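(* Let $n\ge2$, $s\in(0,1)$, let $U\subset\mathbb R^n$ be open and bounded, let $t_i\in(0,1)$ with $t_i\to0^+$, and let $E_{t_i}\subset U$, $i\in\mathbb N$, be Lebesgue measurable sets. Assume that there is $M\in\mathbb R$ such that $$\frac{\mathcal E^s_{t_i}(E_{t_i})}{g_s(t_i)}\le M\qquad\text{for all } i\in\mathbb N.$$ Then there exists a measurable set $E\subset U$ such that, up to a subsequence, $\chi_{E_{t_i}}\to\chi_E$ in $L^1(\mathbb R^n)$. Moreover, if $s\in(0,\frac12)$ then $\mathrm P_{2s}(E)<\infty$, while if $s\in[\frac12,1)$ then $\mathrm P(E)<\infty$.
   Context: For $s\in(0,1)$ and $t>0$, $P^s(\cdot,t)$ is the fundamental solution of the fractional heat equation $\partial_t v+(-\Delta)^s v=0$ on $\mathbb R^n$, i.e. $P^s(z,t)=(2\pi)^{-n}\int_{\mathbb R^n}e^{-t|\xi|^{2s}}e^{i\langle z,\xi\rangle}\,d\xi$; it is positive and $\int_{\mathbb R^n}P^s(z,t)\,dz=1$. For measurable $E\subset\mathbb R^n$, with $E^c=\mathbb R^n\setminus E$, $$\mathcal E^s_t(E)=\int_E\int_{E^c}P^s(x-y,t)\,dy\,dx.$$ The scaling is $g_s(t)=t$ for $s\in(0,\frac12)$, $g_{1/2}(t)=t|\log t|$, and $g_s(t)=t^{1/(2s)}$ for $s\in(\frac12,1)$, for $t\in(0,1)$. $\mathrm P(E)=\sup\{\int_E\operatorname{div}\phi\,dx:\phi\in C^1_c(\mathbb R^n,\mathbb R^n),\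 \|\phi\|_\infty\le1\}$ is the De Giorgi perimeter, and for $s<\frac12$, $\mathrm P_{2s}(E)=\int_E\int_{E^c}|x-y|^{-n-2s}\,dx\,dy$. *)

(* Defs.v *)
From HB Require Import structures.
From mathcomp Require Import all_boot all_order all_algebra.
From mathcomp Require Import complex.
From mathcomp Require Import all_classical all_reals all_analysis.

Set Implicit Arguments.
Unset Strict Implicit.
Unset Printing Implicit Defensive.

Import Order.TTheory GRing.Theory Num.Theory.
Import numFieldNormedType.Exports.

Local Open Scope classical_set_scope.
Local Open Scope ring_scope.
Local Open Scope complex_scope.

(* R^n is 'rV[R]_n. Its library norm is the sup norm: it gives the usual open,
   bounded and compact sets, but |x| in the formulas is [enorm] below. *)
Section lebesgue_rV.
Variable R : realType.

(* Cavalieri: vol_{m+1} A = \int_R vol_m {v | (x, v) \in A} dx. Only its values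
   on Borel sets are used. *)
Fixpoint borel_volume (n : nat) : set 'rV[R]_n -> \bar R :=
  match n with
  | 0 => fun A => (\1_A (0 : 'rV[R]_0))%:E
  | m.+1 => fun A =>
     (\int[@lebesgue_measure R]_x
        borel_volume [set v : 'rV[R]_m | A (row_mx (x%:M : 'rV[R]_1) v)])%E
  end.

Lemma borel_volume0 n : @borel_volume n set0 = 0%E.
Proof.
elim: n => [|n IH] /=; first by rewrite indic0.
exact: integral0_eq.
Qed.

Lemma borel_volume_ge0 n (A : set 'rV[R]_n) : (0 <= borel_volume A)%E.
Proof.
elim: n A => [|n IH] A /=; first by rewrite lee_fin.
exact: integral_ge0.
Qed.

Local Notation borel_rV n := (g_sigma_algebraType (@open 'rV[R]_n)).

(* inf of \sum_k vol (B k) over the covers of A by Borel sets B k *)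
Definition lebesgue_outer (n : nat) : set 'rV[R]_n -> \bar R :=
  @mu_ext _ (borel_rV n) R (@borel_volume n).

HB.instance Definition _ n := isOuterMeasure.Build R 'rV[R]_n
  (@lebesgue_outer n)
  (@mu_ext0 _ (borel_rV n) R _ (@borel_volume0 n) (@borel_volume_ge0 n))
  (@mu_ext_ge0 _ (borel_rV n) R _ (@borel_volume_ge0 n))
  (@le_mu_ext _ (borel_rV n) R (@borel_volume n))
  (@mu_ext_sigma_subadditive _ (borel_rV n) R _ (@borel_volume_ge0 n)).

End lebesgue_rV.

(* 'rV[R]_n with the sigma-algebra of Lebesgue measurable sets *)
Notation lebesgue_rV R n := (caratheodory_type (@lebesgue_outer R n)).

Definition leb (R : realType) (n : nat) : set (lebesgue_rV R n) -> \bar R :=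
  @lebesgue_outer R n.
Arguments leb {R n}.

HB.instance Definition _ (R : realType) (n : nat) :=
  isMeasure.Build _ (lebesgue_rV R n) R (@leb R n)
    (@caratheodory_measure0 _ _ (@lebesgue_outer R n))
    (@caratheodory_measure_ge0 _ _ (@lebesgue_outer R n))
    (@caratheodory_measure_sigma_additive _ _ (@lebesgue_outer R n)).

Section definitions.
Variables (R : realType) (n : nat).
Implicit Types (x y z xi : 'rV[R]_n) (s t : R).

Definition dotrV x y : R := \sum_(i < n) x 0 i * y 0 i.
Definition enorm x : R := Num.sqrt (dotrV x x).

Definition expi (a : R) : R[i] := cos a +i* sin a.

Definition Cintegral (f : 'rV[R]_n -> R[i]) : R[i] :=
  (\int[leb]_x complex.Re (f x)) +i* (\int[leb]_x complex.Im (f x)).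

(* The integral is a real number, as xi |-> - xi conjugates the integrand. *)
Definition frac_heat_kernel s z t : R :=
  complex.Re ((((2 * pi) ^- n)%:C : R[i]) *
    Cintegral (fun xi =>
      (expR (- t * enorm xi `^ (2 * s)))%:C * expi (dotrV z xi))).

Definition frac_heat_energy s t (E : set (lebesgue_rV R n)) : \bar R :=
  (\int[leb]_(x in E) \int[leb]_(y in ~` E)
     (frac_heat_kernel s (x - y) t)%:E)%E.

Definition scaling s t : R :=
  if s < 2^-1 then t
  else if s == 2^-1 then t * `|ln t|
  else t `^ (2 * s)^-1.

Definition frac_perimeter s (E : set (lebesgue_rV R n)) : \bar R :=
  (\int[leb]_(x in E) \int[leb]_(y in ~` E)
     (enorm (x - y) `^ (- n%:R - 2 * s))%:E)%E.

Definition C1c (phi : 'rV[R]_n -> 'rV[R]_n) : Prop :=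
  [/\ forall x, differentiable phi x,
      continuous (fun x => 'J phi x) &
      compact (closure [set x | phi x != 0])].

Definition divergence (phi : 'rV[R]_n -> 'rV[R]_n) x : R :=
  \sum_(i < n) 'D_(delta_mx 0 i) (fun y => phi y 0 i) x.

Definition perimeter (E : set (lebesgue_rV R n)) : \bar R :=
  ereal_sup [set (\int[leb]_(x in E) (divergence phi x)%:E)%E |
    phi in [set phi | C1c phi /\ forall x, enorm (phi x) <= 1]].

End definitions.

(* Main.v *)
Require Import Defs.
From HB Require Import structures.
From mathcomp Require Import all_boot all_order all_algebra.
From mathcomp Require Import all_classical all_reals all_analysis.
From mathcomp Require Import measurable_realfun ring lra.

(** Write [m] for the measure of [E] and [e u] for the Gaussian energy of [E]:
    the integral over [E] and its complement of the heat kernel of variance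
    parameter [u].  By Fubini, the integral of a kernel [K (x - y)] over
    [E] x [E] is the integral of the symbol of [K] against the power spectrum of
    [E], the (normalised) squared modulus of the Fourier transform of its
    indicator.  So [m - e u] is the integral of [expR (- u * l)], with [l] the
    square of the
    frequency, against that spectrum (gauss_energyE).  For the fractional kernel
    the mass is at least one, which gives that [m] minus the fractional energy
    is at most the integral of [expR (- t * l `^ s)] (heat_energy_ge).  The
    second statement needs the positivity of the fractional kernel
    (stretched_kernel_ge0): [l `^ s] is a limit of positive combinations of the
    functions [1 - expR (- u * l)], hence its exponential is a limit of products
    of compound Poisson factors, which preserve positivity.

    With [p = 4 `^ s] and [t * p ^+ J <= 1], the sum over [j <= J] of
    [p ^+ j * (1 - expR (- 4 ^- j * l))] is bounded both by a multiple of
    [l `^ s] and by a multiple of [t^-1], so a small multiple of [t] times it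
    stays below [1 - expR (- t * l `^ s)].  Integrating against the power
    spectrum, where a symbol bounded by [b] contributes at most [b * m]
    (fourier_autocorr_le), the fractional energy dominates
    [c * t * \sum_(j < J.+1) p ^+ j * e (4 ^- j)] (dyadic_gauss_energy_le).

    The translation defect of [E] by [h], the measure of the points of [E] that
    [h] moves out of [E], is subadditive in [h] and at most a multiple of
    [e u] when [sqnorm h <= u] (moved_le_gauss_energy).  Conversely [e u] is
    the Gaussian average of the defects (double_integral_moved).  For
    [s >= 1/2] subadditivity makes every fine scale contribute at least what a
    coarse scale does, and the
    scaling of the energy is exactly the one for which the defect at a fixed
    scale [2 ^- k] becomes at most [C * 2 ^- k] (coarse_scale_bound).  For
    [s < 1/2] the sums of [p ^+ j * e (4 ^- j)] are themselves bounded.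

    In both cases [e u] becomes small for a suitable fixed [u].  As [e u]
    controls the distance from the indicator to its Gaussian average, and the
    averages are equi-Lipschitz on a bounded set, the sets cluster along an
    ultrafilter (energy_compactness); a fast Cauchy subsequence converges to its
    upper limit [F].  Defects and Gaussian energies are continuous for the
    measure of the symmetric difference, so the bounds pass to [F].  For
    [s < 1/2] the kernel of the fractional perimeter is at most a combination of
    Gaussian kernels over all dyadic scales (frac_perimeter_lty); for
    [s >= 1/2] a defect linear in [h] bounds the integral over [F] of every
    difference quotient of a test field (perimeter_lty).

    The function [(x, h) |-> \1_E (x + h)] is sure to be measurable on the
    product only for a Borel set [E], so the argument runs on Borel envelopes of
    the given sets. *)

Set Implicit Arguments.
Unset Strict Implicit.
Unset Printing Implicit Defensive.

Import Order.TTheory GRing.Theory Num.Theory.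
Import numFieldNormedType.Exports.

Local Open Scope classical_set_scope.
Local Open Scope ring_scope.

(** * Borel sets, Lebesgue measure and translations of row vectors *)

Notation borel_rV R n := (g_sigma_algebraType (@open 'rV[R]_n)).

Definition join (R : realType) n (p : R * 'rV[R]_n) : 'rV[R]_n.+1 :=
  row_mx (p.1%:M : 'rV[R]_1) p.2.
Arguments join {R n}.

Section borel_structure.
Variable R : realType.

Lemma join0 n (p : R * 'rV[R]_n) : join p 0 0 = p.1.
Proof.
rewrite /join (_ : (0 : 'I_n.+1) = lshift n (ord0 : 'I_1)); last exact: val_inj.
by rewrite (row_mxEl (p.1%:M : 'rV_1) p.2) mxE eqxx.
Qed.

Lemma joinS n (p : R * 'rV[R]_n) i : join p 0 (lift ord0 i) = p.2 0 i.
Proof.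
rewrite /join (_ : lift ord0 i = rshift 1 i); last exact: val_inj.
exact: row_mxEr.
Qed.

Lemma measurable_open n (A : set 'rV[R]_n) :
  open A -> measurable (A : set (borel_rV R n)).
Proof. by move=> oA; exact: sub_sigma_algebra. Qed.

Lemma borel_continuous n (f : 'rV[R]_n -> R) : continuous f ->
  measurable_fun [set: borel_rV R n] f.
Proof.
move=> cf; apply: (measurability _ (RGenOInfty.measurableE R)).
move=> _ [_ [a ->] <-]; rewrite setTI; apply: measurable_open.
by move/continuousP : cf; apply; exact: interval_open.
Qed.

Lemma borel_coord n i : measurable_fun [set: borel_rV R n] (fun x : 'rV[R]_n => x 0 i).
Proof. apply: borel_continuous; exact: coord_continuous. Qed.

(** Open sets are countable unions of rational boxes, so the Borel structure
    is generated by the coordinates. *)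
Lemma measurable_borel_coords d (T : measurableType d) n (f : T -> 'rV[R]_n) :
  (forall i, measurable_fun setT (fun x => f x 0 i)) ->
  measurable_fun setT (f : T -> borel_rV R n).
Proof.
move=> mf; apply: (@measurability _ _ T (borel_rV R n) setT f (@open 'rV[R]_n)).
  by [].
move=> _ [U oU <-]; rewrite setTI.
(* The countable family of boxes with rational centre and radius. *)
pose box (p : 'rV[rat]_n * rat) : set 'rV[R]_n :=
  [set x | forall i, `|ratr (p.1 0 i) - x 0 i| < ratr p.2].
have -> : f @^-1` U = \bigcup_(p in [set p | box p `<=` U]) (f @^-1` box p).
  apply/seteqP; split => [x /= Ux|x [p pU /=]]; last exact: pU.
  move: oU; rewrite openE => /(_ _ Ux); rewrite /interior.
  move=> /nbhs_ballP[e /= e0 eU].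
  have e2 : 0 < e / 2 by rewrite divr_gt0.
  have [r] := rat_in_itvoo e2; rewrite in_itv /= => /andP[r0 re].
  have /choice[q qP] : forall i, exists q : rat, `|ratr q - f x 0 i| < ratr r.
    move=> i.
    have : f x 0 i - ratr r < f x 0 i + ratr r by rewrite ltrD2l gtrN.
    move=> /rat_in_itvoo[q]; rewrite in_itv /= => /andP[q1 q2]; exists q.
    by rewrite ltr_distl q1.
  exists (\row_i q i, r) => /=; last by move=> i /=; rewrite mxE.
  move=> y /= yb; apply: eU; split => // i0 i; rewrite (ord1 i0).
  rewrite -ball_normE /= -(subrK (ratr (q i)) (f x 0 i)) -addrA.
  rewrite (le_lt_trans (ler_normD _ _))// (splitr e) ltrD//.
    by rewrite distrC (lt_trans (qP i)).
  by have := yb i; rewrite mxE => /lt_trans; apply.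
rewrite bigcup_mkcond; apply: countable_bigcupT_measurable => [|p].
  exact: countableP.
case: ifPn => // _.
have -> : f @^-1` box p =
    \big[setI/setT]_(i < n) [set x | `|ratr (p.1 0 i) - f x 0 i| < ratr p.2].
  rewrite -bigcap_seq; apply/seteqP; split => x /= h i => [_|]; first exact: h.
  by apply: h; rewrite /= mem_index_enum.
apply: bigsetI_measurable => i _.
rewrite -[X in measurable X]setTI.
have : measurable_fun setT (fun x => `|ratr (p.1 0 i) - f x 0 i|).
  by apply: measurableT_comp => //; apply: measurable_funB.
move=> /(_ measurableT `]-oo, (ratr p.2)[%classic (measurable_itv _)).
by under eq_set do rewrite in_itv/=.
Qed.

(** [join] between the Borel structures, the map along which the volume in
    dimension [n.+1] is a product measure. *)
Definition bjoin n : measurableTypeR R * borel_rV R n -> borel_rV R n.+1 := join.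

Lemma measurable_bjoin n : measurable_fun setT (@bjoin n).
Proof.
rewrite /bjoin; apply: measurable_borel_coords => i.
have [j ->|->] := unliftP ord0 i.
  under eq_fun do rewrite joinS.
  exact: (measurableT_comp (@borel_coord n j) measurable_snd).
under eq_fun do rewrite join0.
exact: measurable_fst.
Qed.
End borel_structure.

Section volume.
Variable R : realType.
Local Open Scope ereal_scope.

Definition cube n (k : nat) : set 'rV[R]_n := [set x | forall i, (`|x ord0 i| <= k%:R)%R].

Lemma measurable_cube n k : measurable (cube k : set (borel_rV R n)).
Proof.
have -> : @cube n k =
    \big[setI/setT]_(i < n) [set x : borel_rV R n | (`|(x : 'rV[R]_n) ord0 i| <= k%:R)%R].
  rewrite -bigcap_seq; apply/seteqP; split => x /= h i => [_|]; first exact: h.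
  by apply: h; rewrite /= mem_index_enum.
apply: bigsetI_measurable => i _; rewrite -[X in measurable X]setTI.
have : measurable_fun [set: borel_rV R n] (fun x : 'rV[R]_n => `|x ord0 i|%R).
  by apply: measurableT_comp => //; exact: borel_coord.
move=> /(_ measurableT `]-oo, (k%:R)]%classic (measurable_itv _)).
by under eq_set do rewrite in_itv/=.
Qed.

Lemma bigcup_cube n : \bigcup_k @cube n k = setT.
Proof.
apply/seteqP; split => // x _; exists (Num.truncn `|x|%R).+1 => // i.
rewrite (le_trans _ (ltW (truncnS_gt _)))//.
rewrite [leRHS]mx_normrE.
exact: (le_bigmax _ (fun i : 'I_1 * 'I_n => `|x i.1 i.2|%R) (ord0, i)).
Qed.

Lemma borel_volumeSE n (m : set (borel_rV R n) -> \bar R) :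
  m = @borel_volume R n ->
  @borel_volume R n.+1 =
  pushforward (product_measure1 (@lebesgue_measure R) m) (@bjoin R n).
Proof.
move=> mE; apply/funext => A; rewrite /pushforward /product_measure1 mE /=.
apply: eq_integral => x _ /=; congr borel_volume.
by apply/seteqP; split => v; rewrite /xsection /= inE.
Qed.

(** Both halves are proved together: the product measure in the next dimension
    requires the previous volume to be sigma-finite, which the cubes witness. *)
Lemma borel_volume_measure n :
  semi_sigma_additive (@borel_volume R n : set (borel_rV R n) -> _) /\
  (forall k, borel_volume (@cube n k) < +oo).
Proof.
elim: n => [|n [IHs IHc]].
  split=> [|k]; last by rewrite ltry.
  rewrite (_ : @borel_volume R 0 = \d_(0%R : borel_rV R 0)).
    exact: measure_semi_sigma_additive.
  by apply/funext.
pose Mm := isMeasure.Build _ (borel_rV R n) R (@borel_volume R n)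
  (@borel_volume0 R n) (@borel_volume_ge0 R n) IHs.
pose m0 : {measure set (borel_rV R n) -> \bar R} := HB.pack (@borel_volume R n) Mm.
have sm0 : sigma_finite setT m0.
  exists (@cube n); first by rewrite bigcup_cube.
  by move=> k; split; [exact: measurable_cube|exact: IHc].
pose Sm := Measure_isSigmaFinite.Build _ _ R m0 sm0.
pose m : {sigma_finite_measure set (borel_rV R n) -> \bar R} := HB.pack (@borel_volume R n) Mm Sm.
have E := @borel_volumeSE n m erefl.
split.
  rewrite E => F mF tF mUF; rewrite /pushforward preimage_bigcup.
  have mj A : measurable A -> measurable ((@bjoin R n) @^-1` A).
    by move=> mA; rewrite -[X in measurable X]setTI; exact: measurable_bjoin.
  apply: (@measure_semi_sigma_additive _ _ _ (@lebesgue_measure R \x m)).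
  - by move=> k; exact: mj.
  - apply/trivIsetP => /= i j _ _ ij; rewrite -preimage_setI.
    by move/trivIsetP : tF => /(_ _ _ _ _ ij) ->//; rewrite preimage_set0.
  - by rewrite -preimage_bigcup; exact: mj.
move=> k; rewrite E /pushforward.
rewrite (_ : _ @^-1` _ = `[(- k%:R)%R, k%:R%R]%classic `*` @cube n k); last first.
  apply/seteqP; split => -[x v] /=.
    move=> h; split.
      by have := h ord0; rewrite join0 /= in_itv /= ler_norml.
    by move=> i; have := h (lift ord0 i); rewrite joinS.
  move=> [h1 h2] i; have [j ->|->] := unliftP ord0 i.
    by rewrite joinS; exact: h2.
  by rewrite join0; move: h1; rewrite in_itv /= ler_norml.
rewrite [ltLHS](@product_measure1E _ _ _ _ _ (@lebesgue_measure R) m) //; last first.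
  exact: measurable_cube.
rewrite lte_mul_pinfty//; last exact: IHc.
by rewrite [X in X \is a _]lebesgue_measure_itv/=; case: ifP.
Qed.

Definition vol n : set (borel_rV R n) -> \bar R := @borel_volume R n.

HB.instance Definition _ n := isMeasure.Build _ (borel_rV R n) R (@vol n)
  (@borel_volume0 R n) (@borel_volume_ge0 R n) (borel_volume_measure n).1.

Lemma vol_sigma_finite n :
  sigma_finite setT (@vol n : set (borel_rV R n) -> _).
Proof.
exists (@cube n); first by rewrite bigcup_cube.
by move=> k; split; [exact: measurable_cube|exact: (borel_volume_measure n).2].
Qed.

HB.instance Definition _ n := Measure_isSigmaFinite.Build _ (borel_rV R n) R
  (@vol n) (@vol_sigma_finite n).

Lemma leb_borel n (A : set (borel_rV R n)) : measurable A -> leb A = vol A.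
Proof. exact: (@measurable_mu_extE _ _ _ (@vol n)). Qed.

Lemma measurable_borel_leb n (A : set 'rV[R]_n) :
  measurable (A : set (borel_rV R n)) -> measurable (A : set (lebesgue_rV R n)).
Proof. exact: (@caratheodory_measurable_mu_ext _ _ _ (@vol n)). Qed.

Lemma measurable_fun_borel_leb d (T : measurableType d) n (f : 'rV[R]_n -> T) :
  measurable_fun [set: borel_rV R n] f -> measurable_fun [set: lebesgue_rV R n] f.
Proof.
move=> mf _ B mB; apply: measurable_borel_leb; exact: mf.
Qed.

Lemma leb_cube_lty n k : leb (@cube n k) < +oo.
Proof.
by rewrite leb_borel; [exact: (borel_volume_measure n).2|exact: measurable_cube].
Qed.

Lemma leb_sigma_finite n : sigma_finite setT (@leb R n).
Proof.
exists (@cube n); first by rewrite bigcup_cube.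
move=> k; split; last exact: leb_cube_lty.
by apply: measurable_borel_leb; exact: measurable_cube.
Qed.

HB.instance Definition _ n := Measure_isSigmaFinite.Build _ (lebesgue_rV R n) R
  (@leb R n) (@leb_sigma_finite n).

Lemma ge0_integral_leb_borel n (f : 'rV[R]_n -> \bar R) :
  measurable_fun [set: borel_rV R n] f -> (forall x, 0 <= f x) ->
  \int[leb]_x f x = \int[@vol n]_(x in [set: borel_rV R n]) f x.
Proof.
move=> mf f0.
have mid : measurable_fun [set: lebesgue_rV R n] (id : _ -> borel_rV R n).
  by move=> _ B mB; rewrite setTI; exact: measurable_borel_leb.
rewrite -[LHS](@ge0_integral_pushforward _ _ _ _ _ (id : lebesgue_rV R n -> borel_rV R n) mid leb setT f)//.
by apply: eq_measure_integral => A mA _; exact: leb_borel.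
Qed.

(** Cavalieri's definition of the volume read on functions; every integral
    over row vectors is reduced to the line through it. *)
Lemma tonelli_leb n (f : 'rV[R]_n.+1 -> \bar R) :
  measurable_fun [set: borel_rV R n.+1] f -> (forall x, 0 <= f x) ->
  \int[leb]_x f x = \int[@lebesgue_measure R]_x \int[leb]_v f (join (x, v)).
Proof.
move=> mf f0; rewrite ge0_integral_leb_borel//.
transitivity (\int[pushforward (@lebesgue_measure R \x @vol n) (@bjoin R n)]_x f x).
  apply: eq_measure_integral; first exact: measurable_bjoin.
  move=> mj A mA _ /=.
  by have /(congr1 (fun m => m A)) := @borel_volumeSE n (@borel_volume R n) erefl.
rewrite ge0_integral_pushforward//; last exact: measurable_bjoin.
have mfj : measurable_fun setT (f \o (@bjoin R n)).
  by apply: measurableT_comp => //; exact: measurable_bjoin.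
rewrite preimage_setT fubini_tonelli1//; last by move=> z; exact: f0.
apply: eq_integral => x _; rewrite /fubini_F -ge0_integral_leb_borel//.
  exact: (measurableT_comp mfj (measurable_pair1 x)).
by move=> v; exact: f0.
Qed.

Lemma measurable_slice_integral n (f : 'rV[R]_n.+1 -> \bar R) :
  measurable_fun [set: borel_rV R n.+1] f -> (forall x, 0 <= f x) ->
  measurable_fun [set: measurableTypeR R] (fun x => \int[@leb R n]_v f (join (x, v))).
Proof.
move=> mf f0; have mfj := measurableT_comp mf (@measurable_bjoin R n).
have := @measurable_fun_fubini_tonelli_F _ _ _ _ _ (@vol n) _ mfj (fun=> f0 _).
congr measurable_fun; apply/funext => x.
rewrite /fubini_F -ge0_integral_leb_borel//.
  exact: (measurableT_comp mfj (measurable_pair1 x)).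
by move=> v; exact: f0.
Qed.

Lemma ge0_integral_lebesgue_shift (f : R -> \bar R) (h : R) :
  measurable_fun setT f -> (forall x, 0 <= f x) ->
  \int[@lebesgue_measure R]_x f (x + h)%R = \int[@lebesgue_measure R]_x f x.
Proof.
move=> mf f0.
pose tau : measurableTypeR R -> measurableTypeR R := fun x : R => (x + h)%R.
have mh : measurable_fun setT tau by exact: measurable_funD.
rewrite -[LHS](@ge0_integral_pushforward _ _ _ _ _ tau mh (@lebesgue_measure R) setT f)//.
apply: eq_measure_integral => A mA _.
apply/esym; apply: lebesgue_measure_unique mA => X [[a b]/= _ <-].
rewrite /pushforward.
have -> : tau @^-1` `]a, b] = `](a - h)%R, (b - h)%R]%classic.
  by apply/seteqP; split => x; rewrite /= /tau !in_itv/= ltrBlDr lerBrDr.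
rewrite !lebesgue_measure_itv/= !lte_fin ltrD2r -!EFinD.
by case: ifP => // _; congr EFin; ring.
Qed.

Lemma join_shift n (x : R) (v : 'rV[R]_n) (h : 'rV[R]_n.+1) :
  (join (x, v) + h)%R = join (x + h ord0 ord0, v + \row_i h ord0 (lift ord0 i))%R.
Proof.
apply/rowP => i; rewrite mxE; have [j ->|->] := unliftP ord0 i.
  by rewrite !joinS /= !mxE.
by rewrite !join0.
Qed.

Lemma borel_shift n (h : 'rV[R]_n) :
  measurable_fun [set: borel_rV R n] (fun x => x + h : borel_rV R n)%R.
Proof.
apply: measurable_borel_coords => i; under eq_fun do rewrite mxE.
by apply: measurable_funD => //; exact: borel_coord.
Qed.

Lemma ge0_integral_leb_borel_shift n (f : 'rV[R]_n -> \bar R) (h : 'rV[R]_n) :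
  measurable_fun [set: borel_rV R n] f -> (forall x, 0 <= f x) ->
  \int[leb]_x f (x + h)%R = \int[leb]_x f x.
Proof.
elim: n f h => [|n IH] f h mf f0.
  by apply: eq_integral => x _; rewrite (thinmx0 h) addr0.
rewrite tonelli_leb//; last 1 first.
  exact: (measurableT_comp mf (borel_shift h)).
rewrite [RHS](tonelli_leb mf f0).
have mfj := measurableT_comp mf (@measurable_bjoin R n).
pose g x := \int[@leb R n]_v f (join (x, v)).
rewrite -[RHS](@ge0_integral_lebesgue_shift g (h ord0 ord0)); last 2 first.
- by apply: measurable_slice_integral.
- by move=> x; exact: integral_ge0.
apply: eq_integral => x _; rewrite /g.
under eq_integral do rewrite join_shift.
apply: (IH (fun v => f (join (x + h ord0 ord0, v)%R))).
  exact: (measurableT_comp mfj (measurable_pair1 (x + h ord0 ord0)%R)).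
by move=> v; exact: f0.
Qed.

Lemma vol_shift n (h : 'rV[R]_n) (A : set (borel_rV R n)) : measurable A ->
  vol ((fun x : 'rV[R]_n => x + h)%R @^-1` A) = vol A.
Proof.
move=> mA; have mhA : measurable ((fun x : 'rV[R]_n => x + h)%R @^-1` A : set (borel_rV R n)).
  by rewrite -[X in measurable X]setTI; exact: borel_shift.
have := @ge0_integral_leb_borel_shift n (fun x => (\1_A x)%:E) h.
rewrite -(leb_borel mA) -(leb_borel mhA).
have mA' := measurable_borel_leb mA; have mhA' := measurable_borel_leb mhA.
have := integral_indic leb measurableT mA'; rewrite setIT => <-.
have := integral_indic leb measurableT mhA'; rewrite setIT => <-.
apply => //; exact/measurable_EFinP/measurable_indic.
Qed.

(** Translating a cover by Borel sets gives a cover of the same total volume. *)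
Lemma lebesgue_outer_shift n (h : 'rV[R]_n) (A : set 'rV[R]_n) :
  lebesgue_outer ((fun x => x + h)%R @^-1` A) = lebesgue_outer A.
Proof.
have le_shift (k : 'rV[R]_n) (B : set 'rV[R]_n) :
    lebesgue_outer ((fun x => x + k)%R @^-1` B) <= lebesgue_outer B.
  apply: le_ereal_inf_tmp => _ [F [mF BF] <-].
  apply: ereal_inf_lbound; exists (fun i => (fun x => x + k)%R @^-1` F i).
    split=> [i|x /= /BF[i _ Fi]]; last by exists i.
    by rewrite -[X in measurable X]setTI; apply: borel_shift.
  by apply: eq_eseriesr => i _; exact: vol_shift.
apply/eqP; rewrite eq_le le_shift /=.
have := le_shift (- h)%R ((fun x => x + h)%R @^-1` A).
congr (_ <= _)%E; congr lebesgue_outer; apply/seteqP.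
by split => x /=; rewrite subrK.
Qed.

Lemma measurable_shift n (h : 'rV[R]_n) :
  measurable_fun [set: lebesgue_rV R n] (fun x => x + h : lebesgue_rV R n)%R.
Proof.
move=> _ A mA; rewrite setTI.
change (caratheodory_measurable (@lebesgue_outer R n) A) in mA.
change (caratheodory_measurable (@lebesgue_outer R n) ((fun x => x + h)%R @^-1` A)).
move=> X.
have XE : X = (fun x => x + h)%R @^-1` ((fun x => x - h)%R @^-1` X).
  by apply/seteqP; split => x /=; rewrite addrK.
rewrite XE -preimage_setI preimage_setC -preimage_setI !lebesgue_outer_shift.
by rewrite -[LHS](lebesgue_outer_shift (- h)%R); exact: mA.
Qed.

Lemma ge0_integral_leb_shift n (f : 'rV[R]_n -> \bar R) (h : 'rV[R]_n) :
  measurable_fun [set: lebesgue_rV R n] f -> (forall x, 0 <= f x) ->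
  \int[leb]_x f (x + h)%R = \int[leb]_x f x.
Proof.
move=> mf f0.
rewrite -[LHS](@ge0_integral_pushforward _ _ _ _ _ (fun x : lebesgue_rV R n => (x + h)%R : lebesgue_rV R n) (@measurable_shift n h) leb setT f)//.
have mh := @measurable_shift n h.
apply: (@eq_measure_integral _ _ _ _ _
  (measure_function_pushforward__canonical__measure_function_Measure (@leb R n) mh)).
by move=> A mA _; exact: (lebesgue_outer_shift h A).
Qed.
End volume.

(** * The Fourier transform of a Gaussian on the line *)

Section gauss1.
Variable R : realType.
Local Notation mu := (@lebesgue_measure R).
Implicit Types (u z th : R).

Lemma measurable_gauss1 u : measurable_fun [set: R] (fun x : R => expR (- u * x ^+ 2)).
Proof.
apply: continuous_measurable_fun => x.
apply: continuous_comp; last exact: continuous_expR.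
by apply: cvgM; [exact: cvg_cst|exact: exprn_continuous].
Qed.

Lemma gauss1_integral u : 0 < u ->
  (\int[mu]_x (expR (- u * x ^+ 2))%:E = (Num.sqrt (pi / u))%:E)%E.
Proof.
move=> u0; pose sg := Num.sqrt (2 * u)^-1.
have sg2 : sg ^+ 2 = (2 * u)^-1 by rewrite sqr_sqrtr// invr_ge0 mulr_ge0// ltW.
have sg0 : sg != 0 by rewrite sqrtr_eq0 -ltNge invr_gt0 mulr_gt0.
have pk : 0 < normal_peak sg by exact: normal_peak_gt0.
have peakE : (normal_peak sg)^-1 = Num.sqrt (pi / u).
  rewrite /normal_peak invrK sg2; congr Num.sqrt; field.
  by rewrite gt_eqF.
rewrite -peakE.
have : (\int[mu]_x (normal_pdf 0 sg x)%:E =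
    (normal_peak sg)%:E * \int[mu]_x (expR (- u * x ^+ 2))%:E)%E.
  rewrite -ge0_integralZl_EFin//; last 2 first.
  - by apply/measurable_EFinP; exact: measurable_gauss1.
  - exact: ltW.
  apply: eq_integral => x _.
  rewrite normal_pdfE// -EFinM; congr (_ * expR _)%:E.
  rewrite subr0 sg2; field; by rewrite gt_eqF.
rewrite integral_normal_pdf => /(congr1 (fun y => ((normal_peak sg)^-1)%:E * y)%E).
by rewrite mule1 muleA -EFinM mulVf ?gt_eqF// mul1e.
Qed.

Lemma gauss1_integrable u : 0 < u ->
  mu.-integrable setT (EFin \o (fun x : R => expR (- u * x ^+ 2))).
Proof.
move=> u0; apply/integrableP; split.
  by apply/measurable_EFinP; exact: measurable_gauss1.
under eq_integral => x _ do rewrite /= ger0_norm ?expR_ge0//.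
by rewrite gauss1_integral// ltry.
Qed.

(** The bound under which the Gaussian integral may be differentiated in the
    frequency: half of the exponent absorbs the linear factor. *)
Lemma gauss1_moment_bound u (x : R) : 0 < u ->
  (1 + `|x|) * expR (- u * x ^+ 2) <= (2 + 4 / u) * expR (- (u / 2) * x ^+ 2).
Proof.
move=> u0.
have -> : - u * x ^+ 2 = - (u / 2) * x ^+ 2 - (u / 2) * x ^+ 2 by field.
rewrite expRD mulrA mulrAC ler_wpM2r ?expR_ge0//.
rewrite expRN ler_pdivrMr ?expR_gt0//.
have h : 1 + u / 2 * x ^+ 2 <= expR (u / 2 * x ^+ 2) by exact: expR_ge1Dx.
apply: (@le_trans _ _ ((2 + 4 / u) * (1 + u / 2 * x ^+ 2))); last first.
  by rewrite ler_wpM2l// addr_ge0// divr_ge0// ltW.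
have -> : (2 + 4 / u) * (1 + u / 2 * x ^+ 2) = 2 + 4 / u + (u + 2) * x ^+ 2.
  by field; rewrite gt_eqF.
have : `|x| <= 1 + x ^+ 2.
  rewrite -real_normK ?num_real//; have := normr_ge0 x; set y := `|x|; nra.
have : 0 <= 4 / u by rewrite divr_ge0// ltW.
have := sqr_ge0 x; set y := `|x|; set w := x ^+ 2; set v := 4 / u; nra.
Qed.

Lemma integrable_ge0_dominated d (T : measurableType d)
    (m : {measure set T -> \bar R}) (f g : T -> R) :
  measurable_fun setT f -> m.-integrable setT (EFin \o g) ->
  (forall x, `|f x| <= g x) -> m.-integrable setT (EFin \o f).
Proof.
move=> mf ig fg; apply: le_integrable ig => //; first exact/measurable_EFinP.
by move=> x _ /=; rewrite lee_fin (le_trans (fg x))// ler_norm.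
Qed.

Lemma integrable_scale d (T : measurableType d) (m : {measure set T -> \bar R})
    (c : R) (f : T -> R) : m.-integrable setT (EFin \o f) ->
  m.-integrable setT (EFin \o (fun p => c * f p)).
Proof. exact: integrableZl. Qed.

Lemma dominated_convergence_real d (T : measurableType d)
    (m : {measure set T -> \bar R}) (f_ : nat -> T -> R) (f g : T -> R) :
  (forall n, measurable_fun setT (f_ n)) ->
  (forall x, f_ ^~ x @ \oo --> f x) ->
  m.-integrable setT (EFin \o g) ->
  (forall n x, `|f_ n x| <= g x) ->
  [/\ measurable_fun setT f, m.-integrable setT (EFin \o f) &
   (\int[m]_x (f_ n x)%:E)%E @[n --> \oo] --> (\int[m]_x (f x)%:E)%E].
Proof.
move=> mf_ cf ig fg.
have mf : measurable_fun setT f by exact: (measurable_fun_cvg mf_).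
have [|||||iF _ cF] := @dominated_convergence _ _ _ m setT measurableT
  (fun n => EFin \o f_ n) (EFin \o f) (EFin \o g).
- by move=> n; exact/measurable_EFinP.
- exact/measurable_EFinP.
- by apply: aeW => x _; apply: cvg_EFin; [exact: nearW|exact: cf].
- by [].
- by apply: aeW => x n _; exact: fg.
by [].
Qed.

Section derivative_integral.
Variables (g k G : R -> R).
Hypothesis dg : forall x : R, is_derive x 1 g (k x).
Hypothesis ck : continuous k.
Hypothesis iG : mu.-integrable setT (EFin \o G).
Hypothesis kG : forall x, `|k x| <= G x.
Hypothesis g_cvg : g n.+1%:R - g (- n.+1%:R) @[n --> \oo] --> (0 : R).

(** By the fundamental theorem of calculus on growing intervals. *)
Lemma integral_derivative_eq0 : (\int[mu]_x (k x)%:E = 0)%E.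
Proof.
have mk : measurable_fun setT k by exact: continuous_measurable_fun.
pose f_ (n : nat) x := ((k \_ `[- n.+1%:R, n.+1%:R]) x).
have [||//||_ _] := @dominated_convergence_real _ _ mu f_ k G.
- move=> n; apply/(measurable_restrictT _ _).1; first exact: measurable_itv.
  exact: measurable_funS mk.
- move=> x; apply: cvg_near_cst; near=> n.
  rewrite /f_ patchE ifT// inE /= in_itv /= -ler_norml.
  near: n; exists (Num.truncn `|x|) => // n /= xn.
  by rewrite (le_trans (ltW (truncnS_gt _)))// ler_nat ltnS.
- move=> n x; rewrite /f_ patchE; case: ifPn => // _.
  by rewrite normr0 (le_trans _ (kG x)).
suff -> : (fun n => \int[mu]_x (f_ n x)%:E)%E = (fun n => (g n.+1%:R - g (- n.+1%:R))%:E).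
  move=> h; apply: (cvg_unique (@ereal_hausdorff R) h).
  by apply: cvg_EFin; [exact: nearW|exact: g_cvg].
apply/funext => n.
rewrite (_ : (fun x => (f_ n x)%:E) = (EFin \o k) \_ `[- n.+1%:R, n.+1%:R]); last first.
  by rewrite restrict_EFin.
rewrite -integral_mkcond EFinB.
have cg : continuous g by move=> x; apply: differentiable_continuous; exact/derivable1_diffP.
apply: continuous_FTC2 => //.
- by rewrite gtrN.
- exact: continuous_subspaceT.
- split=> [x _||].
  + by have [] := dg x.
  + exact/cvg_at_right_filter/cg.
  + exact/cvg_at_left_filter/cg.
- by move=> x _; rewrite derive1E derive_val.
Unshelve. all: end_near. Qed.
End derivative_integral.

Section fourier1.
Variables (u th : R).
Hypothesis u0 : 0 < u.

Let phi z (x : R) := expR (- u * x ^+ 2 + z ^+ 2 / (4 * u)) * cos (z * x + th).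
Let dphi z (x : R) := expR (- u * x ^+ 2 + z ^+ 2 / (4 * u)) *
  (z / (2 * u) * cos (z * x + th) - x * sin (z * x + th)).

Let der_phi z x : is_derive z 1 (phi ^~ x) (dphi z x).
Proof.
rewrite /phi /dphi; apply: is_derive_eq; rewrite /GRing.scale /=.
by field; rewrite gt_eqF.
Qed.

Let g z (x : R) := (2 * u)^-1 * expR (- u * x ^+ 2 + z ^+ 2 / (4 * u)) * sin (z * x + th).

Let der_g z (x : R) : is_derive x 1 (g z) (dphi z x).
Proof.
rewrite /g /dphi; apply: is_derive_eq; rewrite /GRing.scale /=.
by field; rewrite gt_eqF.
Qed.

Let G (M x : R) := expR (M ^+ 2 / (4 * u)) * (M / (2 * u) + 1) * (2 + 4 / u) *
  expR (- (u / 2) * x ^+ 2).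

Let iG M : mu.-integrable setT (EFin \o G M).
Proof.
apply: integrable_scale.
by apply: gauss1_integrable; rewrite divr_gt0.
Qed.

Let dphi_G (M z x : R) : `|z| <= M -> `|dphi z x| <= G M x.
Proof.
move=> zM; have M0 : 0 <= M by exact: le_trans zM.
rewrite /dphi /G expRD normrM ger0_norm; last by rewrite mulr_ge0// expR_ge0.
have h1 : expR (z ^+ 2 / (4 * u)) <= expR (M ^+ 2 / (4 * u)).
  rewrite ler_expR ler_pM2r ?invr_gt0 ?mulr_gt0//.
  by rewrite -real_normK ?num_real// lerXn2r// nnegrE.
have h2 : `|z / (2 * u) * cos (z * x + th) - x * sin (z * x + th)| <=
    (M / (2 * u) + 1) * (1 + `|x|).
  rewrite (le_trans (ler_normB _ _))//.
  have -> : (M / (2 * u) + 1) * (1 + `|x|) =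
    M / (2 * u) * 1 + (M / (2 * u) * `|x| + (1 + `|x| * 1)) by ring.
  have Mu : 0 <= M / (2 * u) by rewrite divr_ge0// mulr_ge0// ltW.
  rewrite lerD//.
    rewrite normrM ler_pM//; last exact: cos_max.
    rewrite normf_div [`|2 * u|]gtr0_norm ?mulr_gt0//.
    by rewrite ler_pM2r// invr_gt0 mulr_gt0.
  rewrite -[leLHS]add0r lerD//; first by rewrite mulr_ge0.
  rewrite -[leLHS]add0r lerD// normrM ler_wpM2l//.
  by rewrite ler_norml sin_geN1 sin_le1.
have h3 := gauss1_moment_bound x u0.
have K0 : 0 <= M / (2 * u) + 1 by rewrite addr_ge0// divr_ge0// mulr_ge0// ltW.
move: h1 h2 h3 K0 (expR_ge0 (- u * x ^+ 2)) (expR_ge0 (z ^+ 2 / (4 * u))).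
move: (expR_ge0 (M ^+ 2 / (4 * u))) (normr_ge0 (z / (2 * u) * cos (z * x + th) - x * sin (z * x + th))).
set N := `|_ - _|; set K := _ + 1; set w := 1 + `|x|; set B := expR (M ^+ 2 / _).
set b := expR (z ^+ 2 / _); set a := expR (- u * _); set C := 2 + _; set e := expR (- (u / 2) * _).
move=> B0 N0 bB NKw waCe K0 a0 b0.
apply: (@le_trans _ _ (a * B * (K * w))).
  by apply: ler_pM => //; [exact: mulr_ge0|rewrite ler_wpM2l].
have -> : a * B * (K * w) = B * K * (w * a) by ring.
by rewrite -[leRHS]mulrA ler_wpM2l// mulr_ge0.
Qed.

Let mphi z : measurable_fun setT (phi z).
Proof.
apply: continuous_measurable_fun => x.
apply: differentiable_continuous; apply/derivable1_diffP.
by rewrite /phi; apply: ex_derive.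
Qed.

Let mdphi z : continuous (dphi z).
Proof.
move=> x; apply: differentiable_continuous; apply/derivable1_diffP.
by rewrite /dphi; apply: ex_derive.
Qed.

Let iphi z : mu.-integrable setT (EFin \o phi z).
Proof.
apply: (@integrable_ge0_dominated _ _ mu (phi z)
  (fun x : R => expR (z ^+ 2 / (4 * u)) * expR (- u * x ^+ 2))).
- exact: mphi.
- by apply: integrable_scale; exact: gauss1_integrable.
move=> x; rewrite /phi expRD normrM ger0_norm ?mulr_ge0 ?expR_ge0//.
by rewrite [leRHS]mulrC ler_piMr ?mulr_ge0 ?expR_ge0// cos_max.
Qed.

Let Phi z := (\int[mu]_x phi z x)%R.

Let int_dphi z : (\int[mu]_x dphi z x)%R = 0.
Proof.
pose c := (2 * u)^-1 * expR (z ^+ 2 / (4 * u)).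
have c0 : 0 <= c by rewrite mulr_ge0 ?expR_ge0// invr_ge0 mulr_ge0// ltW.
have gb n (x : R) : `|x| = n.+1%:R -> `|g z x| <= c / u * harmonic n.
  move=> xn; rewrite /g addrC expRD mulrA -/c normrM.
  rewrite (le_trans (_ : _ <= `|c * expR (- u * x ^+ 2)|))//.
    by rewrite ler_piMr// ler_norml sin_geN1 sin_le1.
  rewrite (ger0_norm (mulr_ge0 c0 (expR_ge0 _))) -mulrA ler_wpM2l//.
  rewrite mulNr expRN /harmonic -invfM lef_pV2 ?posrE ?expR_gt0 ?mulr_gt0//.
  apply: le_trans (expR_ge1Dx _); rewrite -real_normK ?num_real// xn.
  have : (1 : R) <= n.+1%:R by rewrite ler1n.
  move=> w1.
  rewrite -[leLHS]add0r lerD// ler_wpM2l ?(ltW u0)// expr2 ler_peMr//.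
have gcvg : g z n.+1%:R - g z (- n.+1%:R) @[n --> \oo] --> (0 : R).
  apply: norm_cvg0.
  apply: (@squeeze_cvgr _ _ _ _ (cst 0) (fun n => (c / u * 2) * harmonic n)).
  - apply: nearW => n /=; rewrite normr_ge0 /= (le_trans (ler_normB _ _))//.
    rewrite mulrAC mulr_natr mulr2n lerD// gb// ?normrN ger0_norm//.
  - exact: cvg_cst.
  - rewrite -[X in _ --> X](mulr0 (c / u * 2)); apply: cvgMr; exact: cvg_harmonic.
rewrite /Rintegral.
by rewrite (integral_derivative_eq0 (der_g z) (@mdphi z) (iG `|z|) (fun x => dphi_G x (lexx `|z|)) gcvg).
Qed.

Let der_Phi z : is_derive z 1 Phi 0.
Proof.
have zI : `]z - 1, z + 1[%classic z by rewrite /= in_itv /= ltrBlDr ltrDl ltr01.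
have dd x y : derivable (phi ^~ y) x 1 by [].
have dE x y : partial1of2 phi x y = dphi x y.
  by rewrite partial1of2E; case: (der_phi x y) => _ ->.
have bd x y : `](z - 1), (z + 1)[%classic x -> [set: R] y -> `|partial1of2 phi x y| <= G (`|z| + 1) y.
  move=> xI _; rewrite dE; apply: dphi_G.
  move: xI; rewrite /= in_itv/= => /andP[x1 x2].
  have : `|x - z| < 1 by rewrite ltr_distl x1.
  have := ler_normD (x - z) z; rewrite subrK; lra.
have G0 y : 0 <= G (`|z| + 1) y.
  by apply: le_trans (normr_ge0 _) (dphi_G y (_ : `|z| <= _)); rewrite lerDl.
apply: DeriveDef.
  exact: (@derivable_under_integral _ _ _ mu phi setT measurableT z _ _ zI
   (fun x _ => iphi x) (fun x y _ _ => dd x y) _ G0 (iG _) bd).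
rewrite -derive1E.
rewrite (@differentiation_under_integral _ _ _ mu phi setT measurableT z _ _ zI
   (fun x _ => iphi x) (fun x y _ _ => dd x y) _ G0 (iG _) bd).
by rewrite -[RHS](int_dphi z); apply: eq_Rintegral => x _.
Qed.

Lemma gauss1_fourier_integrable z :
  mu.-integrable setT (EFin \o (fun x : R => expR (- u * x ^+ 2) * cos (z * x + th))).
Proof.
apply: (@integrable_ge0_dominated _ _ mu _ (fun x : R => expR (- u * x ^+ 2))).
- apply: measurable_funM; first exact: measurable_gauss1.
  apply: continuous_measurable_fun => x; apply: differentiable_continuous.
  by apply/derivable1_diffP; apply: ex_derive.
- exact: gauss1_integrable.
- move=> x; rewrite normrM ger0_norm ?expR_ge0//.
  by rewrite ler_piMr ?expR_ge0// cos_max.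
Qed.

(** Multiplied by [expR (z ^+ 2 / (4 * u))], the integral has a derivative in
    [z] that is the integral of an exact derivative, hence zero; so it is
    constant in [z]. *)
Lemma gauss1_fourier z : (\int[mu]_x (expR (- u * x ^+ 2) * cos (z * x + th)))%R =
  Num.sqrt (pi / u) * (expR (- (z ^+ 2 / (4 * u))) * cos th).
Proof.
have : Phi z = Phi 0 by apply: is_derive_0_is_cst.
rewrite /Phi /phi.
under eq_Rintegral => x _ do rewrite addrC expRD -mulrA.
rewrite RintegralZl//; last exact: gauss1_fourier_integrable.
under [RHS]eq_Rintegral => x _ do rewrite expr0n /= !mul0r addr0 add0r.
rewrite RintegralZr//; last exact: gauss1_integrable.
rewrite {2}/Rintegral gauss1_integral//= => E.
by rewrite expRN mulrCA -E mulrA mulVf ?mul1r// gt_eqF ?expR_gt0.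
Qed.

(** The affine combination with [`|b| <= a] is nonnegative, so that this form
    can be iterated over the coordinates by Tonelli. *)
Lemma gauss1_affine (a b z : R) :
  (\int[mu]_x (expR (- u * x ^+ 2) * (a + b * cos (z * x + th)))%:E =
   (Num.sqrt (pi / u) * (a + b * (expR (- (z ^+ 2 / (4 * u))) * cos th)))%:E)%E.
Proof.
have i1 := integrable_scale a (gauss1_integrable u0).
have i2 := integrable_scale b (gauss1_fourier_integrable z).
rewrite [LHS](_ : _ = \int[mu]_x ((a * expR (- u * x ^+ 2))%:E +
   (b * (expR (- u * x ^+ 2) * cos (z * x + th)))%:E))%E; last first.
  by apply: eq_integral => x _; rewrite -EFinD; congr EFin; ring.
rewrite (integralD _ i1 i2)//.
rewrite -(fineK (integrable_fin_num _ i1))// -(fineK (integrable_fin_num _ i2))//.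
rewrite -EFinD; congr EFin.
rewrite -[X in X + _]/(\int[mu]_x (a * expR (- u * x ^+ 2)))%R.
rewrite -[X in _ + X]/(\int[mu]_x (b * (expR (- u * x ^+ 2) * cos (z * x + th))))%R.
rewrite RintegralZl//; last exact: gauss1_integrable.
rewrite RintegralZl//; last exact: gauss1_fourier_integrable.
rewrite gauss1_fourier {1}/Rintegral gauss1_integral//=; ring.
Qed.

End fourier1.

End gauss1.

(** * Measurability through coordinates *)

Section coordinates.
Variable R : realType.

(** Stated coordinatewise so that it applies to maps into both the Borel and
    the Lebesgue structure. *)
Definition measurable_coords d (T : measurableType d) n (f : T -> 'rV[R]_n) :=
  forall i, measurable_fun setT (fun t => f t ord0 i).

Lemma measurable_coords_id n : measurable_coords (id : lebesgue_rV R n -> 'rV[R]_n).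
Proof. by move=> i; apply: measurable_fun_borel_leb; exact: borel_coord. Qed.

Lemma measurable_coords_borel n : measurable_coords (id : borel_rV R n -> 'rV[R]_n).
Proof. by move=> i; exact: borel_coord. Qed.

Lemma measurable_coords_cst d (T : measurableType d) n (a : 'rV[R]_n) :
  measurable_coords (fun _ : T => a).
Proof. by move=> i; exact: measurable_cst. Qed.

Lemma measurable_coords_fst n d (T : measurableType d) :
  measurable_coords (fst : lebesgue_rV R n * T -> 'rV[R]_n).
Proof. by move=> i; exact: (measurableT_comp (@measurable_coords_id n i) measurable_fst). Qed.

Lemma measurable_coords_snd n d (T : measurableType d) :
  measurable_coords (snd : T * lebesgue_rV R n -> 'rV[R]_n).
Proof. by move=> i; exact: (measurableT_comp (@measurable_coords_id n i) measurable_snd). Qed.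

Section ops.
Context d (T : measurableType d) (n : nat).
Implicit Types f g : T -> 'rV[R]_n.

Lemma measurable_coordsB f g : measurable_coords f -> measurable_coords g ->
  measurable_coords (fun t => f t - g t).
Proof.
by move=> mf mg i; under eq_fun do rewrite !mxE; apply: measurable_funB.
Qed.

Lemma measurable_coordsD f g : measurable_coords f -> measurable_coords g ->
  measurable_coords (fun t => f t + g t).
Proof.
by move=> mf mg i; under eq_fun do rewrite !mxE; apply: measurable_funD.
Qed.

Lemma measurable_dotrV f g : measurable_coords f -> measurable_coords g ->
  measurable_fun setT (fun t => dotrV (f t) (g t)).
Proof.
by move=> mf mg; apply: measurable_sum => i; apply: measurable_funM.
Qed.

Lemma measurable_coords_comp (h : 'rV[R]_n -> R) f :
  measurable_fun [set: borel_rV R n] h -> measurable_coords f ->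
  measurable_fun setT (h \o f).
Proof. by move=> mh /measurable_borel_coords mf; exact: measurableT_comp mh mf. Qed.

End ops.
End coordinates.

Section norm_square.
Variable R : realType.

Definition sqnorm n (x : 'rV[R]_n) : R := dotrV x x.

Lemma sqnorm_ge0 n (x : 'rV[R]_n) : 0 <= sqnorm x.
Proof. by apply: sumr_ge0 => i _; rewrite -expr2 sqr_ge0. Qed.

Lemma enorm_sqr n (x : 'rV[R]_n) : enorm x ^+ 2 = sqnorm x.
Proof. by rewrite /enorm sqr_sqrtr// sqnorm_ge0. Qed.

Lemma enorm_ge0 n (x : 'rV[R]_n) : 0 <= enorm x.
Proof. exact: sqrtr_ge0. Qed.

Lemma dotrV_join n (z : 'rV[R]_n.+1) x v :
  dotrV z (join (x, v)) = z ord0 ord0 * x + dotrV (\row_i z ord0 (lift ord0 i)) v.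
Proof.
rewrite /dotrV big_ord_recl join0; congr (_ + _).
by apply: eq_bigr => i _; rewrite joinS !mxE.
Qed.

Lemma sqnorm_join n (x : R) (v : 'rV[R]_n) : sqnorm (join (x, v)) = x ^+ 2 + sqnorm v.
Proof.
rewrite /sqnorm dotrV_join join0 expr2; congr (_ + dotrV _ _).
by apply/rowP => i; rewrite mxE joinS.
Qed.

Lemma dotrVC n (x y : 'rV[R]_n) : dotrV x y = dotrV y x.
Proof. by apply: eq_bigr => i _; rewrite mulrC. Qed.

Lemma dotrVBl n (x y z : 'rV[R]_n) : dotrV (x - y) z = dotrV x z - dotrV y z.
Proof. by rewrite /dotrV -sumrB; apply: eq_bigr => i _; rewrite !mxE mulrBl. Qed.

Lemma sqnormN n (x : 'rV[R]_n) : sqnorm (- x) = sqnorm x.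
Proof. by apply: eq_bigr => i _; rewrite !mxE mulrNN. Qed.

Lemma sqnorm_parallelogram n (x y : 'rV[R]_n) :
  sqnorm (x + y) <= 2 * sqnorm x + 2 * sqnorm y.
Proof.
rewrite /sqnorm /dotrV !mulr_sumr -big_split /=; apply: ler_sum => i _.
rewrite !mxE; set a := x _ _; set b := y _ _; have := sqr_ge0 (a - b); nra.
Qed.

End norm_square.

(** * Gaussian integrals in higher dimension *)

Section gaussn.
Variable R : realType.
Implicit Types (u a b th : R).

Lemma measurable_cosR : measurable_fun [set: R] (@cos R).
Proof. by apply: continuous_measurable_fun; exact: continuous_cos. Qed.

Lemma measurable_sinR : measurable_fun [set: R] (@sin R).
Proof. by apply: continuous_measurable_fun; exact: continuous_sin. Qed.

Lemma integral_leb0 (f : 'rV[R]_0 -> \bar R) : (\int[leb]_x f x = f 0%R)%E.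
Proof.
rewrite (eq_integral (cst (f 0%R))); last by move=> x _; rewrite (thinmx0 x).
have leb1 : leb [set: lebesgue_rV R 0] = 1%E.
  by rewrite leb_borel// /vol /= indicE in_setT.
rewrite -[RHS]mule1 -leb1; exact: integral_cst.
Qed.

Lemma measurable_gauss_affine d (T : measurableType d) n u a b th (z : 'rV[R]_n) (f : T -> 'rV[R]_n) :
  measurable_coords f ->
  measurable_fun setT (fun t => expR (- u * sqnorm (f t)) * (a + b * cos (dotrV z (f t) + th))).
Proof.
move=> mf; apply: measurable_funM.
  apply: measurableT_comp => //; apply: measurable_funM => //.
  exact: measurable_dotrV.
apply: measurable_funD => //; apply: measurable_funM => //.
apply: measurableT_comp; first exact: measurable_cosR.
by apply: measurable_funD => //; apply: measurable_dotrV => //.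
Qed.

Lemma gauss_affine_ge0 n u a b th (z xi : 'rV[R]_n) : `|b| <= a ->
  0 <= expR (- u * sqnorm xi) * (a + b * cos (dotrV z xi + th)).
Proof.
move=> ba; rewrite mulr_ge0 ?expR_ge0//.
have := cos_max (dotrV z xi + th); set c := cos _ => c1.
have : `|b * c| <= a by rewrite normrM (le_trans _ ba)// ler_piMr.
by rewrite ler_norml => /andP[+ _]; lra.
Qed.

(** Splitting off one coordinate, the phase [th] of the remaining cosine
    absorbs the frequency of the coordinate that was split off. *)
Lemma gauss_affine n u a b th (z : 'rV[R]_n) : 0 < u -> `|b| <= a ->
  (\int[leb]_xi (expR (- u * sqnorm xi) * (a + b * cos (dotrV z xi + th)))%:E =
   (Num.sqrt (pi / u) ^+ n * (a + b * (expR (- (sqnorm z / (4 * u))) * cos th)))%:E)%E.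
Proof.
move=> u0; elim: n b th z => [|n IH] b th z ba.
  rewrite integral_leb0 /sqnorm /dotrV !big_ord0 mulr0 mul0r oppr0 expR0 expr0.
  by rewrite add0r !mul1r.
rewrite tonelli_leb; last 2 first.
- apply/measurable_EFinP; apply: measurable_gauss_affine.
  exact: measurable_coords_borel.
- by move=> xi; rewrite lee_fin gauss_affine_ge0.
pose z' : 'rV[R]_n := \row_i z ord0 (lift ord0 i).
set K := Num.sqrt (pi / u).
set e' := expR (- (sqnorm z' / (4 * u))).
have e'1 : e' <= 1.
  by rewrite expR_le1 oppr_le0 divr_ge0 ?sqnorm_ge0// mulr_ge0// ltW.
have inner (x : R) : (\int[leb]_v (expR (- u * sqnorm (join (x, v))) *
    (a + b * cos (dotrV z (join (x, v)) + th)))%:E =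
   (K ^+ n)%:E * (expR (- u * x ^+ 2) * (a + (b * e') * cos (z ord0 ord0 * x + th)))%:E)%E.
  rewrite [LHS](_ : _ = \int[leb]_v ((expR (- u * x ^+ 2))%:E *
     (expR (- u * sqnorm v) * (a + b * cos (dotrV z' v + (z ord0 ord0 * x + th))))%:E))%E;
    last first.
    apply: eq_integral => v _; rewrite sqnorm_join dotrV_join -EFinM; congr EFin.
    rewrite (mulrDr (- u)) expRD -mulrA; congr (_ * (_ * (a + b * cos _))).
    by rewrite addrCA addrA.
  rewrite ge0_integralZl_EFin; last 4 first.
  - by [].
  - by move=> v _; rewrite lee_fin gauss_affine_ge0.
  - apply/measurable_EFinP; apply: measurable_gauss_affine.
    exact: measurable_coords_id.
  - exact: expR_ge0.
  rewrite IH// -!EFinM; congr EFin; rewrite -/K -/e'; ring.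
under eq_integral do rewrite inner.
rewrite ge0_integralZl_EFin; last 4 first.
- by [].
- move=> x _; rewrite lee_fin mulr_ge0 ?expR_ge0//.
  have := cos_max (z ord0 ord0 * x + th); set c := cos _ => c1.
  have : `|b * e' * c| <= a.
    rewrite -mulrA normrM (le_trans _ ba)// ler_piMr// normrM mulr_ile1//.
    by rewrite ger0_norm ?expR_ge0.
  by rewrite ler_norml => /andP[+ _]; lra.
- apply/measurable_EFinP; apply: measurable_funM; first exact: measurable_gauss1.
  apply: measurable_funD => //; apply: measurable_funM => //.
  apply: measurableT_comp; first exact: measurable_cosR.
  by apply: measurable_funD => //; exact: measurable_funM.
- by rewrite exprn_ge0 ?sqrtr_ge0.
rewrite gauss1_affine// -EFinM; congr EFin.
have -> : expR (- (sqnorm z / (4 * u))) = e' * expR (- (z ord0 ord0 ^+ 2 / (4 * u))).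
  rewrite /e' -expRD; congr expR.
  rewrite {1}/sqnorm {1}/dotrV big_ord_recl -expr2.
  rewrite (_ : \sum_(i < n) _ = sqnorm z'); first by ring.
  by apply: eq_bigr => i _; rewrite !mxE.
by rewrite -/K (exprS K n); ring.
Qed.
End gaussn.

(** * Integrability of the stretched exponential *)

Section integrability.
Variable R : realType.
Local Notation mu := (@lebesgue_measure R).

Lemma integrable_ge0 d (T : measurableType d) (m : {measure set T -> \bar R})
    (f : T -> R) : measurable_fun setT f -> (forall p, 0 <= f p) ->
  (\int[m]_p (f p)%:E < +oo)%E -> m.-integrable setT (EFin \o f).
Proof.
move=> mf f0 foo; apply/integrableP; split; first exact/measurable_EFinP.
by under eq_integral => p _ do rewrite /= ger0_norm//.
Qed.

Lemma integral_leb_prod n (h : R -> R) (I : R) :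
  measurable_fun setT h -> (forall x, 0 <= h x) ->
  (\int[mu]_x (h x)%:E = I%:E)%E ->
  (\int[@leb R n]_x (\prod_(i < n) h ((x : 'rV[R]_n) ord0 i))%:E = (I ^+ n)%:E)%E.
Proof.
move=> mh h0 hI.
have mp m d (T : measurableType d) (f : T -> 'rV[R]_m) : measurable_coords f ->
    measurable_fun setT (fun x => \prod_(i < m) h (f x ord0 i)).
  by move=> mf; apply: measurable_prod => i _; exact: measurableT_comp mh (mf i).
elim: n => [|n IH].
  by rewrite integral_leb0 big_ord0 expr0.
have p0 m (x : 'rV[R]_m) : 0 <= \prod_(i < m) h (x ord0 i) by apply: prodr_ge0.
rewrite tonelli_leb; last 2 first.
- by apply/measurable_EFinP; apply: mp; exact: measurable_coords_borel.
- by move=> x; rewrite lee_fin.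
have inner x : (\int[@leb R n]_v (\prod_(i < n.+1) h (join (x, v) ord0 i))%:E =
   (I ^+ n)%:E * (h x)%:E)%E.
  rewrite [LHS](_ : _ = \int[@leb R n]_v ((h x)%:E * (\prod_(i < n) h ((v : 'rV[R]_n) ord0 i))%:E))%E;
    last first.
    apply: eq_integral => v _; rewrite big_ord_recl join0 -EFinM; congr (_ * _)%:E.
    by apply: eq_bigr => i _; rewrite joinS.
  rewrite ge0_integralZl_EFin; last 4 first.
  - by [].
  - by move=> v _; rewrite lee_fin.
  - by apply/measurable_EFinP; apply: mp; exact: measurable_coords_id.
  - exact: h0.
  by rewrite IH muleC.
have I0 : 0 <= I by rewrite -lee_fin -hI integral_ge0// => x _; rewrite lee_fin.
under eq_integral do rewrite inner.
rewrite ge0_integralZl_EFin; last 4 first.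
- by [].
- by move=> x _; rewrite lee_fin.
- exact/measurable_EFinP.
- exact: exprn_ge0.
by rewrite hI -EFinM exprSr.
Qed.

(** An integrable profile on the line whose products over the coordinates
    dominate any stretched exponential. *)
Definition decay (x : R) : R := (1 + `|x|) ^- 2.

Lemma decay_ge0 x : 0 <= decay x.
Proof. by rewrite invr_ge0 exprn_ge0// addr_ge0. Qed.

Lemma continuous_decay : continuous decay.
Proof.
move=> x; apply: cvgV.
  by rewrite expf_neq0// gt_eqF// ltr_pwDl.
apply: (continuous_comp (f := fun x : R => 1 + `|x|) (g := fun y => y ^+ 2)).
  by apply: cvgD; [exact: cvg_cst|exact: norm_continuous].
exact: exprn_continuous.
Qed.

Lemma is_derive_decay (x : R) : 0 <= x ->
  is_derive x 1 (fun y : R => - (1 + y)^-1) (decay x).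
Proof.
move=> x0; have x10 : 1 + x != 0 by rewrite gt_eqF// ltr_pwDl.
have d1 : is_derive x (1 : R) (cst 1 + id : R -> R) 1.
  by apply: is_derive_eq; rewrite add0r.
have d2 := is_deriveN (@is_deriveV _ (cst 1 + id) _ _ _ x10 d1).
have -> : decay x = - (- (cst 1 + id : R -> R) x ^- 2)%:A.
  by rewrite /decay ger0_norm// /GRing.scale /= mulr1 opprK.
exact: d2.
Qed.

Lemma integral_decay : (\int[mu]_x (decay x)%:E = 2%:E)%E.
Proof.
rewrite ge0_symfun_integralT; last 3 first.
- exact: decay_ge0.
- exact: continuous_decay.
- by move=> x /=; rewrite /decay normrN.
rewrite -set_itvcy (@ge0_continuous_FTC2y _ decay (fun x => - (1 + x)^-1) 0 0).
- by rewrite addr0 invr1 EFinN oppeK add0e mule1.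
- by move=> x _; exact: decay_ge0.
- exact/continuous_subspaceT/continuous_decay.
- rewrite -[X in _ --> X]oppr0; apply: cvgN; apply/gtr0_cvgV0.
    by near=> x; rewrite addr_gt0//; near: x; exact: nbhs_pinfty_gt.
  exact: cvg_addrl.
- by move=> x x0; have [] := is_derive_decay (ltW x0).
- apply: cvg_at_right_filter; apply: cvgN; apply: cvgV.
    by rewrite addr0 oner_neq0.
  by apply: cvgD; [exact: cvg_cst|exact: cvg_id].
- move=> x; rewrite in_itv /= andbT => x0.
  by rewrite derive1E; have [_ ->] := is_derive_decay (ltW x0).
Unshelve. all: end_near. Qed.

Lemma prod_decay n (x : 'rV[R]_n) :
  (4 * Num.max 1 (sqnorm x)) ^- n <= \prod_(i < n) decay (x ord0 i).
Proof.
rewrite -exprVn -[X in _ ^+ X]card_ord -prodr_const.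
apply: ler_prod => i _.
have M1 : 1 <= Num.max 1 (sqnorm x) by rewrite le_max lexx.
rewrite invr_ge0 mulr_ge0//=; last by rewrite (le_trans _ M1).
rewrite lef_pV2 ?posrE; last 2 first.
  by rewrite mulr_gt0// (lt_le_trans _ M1).
  by rewrite exprn_gt0// ltr_pwDl.
have : x ord0 i ^+ 2 <= sqnorm x.
  rewrite /sqnorm /dotrV (bigD1 i)//= -expr2 lerDl.
  by apply: sumr_ge0 => j _; rewrite -expr2 sqr_ge0.
have : sqnorm x <= Num.max 1 (sqnorm x) by rewrite le_max lexx orbT.
rewrite -(real_normK (num_real (x ord0 i))).
have := sqr_ge0 (1 - `|x ord0 i|).
move: M1; set M := Num.max _ _; set a := `|_|; set l := sqnorm _; nra.
Qed.

Lemma measurable_prod_decay d (T : measurableType d) n (f : T -> 'rV[R]_n) :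
  measurable_coords f -> measurable_fun setT (fun p => \prod_(i < n) decay (f p ord0 i)).
Proof.
move=> mf; apply: measurable_prod => i _; apply: measurableT_comp (mf i).
by apply: continuous_measurable_fun; exact: continuous_decay.
Qed.

(** For [N] at least [n / s], [expR (t * l `^ s)] dominates the [N]-th power
    of [c * (1 + l `^ s)], which grows at least like [l ^+ n]. *)
Lemma stretched_bound n (s t : R) : 0 < s -> 0 < t ->
  exists2 C : R, 0 <= C & forall x : 'rV[R]_n,
    expR (- t * sqnorm x `^ s) <= C * \prod_(i < n) decay (x ord0 i).
Proof.
move=> s0 t0.
pose N := (Num.truncn (n%:R / s)).+1.
have sN : n%:R <= s * N%:R.
  by rewrite mulrC -ler_pdivrMr// ltW// truncnS_gt.
pose c := Num.min 1 (t / N%:R).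
have c0 : 0 < c by rewrite lt_min ltr01 divr_gt0.
(* [4 ^+ n] comes from the product of the decay profiles, [c ^- N] from the
   [N]-th power of the lower bound of the exponential. *)
exists (4 ^+ n * c ^- N); first by rewrite mulr_ge0// invr_ge0 exprn_ge0// ltW.
move=> x; set M := Num.max 1 (sqnorm x).
have M1 : 1 <= M by rewrite le_max lexx.
have M0 : 0 < M by exact: lt_le_trans M1.
apply: (@le_trans _ _ (4 ^+ n * c ^- N * (4 * M) ^- n)); last first.
  rewrite ler_wpM2l ?prod_decay// mulr_ge0// invr_ge0 exprn_ge0// ltW//.
rewrite exprMn invfM mulrACA mulfV ?expf_neq0// mul1r.
rewrite mulNr expRN -invfM lef_pV2 ?posrE ?expR_gt0 ?mulr_gt0 ?exprn_gt0//.
set a := sqnorm x `^ s.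
have a0 : 0 <= a by exact: powR_ge0.
have Ma : M `^ s <= 1 + a.
  rewrite /M /Num.max; case: ifPn => _; first by rewrite lerDr.
  by rewrite powR1 lerDl.
have MN : M ^+ n <= (M `^ s) ^+ N.
  rewrite -powR_mulrn ?powR_ge0// -powRrM -powR_mulrn ?(ltW M0)//.
  exact: ler_powR.
apply: (@le_trans _ _ (c ^+ N * (1 + a) ^+ N)).
  rewrite ler_wpM2l ?exprn_ge0 ?(ltW c0)// (le_trans MN)//.
  by rewrite lerXn2r// nnegrE ?powR_ge0// addr_ge0.
rewrite -exprMn.
have -> : t * a = N%:R * (t / N%:R * a) by rewrite mulrA [N%:R * _]mulrC divfK ?pnatr_eq0.
rewrite expRM_natl lerXn2r ?nnegrE ?expR_ge0//.
  by rewrite mulr_ge0 ?addr_ge0// ltW.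
apply: le_trans (expR_ge1Dx _).
rewrite mulrDr mulr1 lerD//; first by rewrite ge_min lexx.
by rewrite ler_wpM2r// ge_min lexx orbT.
Qed.

Lemma powR_sqnorm n (x : 'rV[R]_n) (s : R) : enorm x `^ (2 * s) = sqnorm x `^ s.
Proof. by rewrite powRrM powR_mulrn ?enorm_ge0// enorm_sqr. Qed.

Lemma measurable_sqnorm d (T : measurableType d) n (f : T -> 'rV[R]_n) :
  measurable_coords f -> measurable_fun setT (fun p => sqnorm (f p)).
Proof. by move=> mf; exact: measurable_dotrV. Qed.

Lemma measurable_stretched d (T : measurableType d) n (s t : R) (f : T -> 'rV[R]_n) :
  measurable_coords f ->
  measurable_fun setT (fun p => expR (- t * sqnorm (f p) `^ s)).
Proof.
move=> mf; apply: measurableT_comp => //; apply: measurable_funM => //.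
apply: (measurableT_comp (f := fun x : R => x `^ s)); first exact: measurable_powR.
exact: measurable_sqnorm.
Qed.

Lemma integrable_stretched n (s t : R) : 0 < s -> 0 < t ->
  (@leb R n).-integrable setT (EFin \o (fun x : 'rV[R]_n => expR (- t * sqnorm x `^ s))).
Proof.
move=> s0 t0; have [C C0 hC] := @stretched_bound n s t s0 t0.
apply: (@integrable_ge0_dominated _ _ _ (@leb R n) _ (fun x : 'rV[R]_n => C * \prod_(i < n) decay (x ord0 i))).
- exact: (measurable_stretched s t (@measurable_coords_id R n)).
- apply: integrable_scale; apply: integrable_ge0.
  + exact: (measurable_prod_decay (@measurable_coords_id R n)).
  + by move=> x; apply: prodr_ge0 => i _; exact: decay_ge0.
  rewrite (integral_leb_prod _ _ _ integral_decay) ?ltry//.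
  + by apply: continuous_measurable_fun; exact: continuous_decay.
  + exact: decay_ge0.
- by move=> x; rewrite ger0_norm ?expR_ge0.
Qed.
End integrability.

(** * Powers as limits of Bernstein sums *)

Section bernstein.
Variable R : realType.
Variables (q s : R).
Hypotheses (q1 : 1 < q) (s01 : 0 < s < 1).

Let q0 : 0 < q. Proof. exact: lt_trans q1. Qed.
Let s0 : 0 < s. Proof. by case/andP: s01. Qed.
Let s1 : s < 1. Proof. by case/andP: s01. Qed.
Let p := q `^ s.
Let p0 : 0 < p. Proof. exact: powR_gt0. Qed.

Lemma powR_base_gt1 : 1 < q `^ s.
Proof.
rewrite -(powRr0 q); rewrite /powR !gt_eqF// ltr_expR ltr_pM2r//.
by rewrite ln_gt0.
Qed.

Lemma powR_base_lt : q `^ s < q.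
Proof.
rewrite -[ltRHS](powRr1 (ltW q0)); rewrite /powR !gt_eqF// ltr_expR ltr_pM2r//.
by rewrite ln_gt0.
Qed.

(** The terms with nonnegative index of the sum over all integers [k] of [q `^
    (- s * k) * (1 - expR (- q ^ k * l))]; the terms with negative index are
    given by [bernstein_dn]. *)
Definition bernstein_up (l : R) k := p ^- k * (1 - expR (- (q ^+ k * l))).
Definition bernstein_dn (l : R) k := p ^+ k * (1 - expR (- (q ^- k * l))).

Let oneBexp_ge0 (x : R) : 0 <= x -> 0 <= 1 - expR (- x).
Proof. by move=> x0; rewrite subr_ge0 expR_le1 oppr_le0. Qed.

Lemma bernstein_up_ge0 l k : 0 <= l -> 0 <= bernstein_up l k.
Proof.
move=> l0; apply: mulr_ge0; first by rewrite invr_ge0 exprn_ge0// ltW.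
by apply: oneBexp_ge0; rewrite mulr_ge0// exprn_ge0// ltW.
Qed.

Lemma bernstein_dn_ge0 l k : 0 <= l -> 0 <= bernstein_dn l k.
Proof.
move=> l0; apply: mulr_ge0; first by rewrite exprn_ge0// ltW.
by apply: oneBexp_ge0; rewrite mulr_ge0// invr_ge0 exprn_ge0// ltW.
Qed.

Lemma bernstein_up_le l k : bernstein_up l k <= p^-1 ^+ k.
Proof.
by rewrite exprVn ler_piMr ?invr_ge0 ?exprn_ge0 ?(ltW p0)// gerBl expR_ge0.
Qed.

Lemma bernstein_dn_le l k : bernstein_dn l k <= l * (p / q) ^+ k.
Proof.
have -> : l * (p / q) ^+ k = p ^+ k * (q ^- k * l) by rewrite exprMn exprVn; ring.
rewrite /bernstein_dn ler_wpM2l ?exprn_ge0 ?(ltW p0)//.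
by have := expR_ge1Dx (- (q ^- k * l)); lra.
Qed.

Definition bernstein_term l k := bernstein_up l k + bernstein_dn l k.+1.

Lemma bernstein_term_ge0 l k : 0 <= l -> 0 <= bernstein_term l k.
Proof. by move=> l0; rewrite addr_ge0 ?bernstein_up_ge0 ?bernstein_dn_ge0. Qed.

Let pV_lt1 : `|p^-1| < 1.
Proof. by rewrite ger0_norm ?invr_ge0 ?(ltW p0)// invf_lt1// powR_base_gt1. Qed.

Let pq_lt1 : `|p / q| < 1.
Proof.
rewrite ger0_norm ?divr_ge0 ?(ltW p0) ?(ltW q0)//.
by rewrite ltr_pdivrMr// mul1r powR_base_lt.
Qed.

Lemma bernstein_cvg l : 0 <= l -> cvgn (series (bernstein_term l)).
Proof.
move=> l0; apply: (@series_le_cvg _ _ (geometric 1 p^-1 + geometric (l * (p / q)) (p / q))).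
- by move=> k; exact: bernstein_term_ge0.
- move=> k; rewrite !fctE /geometric /= mul1r addr_ge0//.
    by rewrite exprn_ge0// invr_ge0 ltW.
  have pq0 : 0 <= p / q by rewrite divr_ge0// ltW.
  exact: mulr_ge0 (mulr_ge0 l0 pq0) (exprn_ge0 k pq0).
- move=> k; rewrite !fctE /geometric /= mul1r -mulrA -exprS lerD//.
    exact: bernstein_up_le.
  exact: bernstein_dn_le.
- by apply: is_cvg_seriesD; apply: is_cvg_geometric_series.
Qed.

Definition bernstein l := limn (series (bernstein_term l)).

Lemma bernstein_up_cvg0 l : 0 <= l -> bernstein_up l k @[k --> \oo] --> 0.
Proof.
move=> l0; apply: (@squeeze_cvgr _ _ _ _ (cst 0) (fun k => p^-1 ^+ k)).
- by apply: nearW => k; rewrite bernstein_up_ge0//= bernstein_up_le.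
- exact: cvg_cst.
- exact: cvg_expr.
Qed.

Lemma bernstein_dn_cvg0 l : 0 <= l -> bernstein_dn l k @[k --> \oo] --> 0.
Proof.
move=> l0; apply: (@squeeze_cvgr _ _ _ _ (cst 0) (fun k => l * (p / q) ^+ k)).
- by apply: nearW => k; rewrite bernstein_dn_ge0//= bernstein_dn_le.
- exact: cvg_cst.
- rewrite -[X in _ --> X](mulr0 l); apply: cvgMr; exact: cvg_expr.
Qed.

(** Replacing [l] by [q * l] shifts the index of the two-sided sum by one. *)
Lemma bernstein_scale l : 0 <= l -> bernstein (q * l) = p * bernstein l.
Proof.
move=> l0; have c1 := bernstein_cvg l0.
apply/cvg_lim => //.
have E n : series (bernstein_term (q * l)) n =
    p * (series (bernstein_term l) n + bernstein_up l n - bernstein_dn l n).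
  elim: n => [|n IH].
    rewrite /series /= !big_nil add0r /bernstein_up /bernstein_dn !expr0.
    by rewrite invr1 subrr mulr0.
  rewrite !seriesSr IH /bernstein_term.
  have -> : bernstein_up (q * l) n = p * bernstein_up l n.+1.
    rewrite /bernstein_up mulrA -exprSr mulrA; congr (_ * _).
    by rewrite exprS invfM mulrA mulfV ?mul1r// gt_eqF.
  have -> : bernstein_dn (q * l) n.+1 = p * bernstein_dn l n.
    rewrite /bernstein_dn mulrA exprS; congr (_ * (1 - expR (- _))).
    by rewrite exprSr invfM -mulrA mulKf// gt_eqF.
  ring.
rewrite (_ : series _ = fun n => p * (series (bernstein_term l) n + bernstein_up l n - bernstein_dn l n)); last exact/funext.
rewrite -[X in _ --> p * X]subr0 -[X in _ --> p * (X - _)]addr0.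
apply: cvgMr; apply: cvgB; last exact: bernstein_dn_cvg0.
by apply: cvgD; [exact: c1|exact: bernstein_up_cvg0].
Qed.

Lemma bernstein_partial_le l n : 0 <= l -> series (bernstein_term l) n <= bernstein l.
Proof.
move=> l0; apply: nondecreasing_cvgn_le; last exact: bernstein_cvg.
by apply: nondecreasing_series => k _ _; exact: bernstein_term_ge0.
Qed.

Lemma bernstein_mono l l' : 0 <= l -> l <= l' -> bernstein l <= bernstein l'.
Proof.
move=> l0 ll'; have l'0 := le_trans l0 ll'.
apply: ler_lim; [exact: bernstein_cvg|exact: bernstein_cvg|].
apply: nearW => n; apply: ler_sum => k _; apply: lerD.
  rewrite ler_wpM2l ?invr_ge0 ?exprn_ge0 ?(ltW p0)// lerD2l lerN2 ler_expR lerN2.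
  by rewrite ler_wpM2l// exprn_ge0// ltW.
rewrite ler_wpM2l ?exprn_ge0 ?(ltW p0)// lerD2l lerN2 ler_expR lerN2.
by rewrite ler_wpM2l// invr_ge0 exprn_ge0// ltW.
Qed.

Lemma bernstein1_gt0 : 0 < bernstein 1.
Proof.
apply: (lt_le_trans _ (@bernstein_partial_le 1 1 ler01)).
rewrite /series /= big_nat1 ltr_pwDl ?bernstein_dn_ge0//.
by rewrite /bernstein_up !expr0 invr1 !mul1r subr_gt0 expR_lt1 oppr_lt0.
Qed.

Lemma bernstein_scaleX l k : 0 <= l -> bernstein (q ^+ k * l) = p ^+ k * bernstein l.
Proof.
move=> l0; elim: k => [|k IH]; first by rewrite !expr0 !mul1r.
rewrite exprS -mulrA (bernstein_scale (mulr_ge0 (exprn_ge0 k (ltW q0)) l0)).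
by rewrite IH mulrA -exprS.
Qed.

(** The sum is increasing in [l] and exactly homogeneous under the powers of
    [q], hence homogeneous up to the factor [q `^ s]. *)
Lemma bernstein_homogeneous l : 0 < l ->
  p^-1 * l `^ s <= bernstein l / bernstein 1 <= p * l `^ s.
Proof.
move=> l0; have b1 := bernstein1_gt0.
have exq (x : R) : exists k, x < q ^+ k.
  have lq : 0 < ln q by exact: ln_gt0.
  pose N := (Num.truncn (`|x| / ln q)).+1; exists N.
  have -> : q ^+ N = expR (N%:R * ln q) by rewrite expRM_natl lnK ?posrE.
  apply: (lt_le_trans _ (expR_ge1Dx _)); apply: (@le_lt_trans _ _ `|x|).
    exact: ler_norm.
  apply: (@lt_le_trans _ _ (N%:R * ln q)); last by rewrite lerDr.
  by rewrite -ltr_pdivrMr// truncnS_gt.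
have [m hm] := exq l^-1.
have lm : 1 <= q ^+ m * l by rewrite -ler_pdivrMr// mul1r ltW.
have [[|j] jP jmin] := ex_minnP (exq (q ^+ m * l)).
  by move: jP; rewrite expr0 ltNge lm.
have jq : q ^+ j <= q ^+ m * l.
  by rewrite leNgt; apply/negP => /jmin; rewrite ltnn.
pose u := q ^+ m * l / q ^+ j.
have u1 : 1 <= u by rewrite ler_pdivlMr ?exprn_gt0// mul1r.
have uq : u <= q by rewrite ler_pdivrMr ?exprn_gt0// -exprS ltW.
have u0 : 0 <= u by rewrite (le_trans _ u1).
have uE : q ^+ m * l = q ^+ j * u by rewrite /u [RHS]mulrC divfK// gt_eqF// exprn_gt0.
have bE : p ^+ m * bernstein l = p ^+ j * bernstein u.
  by rewrite -(bernstein_scaleX m (ltW l0)) -(bernstein_scaleX j u0) uE.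
have sE : p ^+ m * l `^ s = p ^+ j * u `^ s.
  have pX k : p ^+ k = (q ^+ k) `^ s.
    elim: k => [|k IH]; first by rewrite !expr0 powR1.
    by rewrite !exprS IH powRM ?exprn_ge0// ltW.
  by rewrite !pX -!powRM ?exprn_ge0 ?(ltW l0) ?(ltW q0)// uE.
have bu1 : bernstein 1 <= bernstein u by exact: bernstein_mono.
have buq : bernstein u <= p * bernstein 1.
  by rewrite -(bernstein_scale ler01) mulr1 bernstein_mono.
have us1 : 1 <= u `^ s.
  have -> : 1 = 1 `^ s by rewrite powR1.
  by rewrite ge0_ler_powR ?nnegrE// ltW.
have usp : u `^ s <= p by rewrite ge0_ler_powR ?nnegrE// ltW.
have pm : 0 < p ^+ m by rewrite exprn_gt0.
have pj : 0 < p ^+ j by rewrite exprn_gt0.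
apply/andP; split.
  rewrite ler_pdivlMr// -(ler_pM2l pm) bE.
  rewrite [leLHS](_ : _ = (p ^+ m * l `^ s) * (p^-1 * bernstein 1)); last by ring.
  rewrite sE -mulrA ler_pM2l//; apply: le_trans bu1.
  by rewrite mulrA ler_piMl ?(ltW b1)// ler_pdivrMr// mul1r.
rewrite ler_pdivrMr// -(ler_pM2l pm) bE.
rewrite [leRHS](_ : _ = (p ^+ m * l `^ s) * (p * bernstein 1)); last by ring.
rewrite sE -mulrA ler_pM2l//; apply: (le_trans buq).
by rewrite ler_peMl// ltW// mulr_gt0.
Qed.

End bernstein.

Section bernstein_limit.
Variable R : realType.
Variable s : R.
Hypothesis s01 : 0 < s < 1.

(** Bases tending to [1], for which the error factor [ratio i `^ s] of
    approximate homogeneity disappears. *)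
Definition ratio i : R := 1 + i.+1%:R^-1.

Lemma ratio_gt1 i : 1 < ratio i.
Proof. by rewrite ltrDl invr_gt0. Qed.

Lemma bernstein_ratio_cvg l : 0 <= l ->
  bernstein (ratio i) s l / bernstein (ratio i) s 1 @[i --> \oo] --> l `^ s.
Proof.
move=> l0; have [s0 s1] := andP s01.
have r0 i : 0 < ratio i by rewrite (lt_trans _ (ratio_gt1 i)).
have [l_gt0|] := ltP 0 l; last first.
  move=> l_le0; have -> : l = 0 by apply/eqP; rewrite eq_le l_le0.
  rewrite powR0 ?gt_eqF//; apply: cvg_near_cst; apply: nearW => i.
  have := bernstein_scale (ratio_gt1 i) s01 (lexx 0); rewrite mulr0.
  move=> h; have : (ratio i `^ s - 1) * bernstein (ratio i) s 0 = 0.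
    by rewrite mulrBl mul1r -h subrr.
  move/eqP; rewrite mulf_eq0 subr_eq0 => /orP[/eqP e|/eqP ->]; last by rewrite mul0r.
  by have := powR_base_gt1 (ratio_gt1 i) s01; rewrite e ltxx.
have ratio_cvg : ratio i @[i --> \oo] --> (1 : R).
  rewrite -[X in _ --> X]addr0; apply: cvgD; first exact: cvg_cst.
  exact: cvg_harmonic.
apply: (@squeeze_cvgr _ _ _ _ (fun i => (ratio i)^-1 * l `^ s) (fun i => ratio i * l `^ s)).
- apply: nearW => i.
  have /andP[h1 h2] := bernstein_homogeneous (ratio_gt1 i) s01 l_gt0.
  have rs := ltW (powR_base_lt (ratio_gt1 i) s01).
  apply/andP; split.
    apply: le_trans h1; rewrite ler_wpM2r ?powR_ge0// lef_pV2 ?posrE//.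
    exact: powR_gt0.
  by apply: le_trans h2 _; rewrite ler_wpM2r ?powR_ge0.
- rewrite -[X in _ --> X]mul1r; apply: cvgMl.
  by rewrite -[X in _ --> X]invr1; apply: cvgV.
- by rewrite -[X in _ --> X]mul1r; apply: cvgMl.
Qed.

End bernstein_limit.

(** * Positivity of the fractional heat kernel *)

Section pos_symbol.
Variables (R : realType) (n : nat).
Implicit Types (f g : R -> R) (d u w t s : R) (z xi : 'rV[R]_n).

Lemma gauss_integral u : 0 < u ->
  (\int[@leb R n]_xi (expR (- u * sqnorm xi))%:E = (Num.sqrt (pi / u) ^+ n)%:E)%E.
Proof.
move=> u0; have := @gauss_affine R n u 1 0 0 0 u0; rewrite normr0 ler01 => /(_ isT).
rewrite mul0r addr0 mulr1 => <-; apply: eq_integral => xi _.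
by rewrite mul0r addr0 mulr1.
Qed.

Lemma measurable_gauss disp (T : measurableType disp) (f : T -> 'rV[R]_n) u : measurable_coords f ->
  measurable_fun setT (fun p => expR (- u * sqnorm (f p))).
Proof.
move=> mf; apply: measurableT_comp => //; apply: measurable_funM => //.
exact: measurable_sqnorm.
Qed.

Lemma gauss_integrable u : 0 < u ->
  (@leb R n).-integrable setT (EFin \o (fun xi => expR (- u * sqnorm xi))).
Proof.
move=> u0; apply: integrable_ge0.
- exact: (measurable_gauss u (@measurable_coords_id R n)).
- by move=> xi; exact: expR_ge0.
- by rewrite gauss_integral// ltry.
Qed.

Lemma measurableM_cos disp (T : measurableType disp) (h : T -> R) (f : T -> 'rV[R]_n) z :
  measurable_fun setT h -> measurable_coords f ->
  measurable_fun setT (fun p => h p * cos (dotrV z (f p))).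
Proof.
move=> mh mf; apply: measurable_funM => //.
by apply: measurableT_comp; [exact: measurable_cosR|exact: measurable_dotrV].
Qed.

Lemma integrableM_cos (h g : 'rV[R]_n -> R) z :
  measurable_fun [set: lebesgue_rV R n] h ->
  (@leb R n).-integrable setT (EFin \o g) -> (forall xi, `|h xi| <= g xi) ->
  (@leb R n).-integrable setT (EFin \o (fun xi => h xi * cos (dotrV z xi))).
Proof.
move=> mh ig hg; apply: (integrable_ge0_dominated _ ig).
  exact: (measurableM_cos z mh (@measurable_coords_id R n)).
by move=> xi; rewrite normrM (le_trans _ (hg xi))// ler_piMr// cos_max.
Qed.

Lemma gauss_cos_integral u z : 0 < u ->
  (\int[leb]_xi (expR (- u * sqnorm xi) * cos (dotrV z xi))%:E =
   (Num.sqrt (pi / u) ^+ n * expR (- (sqnorm z / (4 * u))))%:E)%E.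
Proof.
move=> u0; have := @gauss_affine R n u 1 1 0 z u0; rewrite normr1 lexx => /(_ isT).
have i1 := gauss_integrable u0.
have i2 : (@leb R n).-integrable setT (EFin \o (fun xi => expR (- u * sqnorm xi) * cos (dotrV z xi))).
  apply: (integrableM_cos _ _ i1).
    exact: (measurable_gauss u (@measurable_coords_id R n)).
  by move=> xi; rewrite ger0_norm ?expR_ge0.
rewrite [X in X = _ -> _](_ : _ = \int[leb]_xi ((expR (- u * sqnorm xi))%:E +
    (expR (- u * sqnorm xi) * cos (dotrV z xi))%:E))%E; last first.
  by apply: eq_integral => xi _; rewrite addr0 mul1r mulrDr mulr1 EFinD.
rewrite (integralD _ i1 i2)// [X in (X + _)%E]gauss_integral// => h.
have := congr1 (fun x => x - (Num.sqrt (pi / u) ^+ n)%:E)%E h.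
by rewrite addeAC subee// add0e => ->; rewrite -EFinB cos0; congr EFin; ring.
Qed.

(** The symbols [f (sqnorm xi)] whose inverse Fourier transform is
    nonnegative, tested after damping by a Gaussian because [f] itself need
    not be integrable. *)
Record pos_symbol f : Prop := PosSymbol {
  pos_symbol_meas : measurable_fun [set: lebesgue_rV R n] (fun xi => f (sqnorm xi));
  pos_symbol_bound : exists B, forall l, 0 <= l -> `|f l| <= B;
  pos_symbol_ge0 : forall d z, 0 < d ->
    (0 <= \int[@leb R n]_xi (expR (- d * sqnorm xi) * f (sqnorm xi) * cos (dotrV z xi))%:E)%E
}.

Lemma gaussM_symbol f B d : 0 < d ->
  measurable_fun [set: lebesgue_rV R n] (fun xi => f (sqnorm xi)) ->
  (forall l, 0 <= l -> `|f l| <= B) ->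
  [/\ measurable_fun [set: lebesgue_rV R n] (fun xi => expR (- d * sqnorm xi) * f (sqnorm xi)),
   (@leb R n).-integrable setT (EFin \o (fun xi => B * expR (- d * sqnorm xi))) &
   forall xi, `|expR (- d * sqnorm xi) * f (sqnorm xi)| <= B * expR (- d * sqnorm xi)].
Proof.
move=> d0 mf fB; split.
- by apply: measurable_funM mf; exact: (measurable_gauss d (@measurable_coords_id R n)).
- exact: integrable_scale (gauss_integrable d0).
- move=> xi; rewrite normrM ger0_norm ?expR_ge0// mulrC ler_wpM2r ?expR_ge0//.
  by rewrite fB ?sqnorm_ge0.
Qed.

Lemma pos_symbol_integrable f d z : 0 < d -> pos_symbol f ->
  (@leb R n).-integrable setT
    (EFin \o (fun xi => expR (- d * sqnorm xi) * f (sqnorm xi) * cos (dotrV z xi))).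
Proof.
move=> d0 [mf [B fB] _]; have [m1 i1 b1] := gaussM_symbol d0 mf fB.
exact: integrableM_cos m1 i1 b1.
Qed.

Lemma pos_symbol_cst c : 0 <= c -> pos_symbol (fun=> c).
Proof.
move=> c0; split.
- exact: measurable_cst.
- by exists `|c|.
- move=> d z d0.
  rewrite [leRHS](_ : _ = c%:E * \int[@leb R n]_xi (expR (- d * sqnorm xi) * cos (dotrV z xi))%:E)%E.
    rewrite gauss_cos_integral// -EFinM lee_fin.
    by rewrite !mulr_ge0 ?expR_ge0// exprn_ge0// sqrtr_ge0.
  rewrite -integralZl//; last first.
    apply: (integrableM_cos _ _ (gauss_integrable d0)).
      exact: (measurable_gauss d (@measurable_coords_id R n)).
    by move=> xi; rewrite ger0_norm ?expR_ge0.
  by apply: eq_integral => xi _; rewrite -EFinM mulrAC mulrC.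
Qed.

Lemma pos_symbolD f g : pos_symbol f -> pos_symbol g -> pos_symbol (fun l => f l + g l).
Proof.
move=> pf pg; have [mf [B fB] f0] := pf; have [mg [C gC] g0] := pg; split.
- exact: measurable_funD.
- by exists (B + C) => l l0; rewrite (le_trans (ler_normD _ _))// lerD ?fB ?gC.
- move=> d z d0.
  have := adde_ge0 (f0 d z d0) (g0 d z d0).
  rewrite -(integralD _ (pos_symbol_integrable z d0 pf) (pos_symbol_integrable z d0 pg))//.
  by congr (_ <= _)%E; apply: eq_integral => xi _; rewrite -EFinD; congr EFin; ring.
Qed.

Lemma pos_symbolZ c f : 0 <= c -> pos_symbol f -> pos_symbol (fun l => c * f l).
Proof.
move=> c0 pf; have [mf [B fB] f0] := pf; split.
- exact: measurable_funM.
- by exists (`|c| * B) => l l0; rewrite normrM ler_wpM2l ?fB.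
- move=> d z d0.
  have : (0 <= c%:E * \int[@leb R n]_xi (expR (- d * sqnorm xi) * f (sqnorm xi) * cos (dotrV z xi))%:E)%E.
    by rewrite mule_ge0// f0.
  rewrite -(integralZl _ (pos_symbol_integrable z d0 pf))//.
  by congr (_ <= _)%E; apply: eq_integral => xi _; rewrite -EFinM; congr EFin; ring.
Qed.

Lemma pos_symbol_exp u f : 0 <= u -> pos_symbol f -> pos_symbol (fun l => expR (- u * l) * f l).
Proof.
move=> u0 [mf [B fB] f0]; split.
- by apply: measurable_funM mf; exact: (measurable_gauss u (@measurable_coords_id R n)).
- exists B => l l0; rewrite normrM ger0_norm ?expR_ge0//.
  rewrite (le_trans _ (fB l l0))// ler_piMl// expR_le1 mulNr oppr_le0 mulr_ge0//.
- move=> d z d0; have := f0 (d + u) z (ltr_wpDr u0 d0).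
  congr (_ <= _)%E; apply: eq_integral => xi _.
  by rewrite opprD mulrDl expRD -[in LHS]mulrA !mulrA.
Qed.

Lemma pos_symbol_lim (f_ : nat -> R -> R) f B : (forall m, pos_symbol (f_ m)) ->
  (forall l, 0 <= l -> f_ m l @[m --> \oo] --> f l) ->
  (forall m l, 0 <= l -> `|f_ m l| <= B) -> (forall l, 0 <= l -> `|f l| <= B) ->
  pos_symbol f.
Proof.
move=> pf cf fB' fB; have mf : measurable_fun [set: lebesgue_rV R n] (fun xi => f (sqnorm xi)).
  apply: (measurable_fun_cvg (fun m => pos_symbol_meas (pf m))) => xi _.
  by apply: cf; exact: sqnorm_ge0.
split => //; first by exists B.
move=> d z d0.
have [m1 i1 b1] := gaussM_symbol d0 mf fB.
have [||//||_ _ cvI] := @dominated_convergence_real R _ _ (@leb R n)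
  (fun m xi => expR (- d * sqnorm xi) * f_ m (sqnorm xi) * cos (dotrV z xi))
  (fun xi => expR (- d * sqnorm xi) * f (sqnorm xi) * cos (dotrV z xi))
  (fun xi => B * expR (- d * sqnorm xi)).
- move=> m; have [m2 _ _] := gaussM_symbol d0 (pos_symbol_meas (pf m)) (fB' m).
  exact: (measurableM_cos z m2 (@measurable_coords_id R n)).
- move=> xi; apply: cvgMl; apply: cvgMr; apply: cf; exact: sqnorm_ge0.
- move=> m xi; have [_ _ b2] := gaussM_symbol d0 (pos_symbol_meas (pf m)) (fB' m).
  by rewrite normrM (le_trans _ (b2 xi))// ler_piMr// cos_max.
rewrite -(cvg_lim _ cvI)//; apply: lime_ge; first by apply/cvg_ex; eexists; exact: cvI.
by apply: nearW => m; exact: pos_symbol_ge0.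
Qed.

Lemma pos_symbol_exp_partial w u f m : 0 <= w -> 0 <= u -> pos_symbol f ->
  pos_symbol (fun l => series (exp_coeff (w * expR (- u * l))) m * f l).
Proof.
move=> w0 u0 pf; elim: m => [|m IH].
  rewrite (_ : (fun _ => _) = fun=> 0); first exact: pos_symbol_cst.
  by apply/funext => l; rewrite /series /= big_nil mul0r.
rewrite (_ : (fun _ => _) = fun l => series (exp_coeff (w * expR (- u * l))) m * f l +
    (w ^+ m / m`!%:R) * (expR (- (m%:R * u) * l) * f l)); last first.
  apply/funext => l; rewrite seriesSr mulrDl; congr (_ + _).
  rewrite /exp_coeff /= exprMn -expRM_natl.
  rewrite (_ : m%:R * (- u * l) = - (m%:R * u) * l); ring.
have c0 : 0 <= w ^+ m / m`!%:R by rewrite divr_ge0// exprn_ge0.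
have mu0 : 0 <= m%:R * u by rewrite mulr_ge0.
exact: (pos_symbolD IH (pos_symbolZ c0 (pos_symbol_exp mu0 pf))).
Qed.

Lemma pos_symbol_exp_exp w u f : 0 <= w -> 0 <= u -> pos_symbol f ->
  pos_symbol (fun l => expR (w * expR (- u * l)) * f l).
Proof.
move=> w0 u0 pf; have [_ [B fB] _] := pf.
have xw l : 0 <= l -> w * expR (- u * l) <= w.
  by move=> l0; rewrite ler_piMr// expR_le1 mulNr oppr_le0 mulr_ge0.
apply: (pos_symbol_lim (B := expR w * B) (fun m => pos_symbol_exp_partial m w0 u0 pf)).
- by move=> l l0; apply: cvgMl; exact: is_cvg_series_exp_coeff.
- move=> m l l0; rewrite normrM.
  have x0 : 0 <= w * expR (- u * l) by rewrite mulr_ge0// expR_ge0.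
  have s0 : 0 <= series (exp_coeff (w * expR (- u * l))) m.
    by apply: sumr_ge0 => k _; exact: exp_coeff_ge0.
  rewrite ler_pM ?fB// ger0_norm//.
  apply: (@le_trans _ _ (expR (w * expR (- u * l)))); last by rewrite ler_expR xw.
  apply: nondecreasing_cvgn_le; last exact: is_cvg_series_exp_coeff.
  by apply: nondecreasing_series => k _ _; exact: exp_coeff_ge0.
- move=> l l0; rewrite normrM ger0_norm ?expR_ge0// ler_pM ?expR_ge0 ?fB//.
  by rewrite ler_expR xw.
Qed.

(** The expansion of the exponential of [w * expR (- u * l)] has nonnegative
    coefficients on Gaussian symbols: the transform of a compound Poisson law. *)
Lemma pos_symbol_poisson w u f : 0 <= w -> 0 <= u -> pos_symbol f ->
  pos_symbol (fun l => expR (- (w * (1 - expR (- u * l)))) * f l).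
Proof.
move=> w0 u0 pf; have := pos_symbolZ (expR_ge0 (- w)) (pos_symbol_exp_exp w0 u0 pf).
congr pos_symbol; apply/funext => l; rewrite mulrA -expRD; congr (expR _ * _); ring.
Qed.

Lemma pos_symbol_bernstein_partial q s t m : 1 < q -> 0 <= t ->
  pos_symbol (fun l => expR (- (t * series (bernstein_term q s l) m))).
Proof.
move=> q1 t0; have q0 : 0 <= q by rewrite (le_trans _ (ltW q1)).
elim: m => [|m IH].
  rewrite (_ : (fun _ => _) = fun=> 1); first exact: pos_symbol_cst.
  by apply/funext => l; rewrite /series /= big_nil mulr0 oppr0 expR0.
have := @pos_symbol_poisson (t * (q `^ s) ^- m) (q ^+ m) _ _ _
  (@pos_symbol_poisson (t * (q `^ s) ^+ m.+1) (q ^- m.+1) _ _ _ IH).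
have p0 k : 0 <= (q `^ s) ^+ k by rewrite exprn_ge0// powR_ge0.
have w1 : 0 <= t * (q `^ s) ^- m by rewrite mulr_ge0// invr_ge0.
have w2 : 0 <= t * (q `^ s) ^+ m.+1 by rewrite mulr_ge0.
have u1 : 0 <= q ^+ m by rewrite exprn_ge0.
have u2 : 0 <= q ^- m.+1 by rewrite invr_ge0 exprn_ge0.
move=> /(_ w1 u1 w2 u2).
congr pos_symbol; apply/funext => l; rewrite -!expRD; congr expR.
rewrite seriesSr /bernstein_term /bernstein_up /bernstein_dn !mulNr; ring.
Qed.

Lemma pos_symbol_bernstein q s t : 1 < q -> 0 < s < 1 -> 0 <= t ->
  pos_symbol (fun l => expR (- (t * bernstein q s l))).
Proof.
move=> q1 s01 t0.
apply: (pos_symbol_lim (B := 1) (fun m => pos_symbol_bernstein_partial s m q1 t0)).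
- move=> l l0.
  apply: continuous_cvg; first exact: continuous_expR.
  apply: cvgN; apply: cvgMr; exact: bernstein_cvg.
- move=> m l l0; rewrite ger0_norm ?expR_ge0// expR_le1 oppr_le0 mulr_ge0//.
  by apply: sumr_ge0 => k _; exact: bernstein_term_ge0.
- move=> l l0; rewrite ger0_norm ?expR_ge0// expR_le1 oppr_le0 mulr_ge0//.
  by apply: le_trans (bernstein_partial_le q1 s01 0 l0); rewrite /series /= big_nil.
Qed.

Lemma pos_symbol_stretched s t : 0 < s < 1 -> 0 < t ->
  pos_symbol (fun l => expR (- t * l `^ s)).
Proof.
move=> s01 t0.
have c0 i : 0 <= t / bernstein (@ratio R i) s 1.
  by rewrite divr_ge0 ?(ltW t0)// ltW// bernstein1_gt0// ratio_gt1.
apply: (pos_symbol_lim (B := 1) (fun i => pos_symbol_bernstein (ratio_gt1 R i) s01 (c0 i))).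
- move=> l l0; rewrite mulNr.
  apply: continuous_cvg; first exact: continuous_expR.
  apply: cvgN; rewrite (_ : (fun _ => _) = fun i => t * (bernstein (@ratio R i) s l / bernstein (@ratio R i) s 1)).
    by apply: cvgMr; exact: bernstein_ratio_cvg.
  by apply/funext => i; rewrite mulrAC mulrA.
- move=> i l l0; rewrite ger0_norm ?expR_ge0// expR_le1 oppr_le0 mulr_ge0//.
  by apply: le_trans (bernstein_partial_le (ratio_gt1 R i) s01 0 l0); rewrite /series /= big_nil.
- move=> l l0; rewrite ger0_norm ?expR_ge0// expR_le1 mulNr oppr_le0.
  by rewrite mulr_ge0 ?powR_ge0 ?(ltW t0).
Qed.

Lemma stretched_kernel_ge0 s t z : 0 < s < 1 -> 0 < t ->
  (0 <= \int[@leb R n]_xi (expR (- t * sqnorm xi `^ s) * cos (dotrV z xi))%:E)%E.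
Proof.
move=> s01 t0; have [s0 _] := andP s01.
have ist := @integrable_stretched R n s t s0 t0.
have ms := measurable_stretched s t (@measurable_coords_id R n).
have [||//||_ _ cvI] := @dominated_convergence_real R _ _ (@leb R n)
  (fun m xi => expR (- m.+1%:R^-1 * sqnorm xi) * expR (- t * sqnorm xi `^ s) * cos (dotrV z xi))
  (fun xi => expR (- t * sqnorm xi `^ s) * cos (dotrV z xi))
  (fun xi => expR (- t * sqnorm xi `^ s)).
- move=> m; apply: (measurableM_cos z _ (@measurable_coords_id R n)).
  by apply: measurable_funM ms; exact: (measurable_gauss _ (@measurable_coords_id R n)).
- move=> xi; apply: cvgMl; rewrite -[X in _ --> X]mul1r; apply: cvgMl.
  rewrite -[X in _ --> X]expR0; apply: continuous_cvg; first exact: continuous_expR.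
  rewrite [X in _ --> X](_ : 0 = - 0 * sqnorm xi); last by rewrite oppr0 mul0r.
  by apply: cvgMl; apply: cvgN; exact: cvg_harmonic.
- move=> m xi; rewrite normrM (le_trans (ler_piMr (normr_ge0 _) (cos_max _)))//.
  rewrite ger0_norm ?mulr_ge0 ?expR_ge0// ler_piMl ?expR_ge0//.
  by rewrite expR_le1 mulNr oppr_le0 mulr_ge0 ?sqnorm_ge0.
rewrite -(cvg_lim _ cvI)//; apply: lime_ge; first by apply/cvg_ex; eexists; exact: cvI.
apply: nearW => m; have m0 : 0 < m.+1%:R^-1 :> R by rewrite invr_gt0.
exact: (pos_symbol_ge0 (pos_symbol_stretched s01 t0) z m0).
Qed.

End pos_symbol.

(** * Dominated Fubini and kernels with a radial symbol *)

Lemma fineK_Rintegral d (T : measurableType d) (R : realType)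
    (m : {measure set T -> \bar R}) (D : set T) (f : T -> R) : measurable D ->
  m.-integrable D (EFin \o f) ->
  (\int[m]_(x in D) (f x)%:E)%E = (\int[m]_(x in D) f x)%:E.
Proof. by move=> mD fi; rewrite /Rintegral fineK//; exact: integrable_fin_num. Qed.

Lemma integrable_add d (T : measurableType d) (R : realType)
    (m : {measure set T -> \bar R}) (f g : T -> R) :
  m.-integrable setT (EFin \o f) -> m.-integrable setT (EFin \o g) ->
  m.-integrable setT (EFin \o (fun p => f p + g p)).
Proof. by move=> fi gi; exact: (integrableD measurableT fi gi). Qed.

Section fubini_dominated.
Context d1 d2 (T1 : measurableType d1) (T2 : measurableType d2) (R : realType).
Variables (m1 : {sigma_finite_measure set T1 -> \bar R})
  (m2 : {sigma_finite_measure set T2 -> \bar R}).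
Variables (f : T1 * T2 -> R) (g1 : T1 -> R) (g2 : T2 -> R).
Hypotheses (mf : measurable_fun setT f)
  (i1 : m1.-integrable setT (EFin \o g1)) (i2 : m2.-integrable setT (EFin \o g2))
  (g20 : forall y, 0 <= g2 y) (g10 : forall x, 0 <= g1 x)
  (fg : forall x y, `|f (x, y)| <= g1 x * g2 y).

Lemma integrable_dominated_prod : (m1 \x m2)%E.-integrable setT (EFin \o f).
Proof.
apply/integrable12ltyP; first exact/measurable_EFinP.
have I2 := integrable_fin_num measurableT i2.
have I1 := integrable_fin_num measurableT i1.
apply: (@le_lt_trans _ _ (\int[m1]_x ((g1 x)%:E * \int[m2]_y (g2 y)%:E))%E); last first.
  rewrite ge0_integralZr//.
  - rewrite -ge0_fin_numE; first exact: fin_numM.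
    by rewrite mule_ge0// integral_ge0// => x _; rewrite lee_fin.
  - by case/integrableP: i1.
  - by move=> x _; rewrite lee_fin.
  - by apply: integral_ge0 => y _; rewrite lee_fin.
apply: ge0_le_integral => //.
- by move=> x _; exact: integral_ge0.
- apply: (@measurable_fun_fubini_tonelli_F _ _ _ _ _ m2 (fun p => `|(f p)%:E|%E)).
    by apply: measurableT_comp => //; exact/measurable_EFinP.
  by move=> p; exact: abse_ge0.
- by apply: emeasurable_funM; [case/integrableP: i1|exact: measurable_cst].
- move=> x _; rewrite -ge0_integralZl_EFin//; last 2 first.
  + by move=> y _; rewrite lee_fin.
  + by case/integrableP: i2.
  apply: ge0_le_integral => //.
  + apply: measurableT_comp => //; apply/measurable_EFinP.
    exact: (measurableT_comp mf (measurable_pair1 x)).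
  + by apply: emeasurable_funM; [exact: measurable_cst|case/integrableP: i2].
  + by move=> y _ /=; rewrite -EFinM lee_fin.
Qed.

Lemma integrable_slice1 x : m2.-integrable setT (EFin \o (fun y => f (x, y))).
Proof.
apply: (integrable_ge0_dominated (g := fun y => g1 x * g2 y)).
- exact: (measurableT_comp mf (measurable_pair1 x)).
- exact: integrable_scale.
- exact: fg.
Qed.

Lemma integrable_slice2 y : m1.-integrable setT (EFin \o (fun x => f (x, y))).
Proof.
apply: (integrable_ge0_dominated (g := fun x => g2 y * g1 x)).
- exact: (measurableT_comp mf (measurable_pair2 y)).
- exact: integrable_scale.
- by move=> x; rewrite mulrC; exact: fg.
Qed.

Lemma integrable_section1 : m1.-integrable setT (EFin \o (fun x => \int[m2]_y f (x, y))).
Proof.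
have := integrable_fubini_F integrable_dominated_prod.
congr integrable; apply/funext => x /=.
exact: fineK_Rintegral (integrable_slice1 x).
Qed.

Lemma integrable_section2 : m2.-integrable setT (EFin \o (fun y => \int[m1]_x f (x, y))).
Proof.
have mG := measurable_fubini_G integrable_dominated_prod.
have GE y : fubini_G m1 (EFin \o f) y = (\int[m1]_x f (x, y))%:E.
  exact: fineK_Rintegral (integrable_slice2 y).
apply: (integrable_ge0_dominated (g := fun y => \int[m1]_x g1 x * g2 y)).
- by apply/measurable_EFinP; rewrite (_ : _ \o _ = fubini_G m1 (EFin \o f)) //; apply/funext => y; rewrite GE.
- exact: integrable_scale.
- move=> y; rewrite (le_trans (le_normr_Rintegral _ (integrable_slice2 y)))//.
  rewrite mulrC -RintegralZl//; apply: le_Rintegral => //.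
  + exact: (integrable_abse (integrable_slice2 y)).
  + exact: integrable_scale.
  + by move=> x _; rewrite mulrC; exact: fg.
Qed.

Lemma fubini_dominated :
  \int[m1]_x \int[m2]_y f (x, y) = \int[m2]_y \int[m1]_x f (x, y).
Proof.
apply: EFin_inj.
rewrite -(fineK_Rintegral measurableT integrable_section1).
rewrite -(fineK_Rintegral measurableT integrable_section2).
have E1 x : (\int[m2]_y (EFin \o f) (x, y) = (\int[m2]_y f (x, y))%:E)%E.
  exact: fineK_Rintegral (integrable_slice1 x).
have E2 y : (\int[m1]_x (EFin \o f) (x, y) = (\int[m1]_x f (x, y))%:E)%E.
  exact: fineK_Rintegral (integrable_slice2 y).
have H := Fubini integrable_dominated_prod.
transitivity (\int[m1]_x \int[m2]_y (EFin \o f) (x, y))%E.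
  by apply: eq_integral => x _; rewrite -E1.
by rewrite H; apply: eq_integral => y _; exact: E2.
Qed.

(** Fubini in the form in which it is applied: one iterated integral is known
    up to a constant factor, the inner integral of the other one is known. *)
Lemma fubini_scaled (c : R) (F : T1 -> R) (G : T2 -> R) :
  (forall x, F x = c * \int[m2]_y f (x, y)) ->
  (forall y, \int[m1]_x f (x, y) = G y) ->
  \int[m1]_x F x = c * \int[m2]_y G y.
Proof.
move=> FE GE; transitivity (\int[m1]_x (c * \int[m2]_y f (x, y))).
  by apply: eq_Rintegral => x _; exact: FE.
rewrite (RintegralZl _ measurableT integrable_section1) fubini_dominated.
by congr (_ * _); apply: eq_Rintegral => y _; exact: GE.
Qed.

End fubini_dominated.

Lemma Rintegral_combination d (T : measurableType d) (R : realType)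
    (m : {measure set T -> \bar R}) (f g h : T -> R) (a b c : R) :
  m.-integrable setT (EFin \o f) -> m.-integrable setT (EFin \o g) ->
  (forall p, h p = a * (b * f p + c * g p)) ->
  \int[m]_p h p = a * (b * \int[m]_p f p + c * \int[m]_p g p).
Proof.
move=> fi gi hE; have bf := integrable_scale b fi; have cg := integrable_scale c gi.
transitivity (\int[m]_p (a * (b * f p + c * g p))).
  by apply: eq_Rintegral => p _; exact: hE.
rewrite (RintegralZl _ measurableT (integrable_add bf cg)).
by rewrite (RintegralD measurableT bf cg) !RintegralZl.
Qed.

Section fourier_kernel.
Variables (R : realType) (n : nat).
Implicit Types (phi : 'rV[R]_n -> R) (x z xi : 'rV[R]_n).
Local Notation mu := (@leb R n).

(** The inverse Fourier transform of a real even symbol, the only case that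
    occurs here. *)
Definition fourier_kernel phi z : R :=
  (2 * pi) ^- n * \int[mu]_xi (phi xi * cos (dotrV z xi)).

Lemma frac_heat_kernelE s z t :
  frac_heat_kernel s z t = fourier_kernel (fun xi => expR (- t * sqnorm xi `^ s)) z.
Proof.
rewrite /frac_heat_kernel /fourier_kernel /Cintegral /expi /=.
rewrite mul0r subr0; congr (_ * _); apply: eq_Rintegral => xi _ /=.
by rewrite mul0r subr0 powR_sqnorm.
Qed.

Lemma fourier_kernelN phi z : fourier_kernel phi (- z) = fourier_kernel phi z.
Proof.
congr (_ * _); apply: eq_Rintegral => xi _; rewrite (_ : dotrV (- z) xi = - dotrV z xi) ?cosN//.
by rewrite /dotrV -sumrN; apply: eq_bigr => i _; rewrite mxE mulNr.
Qed.

Lemma fourier_kernel_gauss u z : 0 < u ->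
  fourier_kernel (fun xi => expR (- u * sqnorm xi)) z =
  (Num.sqrt (4 * pi * u) ^+ n)^-1 * expR (- (sqnorm z / (4 * u))).
Proof.
move=> u0; rewrite /fourier_kernel /Rintegral gauss_cos_integral//= mulrA; congr (_ * _).
rewrite -exprVn -exprMn -exprVn; congr (_ ^+ _).
have p0 : 0 < (pi : R) := pi_gt0 R.
rewrite -[LHS](@ger0_norm R); last by rewrite mulr_ge0 ?sqrtr_ge0// invr_ge0 mulr_ge0// ltW.
rewrite -[LHS]sqrtr_sqr -sqrtrV ?mulr_ge0 ?(ltW p0) ?(ltW u0)//.
congr Num.sqrt; rewrite exprMn sqr_sqrtr ?divr_ge0 ?(ltW p0) ?(ltW u0)//.
have un : u != 0 by rewrite gt_eqF.
have pn : (pi : R) != 0 by rewrite gt_eqF.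
move: (pi : R) pn => w wn; by field; rewrite un wn.
Qed.

Section symbol.
Variables (phi : 'rV[R]_n -> R).
Hypotheses (mphi : measurable_fun [set: lebesgue_rV R n] phi)
  (iphi : mu.-integrable setT (EFin \o phi)).

Let iabs : mu.-integrable setT (EFin \o (fun xi => `|phi xi|)).
Proof. exact: (integrable_abse iphi). Qed.

Lemma fourier_integrable z :
  mu.-integrable setT (EFin \o (fun xi => phi xi * cos (dotrV z xi))).
Proof. by apply: (integrableM_cos z mphi iabs) => xi. Qed.

Lemma integrableM_bounded (g : R -> R) z : measurable_fun setT g ->
  (forall r : R, `|g r| <= 1) ->
  mu.-integrable setT (EFin \o (fun xi => phi xi * g (dotrV z xi))).
Proof.
move=> mg g1; apply: (integrable_ge0_dominated _ iabs).
  apply: measurable_funM mphi _; apply: measurableT_comp mg _.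
  by apply: measurable_dotrV; [exact: measurable_coords_cst|exact: measurable_coords_id].
by move=> xi; rewrite normrM ler_piMr.
Qed.

(** Adding [1] makes the integrand nonnegative, so that Tonelli gives the
    measurability in the parameter. *)
Lemma measurable_transform (g : R -> R) d (T : measurableType d) (f : T -> 'rV[R]_n) :
  measurable_fun setT g -> (forall r : R, `|g r| <= 1) ->
  (forall xi, 0 <= phi xi) -> measurable_coords f ->
  measurable_fun setT (fun p => \int[mu]_xi (phi xi * g (dotrV (f p) xi))).
Proof.
move=> mg g1 phi0 mf.
pose F (q : T * lebesgue_rV R n) := (phi q.2 * (1 + g (dotrV (f q.1) q.2)))%:E.
have mF : measurable_fun setT F.
  apply/measurable_EFinP; apply: measurable_funM.
    exact: (measurableT_comp mphi measurable_snd).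
  apply: measurable_funD => //; apply: measurableT_comp mg _.
  apply: measurable_dotrV; last exact: measurable_coords_snd.
  by move=> i; exact: (measurableT_comp (mf i) measurable_fst).
have F0 q : (0 <= F q)%E.
  rewrite lee_fin mulr_ge0//; have := g1 (dotrV (f q.1) q.2).
  by rewrite ler_norml -subr_ge0 opprK addrC => /andP[].
have := @measurable_fun_fubini_tonelli_F _ _ _ _ _ mu F mF F0.
pose r p := \int[mu]_xi phi xi + \int[mu]_xi (phi xi * g (dotrV (f p) xi)).
have -> : fubini_F mu F = EFin \o r.
  apply/funext => p; rewrite /fubini_F /F /r /=.
  rewrite -RintegralD//; last exact: integrableM_bounded.
  rewrite -fineK_Rintegral//.
    by apply: eq_integral => xi _; rewrite mulrDr mulr1.
  exact: (integrable_add iphi (integrableM_bounded _ mg g1)).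
move=> /measurable_EFinP mr.
rewrite (_ : (fun _ => _) = fun p => r p - \int[mu]_xi phi xi).
  by apply: measurable_funB => //; exact: measurable_cst.
by apply/funext => p; rewrite /r addrAC subrr add0r.
Qed.

Lemma measurable_fourier_kernel d (T : measurableType d) (f : T -> 'rV[R]_n) :
  (forall xi, 0 <= phi xi) -> measurable_coords f ->
  measurable_fun setT (fun p => fourier_kernel phi (f p)).
Proof.
move=> phi0 mf; apply: measurable_funM => //.
by apply: measurable_transform => //; [exact: measurable_cosR|exact: cos_max].
Qed.

End symbol.
End fourier_kernel.

(** * The power spectrum of a set *)

Section indicator_transform.
Variables (R : realType) (n : nat) (E : set (lebesgue_rV R n)).
Local Notation mu := (@leb R n).
Hypotheses (mE : measurable E) (Eoo : (mu E < +oo)%E).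
Implicit Types (x z xi : 'rV[R]_n).

Let m := fine (mu E).
Local Notation ind := (@indic 'rV[R]_n R E).

Let m0 : 0 <= m. Proof. by apply: fine_ge0; exact: measure_ge0. Qed.

Lemma integrable_ind : mu.-integrable setT (EFin \o ind).
Proof.
apply: integrable_ge0; first exact: measurable_indic.
  by [].
by rewrite integral_indic// setIT.
Qed.

Lemma measurable_ind : measurable_fun [set: lebesgue_rV R n] ind.
Proof. exact: measurable_indic. Qed.

Let ind_ge0 x : 0 <= ind x. Proof. by []. Qed.

Lemma Rintegral_ind : \int[mu]_x ind x = fine (mu E).
Proof. by rewrite /Rintegral integral_indic// setIT. Qed.

Definition cos_transform xi := \int[mu]_x (ind x * cos (dotrV xi x)).
Definition sin_transform xi := \int[mu]_x (ind x * sin (dotrV xi x)).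
(** The squared modulus of the Fourier transform of the indicator of [E]. *)
Definition power xi := cos_transform xi ^+ 2 + sin_transform xi ^+ 2.

Let sin_max (x : R) : `|sin x| <= 1. Proof. by rewrite ler_norml sin_geN1 sin_le1. Qed.

Let icos xi : mu.-integrable setT (EFin \o (fun x => ind x * cos (dotrV xi x))).
Proof.
exact: (integrableM_bounded measurable_ind integrable_ind xi (@measurable_cosR R) (@cos_max R)).
Qed.

Let isin xi : mu.-integrable setT (EFin \o (fun x => ind x * sin (dotrV xi x))).
Proof.
exact: (integrableM_bounded measurable_ind integrable_ind xi (@measurable_sinR R) sin_max).
Qed.

Let transform_le (g : R -> R) xi : (forall r : R, `|g r| <= 1) ->
  mu.-integrable setT (EFin \o (fun x => ind x * g (dotrV xi x))) ->
  `|\int[mu]_x (ind x * g (dotrV xi x))| <= m.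
Proof.
move=> g1 ig; rewrite (le_trans (le_normr_Rintegral _ ig))//.
rewrite /m -Rintegral_ind; apply: le_Rintegral => //.
- exact: (integrable_abse ig).
- exact: integrable_ind.
- by move=> x _; rewrite normrM [`|\1_E x|]ger0_norm// ler_piMr.
Qed.

Lemma cos_transform_le xi : `|cos_transform xi| <= m.
Proof. by apply: transform_le (icos xi); exact: cos_max. Qed.

Lemma sin_transform_le xi : `|sin_transform xi| <= m.
Proof. exact: transform_le sin_max (isin xi). Qed.

Lemma measurable_cos_transform : measurable_fun [set: lebesgue_rV R n] cos_transform.
Proof.
exact: (measurable_transform measurable_ind integrable_ind (@measurable_cosR R) (@cos_max R) ind_ge0 (@measurable_coords_id R n)).
Qed.

Lemma measurable_sin_transform : measurable_fun [set: lebesgue_rV R n] sin_transform.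
Proof.
exact: (measurable_transform measurable_ind integrable_ind (@measurable_sinR R) sin_max ind_ge0 (@measurable_coords_id R n)).
Qed.

Lemma power_ge0 xi : 0 <= power xi.
Proof. by rewrite addr_ge0 ?sqr_ge0. Qed.

Lemma power_le xi : power xi <= 2 * m ^+ 2.
Proof.
have h (a : R) : `|a| <= m -> a ^+ 2 <= m ^+ 2.
  by move=> am; rewrite -real_normK ?num_real// lerXn2r// nnegrE.
have := h _ (cos_transform_le xi); have := h _ (sin_transform_le xi).
rewrite /power; lra.
Qed.

Lemma measurable_power : measurable_fun [set: lebesgue_rV R n] power.
Proof.
have mc := measurable_cos_transform; have ms := measurable_sin_transform.
by apply: measurable_funD; exact: measurable_funX.
Qed.

Section symbol.
Variable phi : 'rV[R]_n -> R.
Hypotheses (mphi : measurable_fun [set: lebesgue_rV R n] phi)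
  (iphi : mu.-integrable setT (EFin \o phi)).

Let iabs : mu.-integrable setT (EFin \o (fun xi => `|phi xi|)).
Proof. exact: (integrable_abse iphi). Qed.

Lemma integrable_phi_power : mu.-integrable setT (EFin \o (fun xi => phi xi * power xi)).
Proof.
apply: (integrable_ge0_dominated _ (integrable_scale (2 * m ^+ 2) iabs)).
  exact: measurable_funM mphi measurable_power.
move=> xi; rewrite normrM mulrC ler_wpM2r// ger0_norm ?power_ge0//.
exact: power_le.
Qed.

(** The integral of [phi] against the power spectrum, which is the interaction
    of [E] with itself under the kernel of symbol [phi]. *)
Definition fourier_autocorr := (2 * pi) ^- n * \int[mu]_xi (phi xi * power xi).

Lemma fourier_inner x :
  \int[mu]_y (ind y * fourier_kernel phi (x - y)) = (2 * pi) ^- n *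
   \int[mu]_xi (phi xi * (cos (dotrV xi x) * cos_transform xi + sin (dotrV xi x) * sin_transform xi)).
Proof.
pose f (p : lebesgue_rV R n * lebesgue_rV R n) := ind p.1 * (phi p.2 * cos (dotrV (x - p.1) p.2)).
have mf : measurable_fun setT f.
  apply: measurable_funM; first exact: (measurableT_comp measurable_ind measurable_fst).
  apply: measurable_funM; first exact: (measurableT_comp mphi measurable_snd).
  apply: measurableT_comp; first exact: measurable_cosR.
  apply: measurable_dotrV; last exact: measurable_coords_snd.
  apply: measurable_coordsB; first exact: measurable_coords_cst.
  exact: measurable_coords_fst.
have fb y xi : `|f (y, xi)| <= ind y * `|phi xi|.
  rewrite /f /= normrM (ger0_norm (ind_ge0 y)) (ler_wpM2l (ind_ge0 y))//.
  by rewrite normrM ler_piMr ?normr_ge0 ?cos_max.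
apply: (fubini_scaled mf integrable_ind iabs (fun _ => normr_ge0 _) ind_ge0 fb).
  move=> y; rewrite /f /= /fourier_kernel mulrCA; congr (_ * _).
  exact/esym/(RintegralZl _ measurableT (fourier_integrable mphi iphi (x - y))).
move=> xi; apply: (Rintegral_combination (icos xi) (isin xi)) => y.
rewrite /f /= dotrVBl cosB (dotrVC x) (dotrVC y); ring.
Qed.

(** The addition formula for the cosine separates the variables [x] and [y];
    Fubini is applied first in [y], then in [x]. *)
Lemma fourier_autocorrE :
  \int[mu]_x (ind x * \int[mu]_y (ind y * fourier_kernel phi (x - y))) = fourier_autocorr.
Proof.
pose h x xi := cos (dotrV xi x) * cos_transform xi + sin (dotrV xi x) * sin_transform xi.
have h_le x xi : `|h x xi| <= 2 * m.
  rewrite /h (le_trans (ler_normD _ _))// mulr2n mulrDl mul1r lerD// normrM.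
    by rewrite -[leRHS]mul1r ler_pM ?cos_max ?cos_transform_le.
  by rewrite -[leRHS]mul1r ler_pM ?sin_max ?sin_transform_le.
pose f (p : lebesgue_rV R n * lebesgue_rV R n) := ind p.1 * (phi p.2 * h p.1 p.2).
have m21 : measurable_fun [set: lebesgue_rV R n * lebesgue_rV R n] (fun p => dotrV (p.2 : 'rV[R]_n) p.1).
  by apply: measurable_dotrV; [exact: measurable_coords_snd|exact: measurable_coords_fst].
have mh : measurable_fun [set: lebesgue_rV R n * lebesgue_rV R n] (fun p => h p.1 p.2).
  apply: measurable_funD; apply: measurable_funM.
  - exact: (measurableT_comp (@measurable_cosR R) m21).
  - exact: (measurableT_comp measurable_cos_transform measurable_snd).
  - exact: (measurableT_comp (@measurable_sinR R) m21).
  - exact: (measurableT_comp measurable_sin_transform measurable_snd).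
have mf : measurable_fun setT f.
  apply: measurable_funM; first exact: (measurableT_comp measurable_ind measurable_fst).
  by apply: measurable_funM mh; exact: (measurableT_comp mphi measurable_snd).
have i2 := integrable_scale (2 * m) iabs.
have g20 xi : 0 <= 2 * m * `|phi xi| by rewrite !mulr_ge0.
have fb x xi : `|f (x, xi)| <= ind x * (2 * m * `|phi xi|).
  rewrite /f /= normrM [`|ind x|]ger0_norm// ler_wpM2l// normrM mulrC.
  by rewrite ler_wpM2r.
apply: (fubini_scaled mf integrable_ind i2 g20 ind_ge0 fb).
  move=> x; rewrite fourier_inner mulrCA; congr (_ * _); rewrite /f /=.
  apply/esym/(RintegralZl _ measurableT).
  apply: (integrable_ge0_dominated _ i2).
    apply: measurable_funM mphi _.
    exact: (measurableT_comp mh (measurable_pair1 x)).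
  by move=> xi; rewrite normrM mulrC ler_wpM2r.
move=> xi; rewrite /power !expr2; apply: (Rintegral_combination (icos xi) (isin xi)) => x.
rewrite /f /= /h; ring.
Qed.

End symbol.
End indicator_transform.

(** * Interaction energies through the power spectrum *)

Section double_integrals.
Context d (T : measurableType d) (R : realType).
Variables (m : {sigma_finite_measure set T -> \bar R}) (E : set T) (k : T * T -> R).
Hypotheses (mE : measurable E) (mk : measurable_fun setT k) (k0 : forall p, 0 <= k p).

Local Notation ind := (@indic T R E).

Let mkE D : measurable_fun setT (fun p : T * T => (k p * \1_D p.2)%:E) ->
  measurable_fun setT (fun x => \int[m]_(y in D) (k (x, y))%:E)%E.
Proof.
move=> mD.
have := @measurable_fun_fubini_tonelli_F _ _ _ _ _ m _ mD.
have h0 p : (0 <= (k p * \1_D p.2)%:E)%E by rewrite lee_fin mulr_ge0.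
move=> /(_ h0); congr measurable_fun; apply/funext => x.
rewrite [RHS]integral_mkcond /fubini_F; apply: eq_integral => y _ /=.
by rewrite patchE indicE; case: ifP => _; rewrite ?mulr1 ?mulr0.
Qed.

Lemma measurable_slice D : measurable D ->
  measurable_fun setT (fun x => \int[m]_(y in D) (k (x, y))%:E)%E.
Proof.
move=> mD; apply: mkE; apply/measurable_EFinP; apply: measurable_funM => //.
have mi : measurable_fun setT (@indic T R D) by exact: measurable_indic.
exact: (measurableT_comp mi measurable_snd).
Qed.

(** All the mass of [k (x, _)] is either on [E] or on its complement. *)
Lemma double_integral_split M :
  (forall x, \int[m]_y (k (x, y))%:E = M)%E ->
  (\int[m]_(x in E) \int[m]_(y in ~` E) (k (x, y))%:E +
   \int[m]_(x in E) \int[m]_(y in E) (k (x, y))%:E = M * m E)%E.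
Proof.
move=> kM; have mCE := measurableC mE.
rewrite -ge0_integralD//; last 4 first.
- by move=> x _; apply: integral_ge0 => y _; rewrite lee_fin.
- by apply: measurable_funTS; exact: measurable_slice.
- by move=> x _; apply: integral_ge0 => y _; rewrite lee_fin.
- by apply: measurable_funTS; exact: measurable_slice.
rewrite (eq_integral (cst M)).
  by rewrite integral_cst.
move=> x _ /=; rewrite -(kM x) -[in RHS](setUv E) ge0_integral_setU//.
- by rewrite addeC.
- rewrite setUv; apply/measurable_EFinP.
  exact: (measurableT_comp mk (measurable_pair1 x)).
- by move=> y _; rewrite lee_fin.
- by apply/disj_setPCl.
Qed.

Section finite.
Variable B : R.
Hypotheses (Eoo : (m E < +oo)%E) (kB : forall p, k p <= B).

Let iind : m.-integrable setT (EFin \o ind).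
Proof.
apply: integrable_ge0; [exact: measurable_indic|by []|].
by rewrite integral_indic// setIT.
Qed.

Let ind0 x : 0 <= ind x. Proof. by []. Qed.

Let f (p : T * T) := ind p.1 * (ind p.2 * k p).

Let mf : measurable_fun setT f.
Proof.
have mi : measurable_fun setT ind by exact: measurable_indic.
apply: measurable_funM; first exact: (measurableT_comp mi measurable_fst).
by apply: measurable_funM mk; exact: (measurableT_comp mi measurable_snd).
Qed.

Let B0 : 0 <= B. Proof. exact: le_trans (k0 (point, point)) (kB _). Qed.

Let iB : m.-integrable setT (EFin \o (fun y => B * ind y)).
Proof. exact: integrable_scale. Qed.

Let iB0 y : 0 <= B * ind y. Proof. by rewrite mulr_ge0. Qed.

Let fB x y : `|f (x, y)| <= ind x * (B * ind y).
Proof.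
rewrite /f /= ger0_norm ?mulr_ge0// ler_wpM2l// mulrC.
by rewrite ler_wpM2r.
Qed.

Lemma double_integral_real :
  (\int[m]_(x in E) \int[m]_(y in E) (k (x, y))%:E =
   (\int[m]_x (ind x * \int[m]_y (ind y * k (x, y))))%:E)%E.
Proof.
have i1 := integrable_section1 mf iind iB iB0 ind0 fB.
have sl x : m.-integrable setT (EFin \o (fun y => ind y * k (x, y))).
  apply: (integrable_ge0_dominated _ iB).
    apply: measurable_funM; first exact: measurable_indic.
    exact: (measurableT_comp mk (measurable_pair1 x)).
  by move=> y; rewrite ger0_norm ?mulr_ge0// mulrC ler_wpM2r.
have E1 x : (\int[m]_(y in E) (k (x, y))%:E = (\int[m]_y (ind y * k (x, y)))%:E)%E.
  rewrite -(fineK_Rintegral measurableT (sl x)) [LHS]integral_mkcond.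
  apply: eq_integral => y _; rewrite patchE indicE.
  by case: ifP => _; rewrite ?mul1r ?mul0r.
have E2 x : \int[m]_y f (x, y) = ind x * \int[m]_y (ind y * k (x, y)).
  by rewrite /f /= (RintegralZl _ measurableT (sl x)).
transitivity (\int[m]_x (\int[m]_y f (x, y))%:E)%E; last first.
  rewrite (fineK_Rintegral measurableT i1); congr EFin.
  by apply: eq_Rintegral => x _; exact: E2.
rewrite [LHS]integral_mkcond; apply: eq_integral => x _; rewrite patchE E2 indicE.
by case: ifP => _; rewrite ?mul1r ?mul0r// E1.
Qed.

End finite.
End double_integrals.

Section kernels.
Variables (R : realType) (n : nat).
Implicit Types (u s t : R) (x y z xi : 'rV[R]_n) (E : set (lebesgue_rV R n)).
Local Notation mu := (@leb R n).

Lemma measurable_kernel_diff (K : 'rV[R]_n -> R) :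
  measurable_fun [set: borel_rV R n] K ->
  measurable_fun [set: lebesgue_rV R n * lebesgue_rV R n] (fun p => K ((p.1 : 'rV[R]_n) - p.2)).
Proof.
move=> mK; apply: (measurable_coords_comp mK).
by apply: measurable_coordsB; [exact: measurable_coords_fst|exact: measurable_coords_snd].
Qed.

Lemma kernel_mass_shift (K : 'rV[R]_n -> R) x :
  measurable_fun [set: borel_rV R n] K -> (forall z, 0 <= K z) ->
  (forall z, K (- z) = K z) ->
  (\int[mu]_y (K (x - y))%:E = \int[mu]_z (K z)%:E)%E.
Proof.
move=> mK K0 KN.
rewrite -(@ge0_integral_leb_borel_shift R n (fun z => (K z)%:E) (- x)).
- by apply: eq_integral => y _; rewrite -KN opprB.
- exact/measurable_EFinP.
- by move=> z; rewrite lee_fin.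
Qed.

Definition gauss_kernel u z : R :=
  (Num.sqrt (4 * pi * u) ^+ n)^-1 * expR (- (sqnorm z / (4 * u))).

Definition gauss_symbol u xi : R := expR (- u * sqnorm xi).
Definition stretched_symbol s t xi : R := expR (- t * sqnorm xi `^ s).

Lemma gauss_kernelE u z : 0 < u -> gauss_kernel u z = fourier_kernel (gauss_symbol u) z.
Proof. by move=> u0; rewrite /gauss_kernel -fourier_kernel_gauss. Qed.

Let sqrt_pos u : 0 < u -> 0 < Num.sqrt (4 * pi * u) ^+ n.
Proof. by move=> u0; rewrite exprn_gt0// sqrtr_gt0 !mulr_gt0// pi_gt0. Qed.

Lemma gauss_kernel_gt0 u z : 0 < u -> 0 < gauss_kernel u z.
Proof. by move=> u0; rewrite mulr_gt0 ?expR_gt0// invr_gt0 sqrt_pos. Qed.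

Lemma gauss_kernel_ge0 u z : 0 < u -> 0 <= gauss_kernel u z.
Proof. by move=> u0; exact/ltW/gauss_kernel_gt0. Qed.

Lemma gauss_kernelN u z : gauss_kernel u (- z) = gauss_kernel u z.
Proof. by rewrite /gauss_kernel sqnormN. Qed.

Lemma measurable_gauss_kernel u : measurable_fun [set: borel_rV R n] (gauss_kernel u).
Proof.
apply: measurable_funM => //; apply: measurableT_comp => //.
apply: measurableT_comp => //; apply: measurable_funM => //.
exact: measurable_sqnorm (@measurable_coords_borel R n).
Qed.

Lemma gauss_kernel_mass u : 0 < u -> (\int[mu]_z (gauss_kernel u z)%:E = 1)%E.
Proof.
move=> u0; have v0 : 0 < (4 * u)^-1 by rewrite invr_gt0 mulr_gt0.
transitivity (\int[mu]_z (((Num.sqrt (4 * pi * u) ^+ n)^-1)%:E *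
    (expR (- (4 * u)^-1 * sqnorm z))%:E))%E.
  by apply: eq_integral => z _; rewrite -EFinM /gauss_kernel [_ / _]mulrC mulNr.
have ms := measurable_gauss (4 * u)^-1 (@measurable_coords_id R n).
rewrite ge0_integralZl_EFin; last 4 first.
- exact: measurableT.
- by move=> z _; rewrite lee_fin expR_ge0.
- exact/measurable_EFinP.
- by rewrite invr_ge0 ltW// sqrt_pos.
rewrite gauss_integral// invrK -EFinM mulrA [pi * 4]mulrC mulVf//.
by rewrite gt_eqF// sqrt_pos.
Qed.

Definition gauss_energy u E : \bar R :=
  (\int[mu]_(x in E) \int[mu]_(y in ~` E) (gauss_kernel u (x - y))%:E)%E.

Lemma measurable_gauss_symbol u : measurable_fun [set: lebesgue_rV R n] (gauss_symbol u).
Proof. exact: measurable_gauss (@measurable_coords_id R n). Qed.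

Lemma measurable_stretched_symbol s t :
  measurable_fun [set: lebesgue_rV R n] (stretched_symbol s t).
Proof. exact: measurable_stretched (@measurable_coords_id R n). Qed.

Lemma fourier_kernel_ge0_le (phi : 'rV[R]_n -> R) z :
  measurable_fun [set: lebesgue_rV R n] phi -> mu.-integrable setT (EFin \o phi) ->
  (forall xi, 0 <= phi xi) -> fourier_kernel phi z <= (2 * pi) ^- n * \int[mu]_xi phi xi.
Proof.
move=> mphi iphi phi0; rewrite ler_wpM2l ?invr_ge0 ?exprn_ge0 ?mulr_ge0 ?pi_ge0//.
apply: le_Rintegral; [exact: measurableT|exact: fourier_integrable|exact: iphi|].
by move=> xi _; rewrite ler_piMr ?phi0.
Qed.

Lemma autocorr_fourier (phi : 'rV[R]_n -> R) E : measurable E -> (mu E < +oo)%E ->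
  measurable_fun [set: lebesgue_rV R n] phi -> mu.-integrable setT (EFin \o phi) ->
  (forall xi, 0 <= phi xi) -> (forall z, 0 <= fourier_kernel phi z) ->
  (\int[mu]_(x in E) \int[mu]_(y in E) (fourier_kernel phi (x - y))%:E =
   (fourier_autocorr E phi)%:E)%E.
Proof.
move=> mE Eoo mphi iphi phi0 K0.
have mK : measurable_fun [set: borel_rV R n] (fourier_kernel phi).
  exact: (measurable_fourier_kernel mphi iphi phi0 (@measurable_coords_borel R n)).
have mk := measurable_kernel_diff mK.
have kB (p : lebesgue_rV R n * lebesgue_rV R n) :
    fourier_kernel phi ((p.1 : 'rV[R]_n) - p.2) <= (2 * pi) ^- n * \int[mu]_xi phi xi.
  exact: fourier_kernel_ge0_le.
rewrite (@double_integral_real _ _ _ mu E _ mE mk (fun _ => K0 _) _ Eoo kB).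
by rewrite (fourier_autocorrE mE Eoo mphi iphi).
Qed.

(** The Gaussian kernel has mass one. *)
Lemma gauss_energyE u E : 0 < u -> measurable E -> (mu E < +oo)%E ->
  (gauss_energy u E + (fourier_autocorr E (gauss_symbol u))%:E = mu E)%E.
Proof.
move=> u0 mE Eoo.
have KE z := gauss_kernelE z u0.
have i1 : mu.-integrable setT (EFin \o gauss_symbol u) by exact: gauss_integrable.
have K0 z : 0 <= fourier_kernel (gauss_symbol u) z by rewrite -KE gauss_kernel_ge0.
rewrite -(autocorr_fourier mE Eoo (measurable_gauss_symbol u) i1 (fun xi => expR_ge0 _) K0).
have mk := measurable_kernel_diff (measurable_gauss_kernel u).
have k0 (p : lebesgue_rV R n * lebesgue_rV R n) : 0 <= gauss_kernel u ((p.1 : 'rV[R]_n) - p.2).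
  exact: gauss_kernel_ge0.
have kM x : (\int[mu]_y (gauss_kernel u (x - y))%:E = 1)%E.
  rewrite kernel_mass_shift ?gauss_kernel_mass//.
  - exact: measurable_gauss_kernel.
  - by move=> z; exact: gauss_kernel_ge0.
  - exact: gauss_kernelN.
rewrite -[RHS]mul1e -(@double_integral_split _ _ _ mu E _ mE mk k0 _ kM).
congr (_ + _)%E; apply: eq_integral => x _; apply: eq_integral => y _.
by rewrite KE.
Qed.

Section heat.
Variables (s t : R).
Hypotheses (s01 : 0 < s < 1) (t0 : 0 < t).
Let phi := stretched_symbol s t.

Let mphi : measurable_fun [set: lebesgue_rV R n] phi.
Proof. exact: measurable_stretched_symbol. Qed.

Lemma integrable_stretched_symbol : mu.-integrable setT (EFin \o phi).
Proof. by apply: integrable_stretched => //; case/andP: s01. Qed.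
Let iphi := integrable_stretched_symbol.

Let phi0 xi : 0 <= phi xi. Proof. exact: expR_ge0. Qed.

Lemma heat_kernel_ge0 z : 0 <= fourier_kernel phi z.
Proof.
apply: mulr_ge0; first by rewrite invr_ge0 exprn_ge0// mulr_ge0// pi_ge0.
by apply: fine_ge0; exact: stretched_kernel_ge0.
Qed.

Lemma measurable_heat_kernel : measurable_fun [set: borel_rV R n] (fourier_kernel phi).
Proof. exact: (measurable_fourier_kernel mphi iphi phi0 (@measurable_coords_borel R n)). Qed.

Lemma integrable_stretched_gauss u : 0 <= u ->
  mu.-integrable setT (EFin \o (fun xi => phi xi * gauss_symbol u xi)).
Proof.
move=> u0; apply: (integrable_ge0_dominated _ iphi).
  exact: measurable_funM mphi (measurable_gauss_symbol u).
move=> xi; rewrite normrM [`|phi xi|]ger0_norm ?phi0// ler_piMr ?phi0//.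
rewrite ger0_norm ?expR_ge0// /gauss_symbol expR_le1 mulNr oppr_le0.
by rewrite mulr_ge0 ?sqnorm_ge0.
Qed.

(** Damping a kernel by a Gaussian averages its symbol against a Gaussian;
    letting the damping disappear recovers the mass of the kernel. *)
Lemma damped_heat_mass u : 0 < u ->
  \int[mu]_z (expR (- (4 * u)^-1 * sqnorm z) * fourier_kernel phi z) =
  (Num.sqrt (pi / u) ^+ n)^-1 * \int[mu]_xi (phi xi * gauss_symbol u xi).
Proof.
move=> u0; have v0 : 0 < (4 * u)^-1 by rewrite invr_gt0 mulr_gt0.
set v := (4 * u)^-1.
pose f (p : lebesgue_rV R n * lebesgue_rV R n) :=
  expR (- v * sqnorm (p.1 : 'rV[R]_n)) * (phi p.2 * cos (dotrV (p.1 : 'rV[R]_n) p.2)).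
have mg : measurable_fun [set: lebesgue_rV R n] (fun z => expR (- v * sqnorm z)).
  exact: (measurable_gauss v (@measurable_coords_id R n)).
have mf : measurable_fun setT f.
  apply: measurable_funM; first exact: (measurableT_comp mg measurable_fst).
  apply: measurable_funM; first exact: (measurableT_comp mphi measurable_snd).
  apply: measurableT_comp; first exact: measurable_cosR.
  by apply: measurable_dotrV; [exact: measurable_coords_fst|exact: measurable_coords_snd].
have ig := @gauss_integrable R n v v0.
have fb z xi : `|f (z, xi)| <= expR (- v * sqnorm z) * phi xi.
  rewrite /f /= normrM ger0_norm ?expR_ge0// ler_wpM2l ?expR_ge0//.
  by rewrite normrM ger0_norm ?phi0// ler_piMr ?phi0 ?cos_max.
have vE : (2 * pi) ^- n * Num.sqrt (pi / v) ^+ n = (Num.sqrt (pi / u) ^+ n)^-1.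
  rewrite -exprVn -exprMn -exprVn; congr (_ ^+ _).
  have p0 : 0 < (pi : R) := pi_gt0 R.
  rewrite -[LHS](@ger0_norm R); last by rewrite mulr_ge0 ?sqrtr_ge0// invr_ge0 mulr_ge0// ltW.
  rewrite -[LHS]sqrtr_sqr -sqrtrV ?divr_ge0 ?(ltW p0) ?(ltW u0)//.
  congr Num.sqrt; rewrite exprMn sqr_sqrtr ?divr_ge0 ?(ltW p0) ?(ltW v0)// /v.
  have un : u != 0 by rewrite gt_eqF.
  have pn : (pi : R) != 0 by rewrite gt_eqF.
  by move: (pi : R) pn => w wn; field; rewrite un wn.
have ipg := integrable_stretched_gauss (ltW u0).
rewrite -vE (fubini_scaled (c := (2 * pi) ^- n)
  (G := fun xi => Num.sqrt (pi / v) ^+ n * (phi xi * gauss_symbol u xi))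
  mf ig iphi phi0 (fun _ => expR_ge0 _) fb).
- rewrite -mulrA; congr (_ * _); exact: (RintegralZl _ measurableT ipg).
- move=> z; rewrite /f /= (RintegralZl _ measurableT (fourier_integrable mphi iphi z)).
  by rewrite /fourier_kernel mulrCA.
- move=> xi.
  have ic : mu.-integrable setT (EFin \o (fun z => expR (- v * sqnorm z) * cos (dotrV xi z))).
    by apply: (integrableM_cos xi mg ig) => z; rewrite ger0_norm ?expR_ge0.
  transitivity (\int[mu]_z (phi xi * (expR (- v * sqnorm z) * cos (dotrV xi z)))).
    by apply: eq_Rintegral => z _; rewrite /f /= mulrCA dotrVC.
  rewrite (RintegralZl _ measurableT ic) {1}/Rintegral gauss_cos_integral//=.
  rewrite mulrCA; congr (_ * (_ * expR _)); rewrite /v; field; by rewrite gt_eqF.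
Qed.

(** The symbol tends to [1] at the origin, and where it is not close to [1]
    the Gaussian has dropped by a fixed amount that [C] compensates. *)
Lemma symbol_lower e : 0 < e -> exists2 C : R, 0 <= C &
  forall xi, 1 - e - C + C * gauss_symbol 1 xi <= phi xi.
Proof.
move=> e0; have /andP[s0 s1] := s01.
(* Below [l0] the symbol is at least [1 - e]. *)
pose l0 := (e / t) `^ s^-1.
have l00 : 0 < l0 by rewrite powR_gt0// divr_gt0.
have d0 : 0 < 1 - expR (- l0) by rewrite subr_gt0 expR_lt1 oppr_lt0.
exists (1 - expR (- l0))^-1; first by rewrite invr_ge0 ltW.
move=> xi; rewrite /phi /stretched_symbol /gauss_symbol mulN1r.
set l := sqnorm xi; have l_ge0 : 0 <= l := sqnorm_ge0 xi.
set C := (1 - _)^-1; have C0 : 0 <= C by rewrite invr_ge0 ltW.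
have el1 : expR (- l) <= 1 by rewrite expR_le1 oppr_le0.
have [ll0|ll0] := leP l l0.
  have : t * l `^ s <= e.
    rewrite mulrC -ler_pdivlMr// (_ : e / t = l0 `^ s).
      by rewrite ge0_ler_powR ?nnegrE// ltW.
    by rewrite /l0 -powRrM mulVf ?powRr1 ?gt_eqF// ltW// divr_gt0.
  have := expR_ge1Dx (- t * l `^ s); rewrite mulNr => h1 h2.
  have : C * expR (- l) <= C by rewrite ler_piMr.
  lra.
have : 1 <= C * (1 - expR (- l)).
  rewrite mulrC ler_pdivlMr// mul1r lerD2l lerN2 ler_expR lerN2 ltW//.
rewrite mulrBr mulr1; have := expR_ge0 (- t * l `^ s); lra.
Qed.

Lemma integrable_damped u : 0 < u ->
  mu.-integrable setT (EFin \o (fun z => expR (- u * sqnorm z) * fourier_kernel phi z)).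
Proof.
move=> u0; have ig := @gauss_integrable R n u u0.
apply: (integrable_ge0_dominated _ (integrable_scale ((2 * pi) ^- n * \int[mu]_xi phi xi) ig)).
  apply: measurable_funM; first exact: (measurable_gauss u (@measurable_coords_id R n)).
  exact: measurable_fun_borel_leb measurable_heat_kernel.
move=> z; rewrite ger0_norm; last exact: (mulr_ge0 (expR_ge0 _) (heat_kernel_ge0 z)).
by rewrite mulrC ler_wpM2r ?expR_ge0 ?fourier_kernel_ge0_le.
Qed.

Lemma damped_heat_mass_le u : 0 < u ->
  ((\int[mu]_z (expR (- u * sqnorm z) * fourier_kernel phi z))%:E <=
   \int[mu]_z (fourier_kernel phi z)%:E)%E.
Proof.
move=> u0; rewrite -(fineK_Rintegral measurableT (integrable_damped u0)).
apply: ge0_le_integral.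
- exact: measurableT.
- by move=> z _; rewrite lee_fin mulr_ge0 ?expR_ge0 ?heat_kernel_ge0.
- by case/integrableP: (integrable_damped u0).
- exact/measurable_EFinP/(measurable_fun_borel_leb measurable_heat_kernel).
- move=> z _; rewrite lee_fin ler_piMl ?heat_kernel_ge0//.
  by rewrite expR_le1 mulNr oppr_le0 mulr_ge0 ?sqnorm_ge0// ltW.
Qed.

Lemma gauss_ratio_cvg1 :
  (Num.sqrt (k.+1%:R / k.+2%:R) : R) ^+ n @[k --> \oo] --> (1 : R).
Proof.
have cr : k.+1%:R / k.+2%:R @[k --> \oo] --> (1 : R).
  rewrite (_ : (fun _ => _) = fun k : nat => 1 - (k.+2%:R)^-1).
    rewrite -[X in _ --> X]subr0; apply: cvgB; first exact: cvg_cst.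
    by have := @cvg_harmonic R; rewrite -cvg_shiftS.
  apply/funext => k; rewrite -[k.+2%:R]natr1; field.
  by rewrite gt_eqF// addr_gt0.
have cf : continuous ((fun y : R => y ^+ n) \o (@Num.sqrt R)).
  move=> x; exact: (continuous_comp (@sqrt_continuous R x) (@exprn_continuous R n _)).
have := cf (1 : R); rewrite /continuous_at /= sqrtr1 expr1n; exact: cvg_comp.
Qed.

(** The damped masses stay below the mass, and they tend to the value of the
    symbol at the origin. *)
Lemma heat_mass_ge1 : (1 <= \int[mu]_z (fourier_kernel phi z)%:E)%E.
Proof.
apply/lee_addgt0Pr => e e0; have [C C0 hC] := symbol_lower e0.
set M := (\int[mu]_z _)%E.
pose a k : R := 1 - e - C + C * Num.sqrt (k.+1%:R / k.+2%:R) ^+ n.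
have aM k : ((a k)%:E <= M)%E.
  have u0 : 0 < k.+1%:R :> R by [].
  have v0 : 0 < (4 * k.+1%:R)^-1 :> R by rewrite invr_gt0 mulr_gt0.
  apply: le_trans (damped_heat_mass_le v0); rewrite lee_fin (damped_heat_mass u0).
  rewrite ler_pdivlMl; last by rewrite exprn_gt0// sqrtr_gt0 divr_gt0// pi_gt0.
  have i1 := @gauss_integrable R n _ u0.
  have i2 : mu.-integrable setT (EFin \o gauss_symbol k.+2%:R) by exact: gauss_integrable.
  have N1 : \int[mu]_xi gauss_symbol k.+1%:R xi = Num.sqrt (pi / k.+1%:R) ^+ n.
    by rewrite /Rintegral gauss_integral.
  have N2 : \int[mu]_xi gauss_symbol k.+2%:R xi = Num.sqrt (pi / k.+2%:R) ^+ n.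
    by rewrite /Rintegral gauss_integral.
  have j1 := integrable_scale (1 - e - C) i1.
  have j2 := integrable_scale C i2.
  apply: (@le_trans _ _ (\int[mu]_xi ((1 - e - C) * gauss_symbol k.+1%:R xi + C * gauss_symbol k.+2%:R xi))).
    rewrite (RintegralD measurableT j1 j2) !RintegralZl// N1 N2.
    rewrite /a mulrDr [Num.sqrt _ ^+ n * (1 - _ - _)]mulrC lerD2l mulrCA ler_wpM2l//.
    rewrite -exprMn -sqrtrM ?divr_ge0 ?pi_ge0// mulrA divfK//.
  apply: le_Rintegral; [exact: measurableT|exact: integrable_add j1 j2| |].
    exact: integrable_stretched_gauss.
  move=> xi _; have := hC xi.
  have -> : gauss_symbol k.+2%:R xi = gauss_symbol 1 xi * gauss_symbol k.+1%:R xi.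
    by rewrite /gauss_symbol -expRD -mulrDl -opprD nat1r.
  by rewrite mulrA -mulrDl; apply: ler_wpM2r; exact: expR_ge0.
have ac : a k @[k --> \oo] --> 1 - e.
  rewrite [X in _ --> X](_ : _ = 1 - e - C + C * 1); last by ring.
  by apply: cvgD; [exact: cvg_cst|apply: cvgMr; exact: gauss_ratio_cvg1].
have : ((1 - e)%:E <= M)%E.
  have ca : (a k)%:E @[k --> \oo] --> (1 - e)%:E by apply: cvg_EFin ac; exact: nearW.
  rewrite -(cvg_lim _ ca)//; apply: lime_le; last exact: nearW.
  by apply/cvg_ex; eexists; exact: ca.
by rewrite EFinB leeBlDr.
Qed.

(** The energy and the self-interaction add up to the mass of the kernel times
    the measure of [E]. *)
Lemma heat_energy_ge E : measurable E -> (mu E < +oo)%E ->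
  (mu E <= frac_heat_energy s t E + (fourier_autocorr E phi)%:E)%E.
Proof.
move=> mE Eoo.
rewrite -(autocorr_fourier mE Eoo mphi iphi phi0 heat_kernel_ge0).
have mk := measurable_kernel_diff measurable_heat_kernel.
have kM x : (\int[mu]_y (fourier_kernel phi (x - y))%:E =
    \int[mu]_z (fourier_kernel phi z)%:E)%E.
  apply: kernel_mass_shift; [exact: measurable_heat_kernel|exact: heat_kernel_ge0|].
  exact: fourier_kernelN.
have := @double_integral_split _ _ _ mu E _ mE mk (fun _ => heat_kernel_ge0 _) _ kM.
rewrite (_ : (\int[mu]_(x in E) \int[mu]_(y in ~` E) (fourier_kernel phi _)%:E)%E = frac_heat_energy s t E).
  move=> ->; rewrite -[leLHS]mul1e lee_wpmul2r//; exact: heat_mass_ge1.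
apply: eq_integral => x _; apply: eq_integral => y _.
by rewrite frac_heat_kernelE.
Qed.

End heat.
End kernels.

(** * The heat energy dominates Gaussian energies *)

Section bessel.
Variables (R : realType) (n : nat) (E : set (lebesgue_rV R n)).
Local Notation mu := (@leb R n).
Hypotheses (mE : measurable E) (Eoo : (mu E < +oo)%E).
Implicit Types (phi : 'rV[R]_n -> R).
Local Notation symbol phi :=
  (measurable_fun [set: lebesgue_rV R n] phi /\ mu.-integrable setT (EFin \o phi)).

Lemma symbol_gauss u : 0 < u -> symbol (@gauss_symbol R n u).
Proof. by move=> u0; split; [exact: measurable_gauss_symbol|exact: gauss_integrable]. Qed.

Lemma symbolB phi psi a : symbol phi -> symbol psi -> symbol (fun xi => phi xi - a * psi xi).
Proof.
move=> [m1 i1] [m2 i2].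
have m3 : measurable_fun [set: lebesgue_rV R n] (fun xi => - a * psi xi).
  exact: measurable_funM (measurable_cst _) m2.
split.
  rewrite (_ : (fun _ => _) = (fun xi => phi xi + - a * psi xi)); last first.
    by apply/funext => xi; rewrite mulNr.
  exact: measurable_funD m1 m3.
have := integrable_add i1 (integrable_scale (- a) i2).
congr (mu.-integrable setT _); apply/funext => xi /=.
by rewrite mulNr.
Qed.

Lemma fourier_autocorrB phi psi a : symbol phi -> symbol psi ->
  fourier_autocorr E (fun xi => phi xi - a * psi xi) =
  fourier_autocorr E phi - a * fourier_autocorr E psi.
Proof.
move=> [m1 i1] [m2 i2]; rewrite /fourier_autocorr.
have j1 := integrable_phi_power mE Eoo m1 i1.
have j2 := integrable_phi_power mE Eoo m2 i2.
rewrite (@Rintegral_combination _ _ R mu _ _ _ 1 1 (- a) j1 j2).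
  by move=> *; ring.
by move=> xi; ring.
Qed.

Lemma symbol_lincomb phi (a u : nat -> R) J : symbol phi -> (forall j, 0 < u j) ->
  symbol (fun xi => phi xi - \sum_(j < J) a j * gauss_symbol (u j) xi) /\
  fourier_autocorr E (fun xi => phi xi - \sum_(j < J) a j * gauss_symbol (u j) xi) =
  fourier_autocorr E phi - \sum_(j < J) a j * fourier_autocorr E (gauss_symbol (u j)).
Proof.
move=> sphi u0; elim: J => [|J [sJ aJ]].
  rewrite big_ord0 subr0 (_ : (fun _ => _) = phi)//.
  by apply/funext => xi; rewrite big_ord0 subr0.
have -> : (fun xi => phi xi - \sum_(j < J.+1) a j * gauss_symbol (u j) xi) =
    (fun xi => (phi xi - \sum_(j < J) a j * gauss_symbol (u j) xi) - a J * gauss_symbol (u J) xi).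
  by apply/funext => xi; rewrite big_ord_recr opprD addrA.
split; first exact: symbolB sJ (symbol_gauss (u0 J)).
by rewrite (fourier_autocorrB _ sJ (symbol_gauss (u0 J))) aJ big_ord_recr opprD addrA.
Qed.

Lemma gauss_energy_ge0 u : 0 < u -> (0 <= gauss_energy u E)%E.
Proof.
move=> u0; apply: integral_ge0 => x _; apply: integral_ge0 => y _.
by rewrite lee_fin gauss_kernel_ge0.
Qed.

Lemma gauss_energy_fin u : 0 < u -> gauss_energy u E = (fine (gauss_energy u E))%:E.
Proof.
move=> u0; rewrite fineK// ge0_fin_numE ?gauss_energy_ge0//.
apply: le_lt_trans Eoo; rewrite -(gauss_energyE u0 mE Eoo) leeDl// lee_fin.
apply: mulr_ge0; first by rewrite invr_ge0 exprn_ge0// mulr_ge0// pi_ge0.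
apply: Rintegral_ge0 => xi _; rewrite mulr_ge0 ?expR_ge0 ?power_ge0//.
Qed.

Lemma gauss_energy_fineE u : 0 < u ->
  fine (gauss_energy u E) = fine (mu E) - fourier_autocorr E (gauss_symbol u).
Proof.
move=> u0; rewrite -(gauss_energyE u0 mE Eoo) (gauss_energy_fin u0) /=.
by rewrite addrK.
Qed.

Lemma gauss_autocorr_le u : 0 < u -> fourier_autocorr E (gauss_symbol u) <= fine (mu E).
Proof.
move=> u0; rewrite -subr_ge0 -gauss_energy_fineE//; apply: fine_ge0.
exact: gauss_energy_ge0.
Qed.

(** Half of Plancherel's theorem: damping [phi] by a Gaussian symbol reduces
    it to Gaussian energies, which are nonnegative. *)
Lemma fourier_autocorr_le phi b : symbol phi -> 0 <= b -> (forall xi, phi xi <= b) ->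
  fourier_autocorr E phi <= b * fine (mu E).
Proof.
move=> [mphi iphi] b0 phib.
pose u k : R := k.+1%:R^-1.
have u0 k : 0 < u k by rewrite invr_gt0.
have g1 k (xi : 'rV[R]_n) : gauss_symbol (u k) xi <= 1.
  by rewrite expR_le1 mulNr oppr_le0 mulr_ge0 ?sqnorm_ge0// ltW.
have cu : u k @[k --> \oo] --> (0 : R) by exact: cvg_harmonic.
have sk k : symbol (fun xi => phi xi * gauss_symbol (u k) xi).
  split; first exact: measurable_funM mphi (measurable_gauss_symbol _).
  have ia : mu.-integrable setT (EFin \o (fun xi => `|phi xi|)).
    exact: (integrable_norm iphi).
  apply: (integrable_ge0_dominated _ ia).
    exact: measurable_funM mphi (measurable_gauss_symbol _).
  by move=> xi; rewrite normrM ler_piMr// ger0_norm ?expR_ge0.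
have le k : fourier_autocorr E (fun xi => phi xi * gauss_symbol (u k) xi) <= b * fine (mu E).
  apply: le_trans (ler_wpM2l b0 (gauss_autocorr_le (u0 k))).
  rewrite /fourier_autocorr mulrCA ler_wpM2l//.
    by rewrite invr_ge0 exprn_ge0// mulr_ge0// pi_ge0.
  have ip := integrable_phi_power mE Eoo (measurable_gauss_symbol (u k)) (@gauss_integrable R n _ (u0 k)).
  rewrite -(RintegralZl _ measurableT ip); apply: le_Rintegral.
  - exact: measurableT.
  - by case: (sk k) => m1 i1; exact: integrable_phi_power.
  - exact: integrable_scale.
  - move=> xi _; rewrite mulrA ler_wpM2r ?power_ge0//.
    by rewrite ler_wpM2r ?expR_ge0.
have c : (fourier_autocorr E (fun xi => phi xi * gauss_symbol (u k) xi)) @[k --> \oo] -->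
    fourier_autocorr E phi.
  apply: cvgMr; have ip := integrable_phi_power mE Eoo mphi iphi.
  have mk k : measurable_fun [set: lebesgue_rV R n]
      (fun xi => phi xi * gauss_symbol (u k) xi * power E xi).
    by apply: measurable_funM (measurable_power mE Eoo); case: (sk k).
  have ptw xi : phi xi * gauss_symbol (u k) xi * power E xi @[k --> \oo] -->
      phi xi * power E xi.
    have cg : gauss_symbol (u k) xi @[k --> \oo] --> (1 : R).
      have c0 : - u k * sqnorm xi @[k --> \oo] --> (0 : R).
        rewrite [X in _ --> X](_ : 0 = - 0 * sqnorm xi); last by rewrite oppr0 mul0r.
        by apply: cvgMl; apply: cvgN.
      have := (@continuous_expR R 0); rewrite /continuous_at expR0; exact: cvg_comp.
    rewrite [X in _ --> X](_ : _ = phi xi * 1 * power E xi); last by rewrite mulr1.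
    by apply: cvgMl; apply: cvgMr.
  have ia : mu.-integrable setT (EFin \o (fun xi => `|phi xi * power E xi|)).
    exact: (integrable_norm ip).
  have dom k xi : `|phi xi * gauss_symbol (u k) xi * power E xi| <= `|phi xi * power E xi|.
    rewrite mulrAC normrM ler_piMr// ger0_norm ?expR_ge0//.
  have [_ _ cI] := dominated_convergence_real mk ptw ia dom.
  by apply: fine_cvg; move: cI; rewrite (fineK_Rintegral measurableT ip).
rewrite -(cvg_lim _ c)//; apply: limr_le; last exact: nearW.
by apply/cvg_ex; eexists; exact: c.
Qed.

End bessel.

Section heat_controls_gauss.
Variables (R : realType) (s : R).
Hypothesis s01 : 0 < s < 1.
Local Notation p := ((4 : R) `^ s).

Let q1 : 1 < 4 :> R. Proof. by rewrite ltr1n. Qed.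

Let p1 : 1 < p. Proof. exact: powR_base_gt1. Qed.

Lemma sum_powers_le J : \sum_(j < J.+1) p ^+ j <= p / (p - 1) * p ^+ J.
Proof.
have d0 : 0 < p - 1 by rewrite subr_gt0.
rewrite mulrAC ler_pdivlMr// -exprS mulrC -subrX1.
by rewrite gerBl.
Qed.

(** The dyadic sum is a part of the Bernstein sum of base [4]. *)
Lemma dyadic_sum_le l J : 0 <= l ->
  \sum_(j < J.+1) bernstein_dn 4 s l j <= p * bernstein 4 s 1 * l `^ s.
Proof.
rewrite le_eqVlt => /predU1P[<-|l0].
  rewrite big1 ?mulr_ge0 ?powR_ge0 ?(ltW (bernstein1_gt0 q1 s01))//.
  by move=> j _; rewrite /bernstein_dn mulr0 oppr0 expR0 subrr mulr0.
have /andP[_] := bernstein_homogeneous q1 s01 l0.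
rewrite ler_pdivrMr ?bernstein1_gt0// mulrAC; apply: le_trans.
apply: le_trans (bernstein_partial_le q1 s01 J.+1 (ltW l0)).
rewrite /series /= big_mkord.
have -> : \sum_(i < J.+1) bernstein_term 4 s l i =
    \sum_(i < J.+1) bernstein_up 4 s l i + \sum_(i < J.+1) bernstein_dn 4 s l i.+1.
  by rewrite -big_split.
have u0 : bernstein_dn 4 s l 0 = bernstein_up 4 s l 0.
  by rewrite /bernstein_dn /bernstein_up !expr0 invr1.
rewrite big_ord_recl /= u0 [X in _ <= X + _]big_ord_recl [X in _ <= _ + X]big_ord_recr /=.
have U0 : 0 <= \sum_(i < J) bernstein_up 4 s l (lift ord0 i).
  by apply: sumr_ge0 => i _; apply: bernstein_up_ge0 => //; exact: ltW.
have D0 : 0 <= bernstein_dn 4 s l J.+1 by apply: bernstein_dn_ge0 => //; exact: ltW.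
under [X in _ + X <= _]eq_bigr do rewrite /bump /= add1n.
lra.
Qed.

Lemma one_sub_expR_ge (y : R) : 0 <= y -> y / (1 + y) <= 1 - expR (- y).
Proof.
move=> y0; have y1 : 0 < 1 + y by rewrite ltr_pwDl.
rewrite (_ : y / (1 + y) = 1 - (1 + y)^-1); last by field; rewrite gt_eqF.
by rewrite lerD2l lerN2 expRN lef_pV2 ?posrE ?expR_gt0// expR_ge1Dx.
Qed.

(** Up to constants, [t] times the dyadic sum is at most [t * l `^ s] as part
    of a Bernstein sum, and at most [1] as a geometric sum cut at [t * p ^+ J
    <= 1]; on the other side [1 - expR (- y)] is at least a multiple of the
    minimum of [1] and [y]. *)
Lemma dyadic_symbol_le : exists2 c : R, 0 < c &
  forall t J, 0 < t -> t * p ^+ J <= 1 ->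
  c * t * \sum_(j < J.+1) p ^+ j <= 1 /\
  forall l, 0 <= l -> c * t * \sum_(j < J.+1) bernstein_dn 4 s l j <= 1 - expR (- t * l `^ s).
Proof.
set A := p * bernstein 4 s 1; set B := p / (p - 1).
have p0 : 0 < p := lt_trans ltr01 p1.
have A0 : 0 < A by rewrite mulr_gt0// bernstein1_gt0.
have B0 : 0 < B by rewrite divr_gt0// subr_gt0.
have AB0 : 0 < A + B by rewrite addr_gt0.
(* [t] times the sum is at most [A * y] and at most [B], hence at most [A + B]
   times the minimum of [1] and [y]; the factor [2] is lost in bounding that
   minimum by [2 * (y / (1 + y))]. *)
exists (2 * (A + B))^-1; first by rewrite invr_gt0 mulr_gt0.
move=> t J t0 tJ.
have tS : t * \sum_(j < J.+1) p ^+ j <= B.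
  apply: (@le_trans _ _ (t * (B * p ^+ J))); first by rewrite ler_wpM2l ?(ltW t0)// sum_powers_le.
  by rewrite mulrCA ler_piMr// ltW.
split.
  by rewrite -mulrA ler_pdivrMl ?mulr_gt0// mulr1; lra.
move=> l l0; set S := \sum_(j < _) _; rewrite mulNr; set y := t * l `^ s.
have y0 : 0 <= y by rewrite mulr_ge0 ?powR_ge0// ltW.
have S1 : t * S <= A * y.
  rewrite /y mulrCA ler_wpM2l ?(ltW t0)//; exact: dyadic_sum_le.
have S2 : t * S <= B.
  apply: le_trans tS; rewrite ler_wpM2l ?(ltW t0)// ler_sum// => j _.
  by rewrite ler_piMr ?exprn_ge0 ?(ltW p0)// gerBl expR_ge0.
have h := one_sub_expR_ge y0; apply: le_trans h.
have y1 : 0 < 1 + y by rewrite ltr_pwDl.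
rewrite -mulrA ler_pdivlMr// -mulrA ler_pdivrMl ?mulr_gt0// mulrDr mulr1.
have : t * S * y <= B * y by rewrite ler_wpM2r.
nra.
Qed.

Variable n : nat.
Local Notation mu := (@leb R n).

(** With [kappa] the total weight of the dyadic sum, the symbol [expR (- t * l
    `^ s)] minus the weighted Gaussian symbols is at most [1 - kappa], so its
    integral against the power spectrum is at most [(1 - kappa)] times the
    measure of [E]. *)
Lemma dyadic_gauss_energy_le : exists2 c : R, 0 < c &
  forall (E : set (lebesgue_rV R n)) t J, measurable E -> (mu E < +oo)%E ->
  0 < t -> t * p ^+ J <= 1 ->
  ((c * t * \sum_(j < J.+1) p ^+ j * fine (gauss_energy (4 ^- j) E))%:E <=
   frac_heat_energy s t E)%E.
Proof.
have [c c0 hc] := dyadic_symbol_le; exists c => // E t J mE Eoo t0 tJ.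
have {hc}[k1 hc] := hc t J t0 tJ.
have u0 j : 0 < (4 : R) ^- j by rewrite invr_gt0 exprn_gt0.
pose phi := stretched_symbol s t : 'rV[R]_n -> R.
have sphi : measurable_fun [set: lebesgue_rV R n] phi /\ mu.-integrable setT (EFin \o phi).
  by split; [exact: measurable_stretched_symbol|exact: integrable_stretched_symbol].
have [sJ aJ] := symbol_lincomb mE Eoo (fun j => c * t * p ^+ j) J.+1 sphi u0.
set k := c * t * \sum_(j < J.+1) p ^+ j in k1.
have : fourier_autocorr E phi - \sum_(j < J.+1) c * t * p ^+ j * fourier_autocorr E (gauss_symbol (4 ^- j)) <=
    (1 - k) * fine (mu E).
  rewrite -aJ; apply: (fourier_autocorr_le mE Eoo sJ); first by rewrite subr_ge0.
  move=> xi; have := hc _ (sqnorm_ge0 xi); rewrite -/(stretched_symbol s t xi) -/(phi xi).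
  rewrite mulr_sumr /k mulr_sumr => h.
  have -> : \sum_(j < J.+1) c * t * p ^+ j * gauss_symbol (4 ^- j) xi =
    \sum_(j < J.+1) c * t * p ^+ j - \sum_(j < J.+1) c * t * bernstein_dn 4 s (sqnorm xi) j.
    rewrite -sumrB; apply: eq_bigr => j _.
    by rewrite /bernstein_dn /gauss_symbol mulNr; ring.
  lra.
have -> : c * t * \sum_(j < J.+1) p ^+ j * fine (gauss_energy (4 ^- j) E) =
    k * fine (mu E) - \sum_(j < J.+1) c * t * p ^+ j * fourier_autocorr E (gauss_symbol (4 ^- j)).
  rewrite /k -[_ * _ * fine _]mulrA mulr_suml !mulr_sumr -sumrB; apply: eq_bigr => j _.
  by rewrite gauss_energy_fineE//; ring.
move=> h; have := heat_energy_ge s01 t0 mE Eoo.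
have muf : mu E \is a fin_num by rewrite ge0_fin_numE ?measure_ge0.
rewrite -{1}(fineK muf) addeC -leeBlDl// -EFinB; apply: le_trans.
by rewrite lee_fin -/phi; lra.
Qed.

End heat_controls_gauss.

(** * Translation defects of a set *)

Section null_modification.
Context d (T : measurableType d) (R : realType).
Variables (m : {sigma_finite_measure set T -> \bar R}) (A B : set T) (k : T * T -> R).
Hypotheses (mA : measurable A) (mB : measurable B).
Hypotheses (mk : measurable_fun setT k) (k0 : forall p, 0 <= k p).
Hypotheses (AB : A `<=` B) (BA0 : m (B `\` A) = 0%E).

(** Both the inner and the outer domain change by a null set. *)
Lemma double_integral_null :
  (\int[m]_(x in A) \int[m]_(y in ~` A) (k (x, y))%:E =
   \int[m]_(x in B) \int[m]_(y in ~` B) (k (x, y))%:E)%E.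
Proof.
have mN : measurable (B `\` A) by exact: measurableD.
have inner x : (\int[m]_(y in ~` A) (k (x, y))%:E = \int[m]_(y in ~` B) (k (x, y))%:E)%E.
  rewrite (@ge0_negligible_integral _ _ _ m (~` A) (B `\` A))//.
  - by rewrite setDE setCI setCK setIUr setICl setU0 -setCU setUidr.
  - exact: measurableC.
  - apply: measurable_funTS; apply/measurable_EFinP.
    exact: (measurableT_comp mk (measurable_pair1 x)).
  - by move=> y _; rewrite lee_fin.
rewrite [RHS](@ge0_negligible_integral _ _ _ m B (B `\` A))//.
- by rewrite setDD setIidr//; apply: eq_integral => x _; exact: inner.
- by apply: measurable_funTS; apply: measurable_slice => //; exact: measurableC.
- by move=> x _; apply: integral_ge0 => y _; rewrite lee_fin.
Qed.

End null_modification.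

Lemma measurable_section2 d d' (T : measurableType d) (T' : measurableType d') (R : realType)
  (f : T * T' -> R) y : measurable_fun setT f -> measurable_fun setT (fun x => f (x, y)).
Proof. by move=> mf; exact: (measurableT_comp mf (measurable_pair2 y)). Qed.

Lemma measurable_integral_fst d (T : measurableType d) (R : realType)
  (m : {sigma_finite_measure set T -> \bar R}) (f : T * T -> \bar R) :
  measurable_fun setT f -> (forall p, (0 <= f p)%E) ->
  measurable_fun setT (fun y => \int[m]_x f (x, y))%E.
Proof. by move=> mf f0; apply: measurable_fun_fubini_tonelli_G. Qed.

Lemma ge0_integral_swap d (T : measurableType d) (R : realType)
  (m : {sigma_finite_measure set T -> \bar R}) (f : T * T -> \bar R) :
  measurable_fun setT f -> (forall p, (0 <= f p)%E) ->
  (\int[m]_x \int[m]_y f (x, y) = \int[m]_y \int[m]_x f (x, y))%E.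
Proof. by move=> mf f0; apply: fubini_tonelli. Qed.

Section moved.
Variables (R : realType) (n : nat).
Local Notation mu := (@leb R n).
Implicit Types (h k x y : 'rV[R]_n) (A B E F : set (lebesgue_rV R n)).

Definition translate h E : set (lebesgue_rV R n) := [set x | E ((x : 'rV[R]_n) + h)].

Lemma measurable_translate h E : measurable E -> measurable (translate h E).
Proof. by move=> mE; rewrite -[translate h E]setTI; exact: measurable_shift. Qed.

Lemma leb_translate h E : mu (translate h E) = mu E.
Proof. exact: lebesgue_outer_shift. Qed.

Lemma translateD h k E : translate h (translate k E) = translate (h + k) E.
Proof. by rewrite /translate; apply/seteqP; split => x /=; rewrite addrA. Qed.

Lemma translate0 E : translate 0 E = E.
Proof. by apply/seteqP; split => x; rewrite /translate /= addr0. Qed.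

(** The part of [E] that the translation by [h] moves out of [E]. For sets of
    finite measure this is half of the measure of the symmetric difference of
    [E] and its translate. *)
Definition moved E h := mu (E `\` translate h E).

(** A point that leaves [E] under [h + k] either leaves under [h], or stays
    and then leaves under [k]. *)
Lemma moved_sub E h k : measurable E -> (moved E (h + k) <= moved E h + moved E k)%E.
Proof.
move=> mE.
have m1 : measurable (E `\` translate h E) by apply: measurableD => //; exact: measurable_translate.
have m2 : measurable (translate h (E `\` translate k E)).
  by apply: measurable_translate; apply: measurableD => //; exact: measurable_translate.
rewrite /moved -[leRHS]addeC -(leb_translate h (E `\` translate k E)).
rewrite addeC; apply: le_trans (measureU2 _ m1 m2); apply: le_measure.
- by rewrite inE; apply: measurableD => //; exact: measurable_translate.
- by rewrite inE; exact: measurableU.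
- move=> x [Ex nE]; have [Eh|nh] := pselect (translate h E x); last by left.
  by right; split => //; move: nE; rewrite -translateD.
Qed.

(** A set and its translate have the same measure, so as much leaves [E] as
    enters it. *)
Lemma movedN E h : measurable E -> (mu E < +oo)%E -> moved E (- h) = moved E h.
Proof.
move=> mE Eoo; have mh := measurable_translate h mE.
have -> : moved E (- h) = mu (translate h E `\` E).
  have e0 : translate h (translate (- h) E) = E by rewrite translateD subrr translate0.
  rewrite /moved -(leb_translate h); congr (mu _).
  change (translate h E `\` translate h (translate (- h) E) = translate h E `\` E).
  by rewrite e0.
have e1 : mu E = (mu (E `\` translate h E) + mu (E `&` translate h E))%E.
  by rewrite (measureDI mu mE mh).
have e2 : mu E = (mu (translate h E `\` E) + mu (E `&` translate h E))%E.
  by rewrite -{1}(leb_translate h) (measureDI mu mh mE) setIC.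
have fI : mu (E `&` translate h E) \is a fin_num.
  rewrite ge0_fin_numE//; apply: le_lt_trans Eoo; apply: le_measure; rewrite ?inE//.
  exact: measurableI.
by rewrite /moved -[LHS](addeK _ fI) -e2 e1 addeK.
Qed.

Lemma moved_stable E F h : measurable E -> measurable F ->
  (moved F h <= moved E h + (mu (F `\` E) + mu (E `\` F)))%E.
Proof.
move=> mE mF; rewrite -(leb_translate h (E `\` F)).
have m1 : measurable (E `\` translate h E) by apply: measurableD => //; exact: measurable_translate.
have m2 : measurable (F `\` E) by exact: measurableD.
have m3 : measurable (translate h (E `\` F)) by apply: measurable_translate; exact: measurableD.
apply: (@le_trans _ _ (mu (E `\` translate h E) + mu ((F `\` E) `|` translate h (E `\` F)))%E).
  apply: le_trans (measureU2 _ m1 (measurableU _ _ m2 m3)); apply: le_measure.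
  - by rewrite inE; apply: measurableD => //; exact: measurable_translate.
  - by rewrite inE; apply: measurableU => //; exact: measurableU.
  - move=> x [Fx nF]; have [Ex|nE] := pselect (E x); last by right; left.
    have [Eh|nh] := pselect (translate h E x); last by left.
    by right; right.
by rewrite leeD2l// measureU2.
Qed.

(** Each step of a walk moves at most as much mass as the first one. *)
Lemma moved_mulrn E h j : measurable E -> (moved E (h *+ j.+1) <= (j.+1)%:R%:E * moved E h)%E.
Proof.
move=> mE; elim: j => [|j IH]; first by rewrite mulr1n mul1e.
rewrite mulrS; apply: le_trans (moved_sub _ _ mE) _.
by rewrite -[(j.+2)%:R]nat1r EFinD ge0_muleDl ?lee_fin// mul1e leeD2l.
Qed.

Section borel.
Variable (E : set 'rV[R]_n).
Hypothesis bE : measurable (E : set (borel_rV R n)).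
Let mE : measurable (E : set (lebesgue_rV R n)) := measurable_borel_leb bE.

Let move_ind (p : lebesgue_rV R n * lebesgue_rV R n) : R :=
  \1_E (p.1 : 'rV[R]_n) * \1_(~` E) ((p.1 : 'rV[R]_n) + p.2).

Let measurable_move_ind : measurable_fun setT move_ind.
Proof.
apply: measurable_funM.
  have mi : measurable_fun setT (@indic (borel_rV R n) R E) by exact: measurable_indic.
  exact: (measurable_coords_comp mi (@measurable_coords_fst _ _ _ _)).
have mi : measurable_fun setT (@indic (borel_rV R n) R (~` E)).
  by apply: measurable_indic; exact: measurableC.
apply: (measurable_coords_comp mi).
exact: measurable_coordsD (@measurable_coords_fst _ _ _ _) (@measurable_coords_snd _ _ _ _).
Qed.

Let movedE h : (\int[mu]_x (move_ind (x, h))%:E)%E = moved E h.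
Proof.
have mD : measurable (E `\` translate h E : set (lebesgue_rV R n)).
  by apply: measurableD => //; exact: measurable_translate.
transitivity (\int[mu]_x (@indic (lebesgue_rV R n) R (E `\` translate h E) x)%:E)%E.
  apply: eq_integral => x _; congr EFin.
  by rewrite /move_ind /= !indicE in_setD in_setC -natrM mulnb.
by rewrite integral_indic ?setIT.
Qed.

Let move_ind_ge0 p : 0 <= move_ind p. Proof. by rewrite mulr_ge0. Qed.

Section kernel.
Variable K : 'rV[R]_n -> R.
Hypotheses (mK : measurable_fun [set: borel_rV R n] K) (K0 : forall z, 0 <= K z).

Let f (p : lebesgue_rV R n * lebesgue_rV R n) : \bar R := (move_ind p * K p.2)%:E.

Let mf : measurable_fun setT f.
Proof.
apply/measurable_EFinP; apply: measurable_funM measurable_move_ind _.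
exact: (measurable_coords_comp mK (@measurable_coords_snd _ _ _ _)).
Qed.

Let f0 p : (0 <= f p)%E. Proof. by rewrite lee_fin mulr_ge0. Qed.

Let intf h : (\int[mu]_x f (x, h) = (K h)%:E * moved E h)%E.
Proof.
have ms : measurable_fun [set: lebesgue_rV R n] (fun x => (move_ind (x, h))%:E).
  by apply/measurable_EFinP; exact: (@measurable_section2 _ _ _ _ R move_ind h measurable_move_ind).
rewrite -movedE -(ge0_integralZl_EFin mu measurableT _ ms (K0 h)).
  by apply: eq_integral => x _; rewrite /f /= mulrC EFinM.
by move=> x _; rewrite lee_fin.
Qed.

Lemma measurable_kernel_moved :
  measurable_fun [set: lebesgue_rV R n] (fun h => (K h)%:E * moved E h)%E.
Proof.
have := measurable_integral_fst mu mf f0.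
by congr measurable_fun; apply/funext => h; exact: intf.
Qed.

(** Substituting [y = x + h] turns the interaction of a set with its
    complement into an average of the translation defects. *)
Lemma double_integral_moved : (forall z, K (- z) = K z) ->
  (\int[mu]_(x in E) \int[mu]_(y in ~` E) (K ((x : 'rV[R]_n) - y))%:E =
   \int[mu]_h ((K h)%:E * moved E h))%E.
Proof.
move=> KN; under [RHS]eq_integral do rewrite -intf.
rewrite -(ge0_integral_swap mu mf f0) [LHS]integral_mkcond.
apply: eq_integral => x _; rewrite patchE.
have mi : measurable_fun setT (@indic (borel_rV R n) R (~` E)).
  by apply: measurable_indic; exact: measurableC.
have mg : measurable_fun [set: borel_rV R n] (fun y => (\1_(~` E) y * K (x - y))%:E).
  apply/measurable_EFinP; apply: measurable_funM mi _.
  apply: (measurable_coords_comp mK); apply: measurable_coordsB.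
  - exact: measurable_coords_cst.
  - exact: measurable_coords_borel.
have g0 y : (0 <= (\1_(~` E) y * K ((x : 'rV[R]_n) - y))%:E)%E by rewrite lee_fin mulr_ge0.
case: ifPn => xE; last first.
  rewrite integral0_eq// => h _; rewrite /f /move_ind /= indicE (negbTE xE).
  by rewrite !mul0r.
transitivity (\int[mu]_y (\1_(~` E) y * K ((x : 'rV[R]_n) - y))%:E)%E.
  rewrite integral_mkcond; apply: eq_integral => y _; rewrite patchE indicE.
  by case: ifP => _; rewrite ?mul1r ?mul0r.
rewrite -(ge0_integral_leb_borel_shift x mg g0); apply: eq_integral => h _.
rewrite /f /move_ind /= [\1_E x]indicE xE mul1r [in RHS]addrC.
by rewrite opprD addrCA subrr addr0 KN.
Qed.

End kernel.

Lemma measurable_moved : measurable_fun [set: lebesgue_rV R n] (moved E).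
Proof.
have := @measurable_kernel_moved (cst 1) (measurable_cst _) (fun _ => ler01).
by under eq_fun do rewrite mul1e.
Qed.

End borel.
End moved.

(** * Gaussian energies against translation defects *)

Section ge0_integral.
Context d (T : measurableType d) (R : realType) (m : {measure set T -> \bar R}).
Implicit Types f g : T -> \bar R.

Lemma ge0_integral_scale f c : measurable_fun setT f -> (forall x, (0 <= f x)%E) ->
  0 <= c -> (\int[m]_x (c%:E * f x) = c%:E * \int[m]_x f x)%E.
Proof. by move=> mf f0 c0; rewrite ge0_integralZl_EFin. Qed.

Lemma ge0_integral_add f g : measurable_fun setT f -> (forall x, (0 <= f x)%E) ->
  measurable_fun setT g -> (forall x, (0 <= g x)%E) ->
  (\int[m]_x (f x + g x) = \int[m]_x f x + \int[m]_x g x)%E.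
Proof. by move=> mf f0 mg g0; rewrite ge0_integralD. Qed.

Lemma ge0_integral_mono f g : measurable_fun setT f -> (forall x, (0 <= f x)%E) ->
  measurable_fun setT g -> (forall x, (f x <= g x)%E) ->
  (\int[m]_x f x <= \int[m]_x g x)%E.
Proof.
by move=> mf f0 mg fg; apply: ge0_le_integral.
Qed.

Lemma ge0_integral_series (f_ : nat -> T -> \bar R) : (forall k, measurable_fun setT (f_ k)) ->
  (forall k x, (0 <= f_ k x)%E) ->
  measurable_fun setT (fun x => \sum_(0 <= k <oo) f_ k x)%E /\
  (\int[m]_x (\sum_(0 <= k <oo) f_ k x) = \sum_(0 <= k <oo) \int[m]_x f_ k x)%E.
Proof.
move=> mf f0; split; last by rewrite integral_nneseries.
by apply: ge0_emeasurable_sum.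
Qed.
End ge0_integral.

Section gauss_moved.
Variables (R : realType) (n : nat).
Local Notation mu := (@leb R n).
Implicit Types (h k z : 'rV[R]_n) (u v : R).

Lemma gauss_kernel_halve u z : 0 < u ->
  gauss_kernel u z = Num.sqrt 2 ^+ n * expR (- (sqnorm z / (8 * u))) * gauss_kernel (2 * u) z.
Proof.
move=> u0; rewrite /gauss_kernel.
have -> : expR (- (sqnorm z / (4 * u))) =
    expR (- (sqnorm z / (8 * u))) * expR (- (sqnorm z / (4 * (2 * u)))).
  rewrite -expRD; congr expR; rewrite -opprD; congr (- _).
  by field; rewrite gt_eqF.
have -> : Num.sqrt (4 * pi * (2 * u)) = Num.sqrt 2 * Num.sqrt (4 * pi * u).
  by rewrite -sqrtrM//; congr Num.sqrt; ring.
rewrite exprMn.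
set a := Num.sqrt 2 ^+ n; set b := Num.sqrt _ ^+ n.
have a0 : a != 0 by rewrite gt_eqF// exprn_gt0// sqrtr_gt0.
have b0 : b != 0 by rewrite gt_eqF// exprn_gt0// sqrtr_gt0 !mulr_gt0// pi_gt0.
by field; rewrite a0 b0.
Qed.

Lemma gauss_kernel_le_double u z r : 0 < u -> r <= sqnorm z ->
  gauss_kernel u z <= Num.sqrt 2 ^+ n * expR (- (r / (8 * u))) * gauss_kernel (2 * u) z.
Proof.
move=> u0 rz; rewrite (gauss_kernel_halve z u0).
rewrite ler_wpM2r ?gauss_kernel_ge0 ?mulr_gt0// ler_wpM2l ?exprn_ge0 ?sqrtr_ge0//.
by rewrite ler_expR lerN2 ler_wpM2r// invr_ge0 mulr_ge0// ltW.
Qed.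

(** The parallelogram inequality compares [sqnorm (k - h)] with half of
    [sqnorm k]; doubling the variance compensates for the half. *)
Lemma gauss_kernel_shift_le v k h : 0 < v -> sqnorm h <= 2 * v ->
  gauss_kernel v (k - h) <= Num.sqrt 2 ^+ n * expR (2^-1) * gauss_kernel (2 * v) k.
Proof.
move=> v0 hv; have := sqnorm_parallelogram (k - h) h; rewrite subrK => par.
rewrite /gauss_kernel.
have -> : Num.sqrt (4 * pi * (2 * v)) = Num.sqrt 2 * Num.sqrt (4 * pi * v).
  by rewrite -sqrtrM//; congr Num.sqrt; ring.
rewrite exprMn.
set a := Num.sqrt 2 ^+ n; set b := Num.sqrt _ ^+ n.
have a0 : a != 0 by rewrite gt_eqF// exprn_gt0// sqrtr_gt0.
have b0 : b != 0 by rewrite gt_eqF// exprn_gt0// sqrtr_gt0 !mulr_gt0// pi_gt0.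
have aE x y : a * x * ((a * b)^-1 * y) = b^-1 * (x * y) by field; rewrite a0 b0.
rewrite aE {aE}.
rewrite ler_wpM2l ?invr_ge0 ?exprn_ge0 ?sqrtr_ge0// -expRD ler_expR.
rewrite (_ : 2^-1 - _ = - ((sqnorm k - 4 * v) / (8 * v))); last by field; rewrite gt_eqF.
rewrite lerN2 ler_pdivrMr ?mulr_gt0// (_ : _ * (8 * v) = 2 * sqnorm (k - h)).
  lra.
by field; rewrite gt_eqF.
Qed.

Section borel.
Variable E : set 'rV[R]_n.
Hypotheses (bE : measurable (E : set (borel_rV R n))) (Eoo : (mu E < +oo)%E).
Let mE : measurable (E : set (lebesgue_rV R n)) := measurable_borel_leb bE.

Lemma moved_le h : (moved E h <= mu E)%E.
Proof.
apply: le_measure; [rewrite inE|by rewrite inE|exact: subDsetl].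
by apply: measurableD => //; exact: measurable_translate.
Qed.

Lemma gauss_energy_moved u : 0 < u ->
  gauss_energy u E = (\int[mu]_h ((gauss_kernel u h)%:E * moved E h))%E.
Proof.
move=> u0; apply: (double_integral_moved bE (measurable_gauss_kernel u)).
- by move=> z; exact: gauss_kernel_ge0.
- exact: gauss_kernelN.
Qed.

Lemma measurable_gauss_moved u : 0 < u ->
  measurable_fun [set: lebesgue_rV R n] (fun h => (gauss_kernel u h)%:E * moved E h)%E.
Proof.
move=> u0; apply: (measurable_kernel_moved bE (measurable_gauss_kernel u)).
by move=> z; exact: gauss_kernel_ge0.
Qed.

Definition gauss_const : R := Num.sqrt 2 ^+ n * (1 + expR 2^-1).

Lemma gauss_const_gt0 : 0 < gauss_const.
Proof. by rewrite mulr_gt0 ?exprn_gt0 ?sqrtr_gt0// addr_gt0 ?expR_gt0. Qed.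

(** Averaging [moved E h <= moved E (k + h) + moved E k] over a Gaussian in
    [k]: a shift of [h] by at most the standard deviation is absorbed by
    doubling the variance. *)
Lemma moved_le_gauss_energy u h : 0 < u -> sqnorm h <= u ->
  (moved E h <= gauss_const%:E * gauss_energy u E)%E.
Proof.
(* A Gaussian of parameter [v] leaves room for doubling the variance to [u]. *)
move=> u0 hu; pose v := u / 2.
have v0 : 0 < v by rewrite divr_gt0.
have uE : u = 2 * v by rewrite /v mulrC divfK.
have mm := measurable_moved bE.
have G0 (k : 'rV[R]_n) : (0 <= (gauss_kernel v k)%:E)%E by rewrite lee_fin gauss_kernel_ge0.
have gm (k : 'rV[R]_n) : (0 <= (gauss_kernel u k)%:E * moved E k)%E.
  by rewrite mule_ge0// lee_fin gauss_kernel_ge0.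
pose f k := ((gauss_kernel v (k - h))%:E * moved E k)%E.
have mf : measurable_fun [set: lebesgue_rV R n] f.
  apply: emeasurable_funM mm; apply/measurable_EFinP.
  apply: measurable_fun_borel_leb; apply: (measurable_coords_comp (measurable_gauss_kernel v)).
  by apply: measurable_coordsB; [exact: measurable_coords_borel|exact: measurable_coords_cst].
have f0 k : (0 <= f k)%E by rewrite mule_ge0// lee_fin gauss_kernel_ge0.
have fk (k : 'rV[R]_n) : f (k + h) = ((gauss_kernel v k)%:E * moved E (k + h)%R)%E.
  by rewrite /f addrK.
have gs (k : 'rV[R]_n) : (0 <= (gauss_kernel v k)%:E * moved E k)%E by rewrite mule_ge0.
have mG : measurable_fun [set: lebesgue_rV R n] (fun k => (gauss_kernel v k)%:E).
  by apply/measurable_EFinP; exact: measurable_fun_borel_leb (measurable_gauss_kernel v).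
have mGv := measurable_gauss_moved v0; have mGu := measurable_gauss_moved u0.
have mfh := measurableT_comp mf (measurable_shift h).
have -> : moved E h = (\int[mu]_k ((gauss_kernel v k)%:E * moved E h))%E.
  have hf : moved E h = (fine (moved E h))%:E.
    by rewrite fineK// ge0_fin_numE//; exact: le_lt_trans (moved_le h) Eoo.
  have d0 : 0 <= fine (moved E h) by exact: fine_ge0.
  under eq_integral do rewrite muleC hf.
  by rewrite (ge0_integral_scale mu mG G0 d0) gauss_kernel_mass// mule1 -hf.
have -> : (gauss_const%:E * gauss_energy u E =
    \int[mu]_k (gauss_const%:E * ((gauss_kernel u k)%:E * moved E k)))%E.
  by rewrite gauss_energy_moved// (ge0_integral_scale mu mGu gm (ltW gauss_const_gt0)).
apply: (@le_trans _ _ (\int[mu]_k (f (k + h)%R + (gauss_kernel v k)%:E * moved E k))%E).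
  apply: (ge0_integral_mono _ _ _ (emeasurable_funD mfh mGv)).
  - exact: emeasurable_funM mG (measurable_cst _).
  - by move=> k; rewrite mule_ge0.
  - move=> k; rewrite [(f \o _) k]fk -ge0_muleDr// lee_wpmul2l//.
    have := moved_sub ((k : 'rV[R]_n) + h) (- k) mE; rewrite addrAC subrr add0r.
    by rewrite (movedN k mE Eoo).
rewrite (ge0_integral_add mu mfh (fun k => f0 _) mGv gs).
rewrite (ge0_integral_leb_shift h mf f0) -(ge0_integral_add mu mf f0 mGv gs).
apply: (ge0_integral_mono _ (emeasurable_funD mf mGv)).
- by move=> k; rewrite adde_ge0.
- exact: emeasurable_funM (measurable_cst _) mGu.
- move=> k; rewrite muleA -EFinM /f.
  rewrite -ge0_muleDl// lee_wpmul2r// -EFinD lee_fin /gauss_const mulrDr mulr1 mulrDl addrC.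
  apply: lerD; last by rewrite uE; apply: gauss_kernel_shift_le => //; rewrite -uE.
  have := gauss_kernel_le_double v0 (sqnorm_ge0 k).
  by rewrite mul0r oppr0 expR0 mulr1 -uE.
Qed.

(** The Gaussian mass outside of the ball of square radius [r] is
    exponentially small, and there the defect is at most the measure of [E]. *)
Lemma gauss_energy_le_moved u r a V : 0 < u -> 0 <= a -> 0 <= V -> (mu E <= V%:E)%E ->
  (forall h, sqnorm h <= r -> (moved E h <= a%:E)%E) ->
  (gauss_energy u E <= (a + V * Num.sqrt 2 ^+ n * expR (- (r / (8 * u))))%:E)%E.
Proof.
move=> u0 a0 V0 EV Ea; set b := _ * expR _.
have b0 : 0 <= b by rewrite mulr_ge0 ?expR_ge0// mulr_ge0// exprn_ge0// sqrtr_ge0.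
have v0 : 0 < 2 * u by rewrite mulr_gt0.
have mG w : measurable_fun [set: lebesgue_rV R n] (fun k => (gauss_kernel w k)%:E).
  by apply/measurable_EFinP; exact: measurable_fun_borel_leb (measurable_gauss_kernel w).
have G0 w (k : 'rV[R]_n) : 0 < w -> (0 <= (gauss_kernel w k)%:E)%E.
  by move=> w0; rewrite lee_fin gauss_kernel_ge0.
have -> : ((a + b)%:E = \int[mu]_k (a%:E * (gauss_kernel u k)%:E + b%:E * (gauss_kernel (2 * u) k)%:E))%E.
  rewrite (ge0_integral_add mu).
  - rewrite (ge0_integral_scale mu (mG u) (fun k => G0 u k u0) a0).
    rewrite (ge0_integral_scale mu (mG (2 * u)) (fun k => G0 _ k v0) b0).
    by rewrite !gauss_kernel_mass// !mule1 -EFinD.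
  - exact: emeasurable_funM (measurable_cst _) (mG u).
  - by move=> k; rewrite mule_ge0 ?G0.
  - exact: emeasurable_funM (measurable_cst _) (mG (2 * u)).
  - by move=> k; rewrite mule_ge0 ?G0.
rewrite gauss_energy_moved//; apply: ge0_integral_mono.
- exact: measurable_gauss_moved.
- by move=> k; rewrite mule_ge0 ?G0.
- by apply: emeasurable_funD; apply: emeasurable_funM; (exact: measurable_cst || exact: mG).
- move=> k; have [kr|kr] := leP (sqnorm k) r.
    apply: (@le_trans _ _ (a%:E * (gauss_kernel u k)%:E)%E).
      by rewrite muleC lee_wpmul2r ?G0// Ea.
    by rewrite leeDl// mule_ge0 ?G0.
  apply: (@le_trans _ _ (b%:E * (gauss_kernel (2 * u) k)%:E)%E); last first.
    by rewrite leeDr// mule_ge0 ?G0.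
  apply: (@le_trans _ _ ((gauss_kernel u k)%:E * V%:E)%E).
    by rewrite lee_wpmul2l ?G0//; exact: le_trans (moved_le k) EV.
  rewrite -!EFinM lee_fin mulrC /b -!mulrA ler_wpM2l// mulrA.
  by apply: gauss_kernel_le_double => //; exact: ltW.
Qed.

End borel.

(** The translation defects are stable uniformly in [h], and the Gaussian has
    mass one. *)
Lemma gauss_energy_stable u (E F : set 'rV[R]_n) : 0 < u ->
  measurable (E : set (borel_rV R n)) -> measurable (F : set (borel_rV R n)) ->
  (mu (F `\` E) + mu (E `\` F) < +oo)%E ->
  (gauss_energy u F <= gauss_energy u E + (mu (F `\` E) + mu (E `\` F)))%E.
Proof.
move=> u0 bE bF; set a := (_ + _)%E => aoo.
have a0 : (0 <= a)%E by rewrite adde_ge0.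
have aE : a = (fine a)%:E by rewrite fineK// ge0_fin_numE.
have fa0 : 0 <= fine a by exact: fine_ge0.
have mG : measurable_fun [set: lebesgue_rV R n] (fun k => (gauss_kernel u k)%:E).
  by apply/measurable_EFinP; exact: measurable_fun_borel_leb (measurable_gauss_kernel u).
have G0 (k : 'rV[R]_n) : (0 <= (gauss_kernel u k)%:E)%E by rewrite lee_fin gauss_kernel_ge0.
have mGE := measurable_gauss_moved bE u0; have mGF := measurable_gauss_moved bF u0.
have ma : measurable_fun [set: lebesgue_rV R n] (fun k => (fine a)%:E * (gauss_kernel u k)%:E)%E.
  exact: emeasurable_funM (measurable_cst _) mG.
rewrite !gauss_energy_moved//.
have -> : a = (\int[mu]_k ((fine a)%:E * (gauss_kernel u k)%:E))%E.
  by rewrite (ge0_integral_scale mu mG G0 fa0) gauss_kernel_mass// mule1.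
rewrite -(ge0_integral_add mu mGE _ ma); last 2 first.
- by move=> k; rewrite mule_ge0.
- by move=> k; rewrite mule_ge0.
apply: (ge0_integral_mono mu mGF _ (emeasurable_funD mGE ma)).
- by move=> k; rewrite mule_ge0.
- move=> k; rewrite [((fine a)%:E * _)%E]muleC -aE -ge0_muleDr// lee_wpmul2l//.
  exact: moved_stable (measurable_borel_leb bE) (measurable_borel_leb bF).
Qed.

(** * The fractional perimeter as a sum of Gaussian energies *)

Lemma powR_half_natr (x r : R) : 0 < x -> x `^ (n%:R / 2 + r) = Num.sqrt x ^+ n * x `^ r.
Proof.
move=> x0; rewrite powRD; last by rewrite (gt_eqF x0) implybT.
congr (_ * _).
by rewrite mulrC powRrM powR12_sqrt ?ltW// powR_mulrn ?sqrtr_ge0.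
Qed.

Section frac_perimeter.
Variable s : R.
Hypothesis s01 : 0 < s < 1.
Local Notation p := ((4 : R) `^ s).

Definition frac_kernel z : R := enorm z `^ (- n%:R - 2 * s).

Lemma frac_kernel_ge0 z : 0 <= frac_kernel z. Proof. exact: powR_ge0. Qed.

Lemma frac_kernelE z : frac_kernel z = sqnorm z `^ (- (n%:R / 2 + s)).
Proof.
rewrite /frac_kernel (_ : - n%:R - 2 * s = 2 * (- (n%:R / 2 + s))); last by field.
by rewrite powR_sqnorm.
Qed.

Lemma frac_kernelN z : frac_kernel (- z) = frac_kernel z.
Proof. by rewrite !frac_kernelE sqnormN. Qed.

Lemma measurable_frac_kernel : measurable_fun [set: borel_rV R n] frac_kernel.
Proof.
rewrite (_ : frac_kernel = fun z => sqnorm z `^ (- (n%:R / 2 + s))); last first.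
  by apply/funext => z; exact: frac_kernelE.
apply: (measurableT_comp (measurable_powR _)).
exact: measurable_sqnorm (@measurable_coords_borel R n).
Qed.

Definition frac_const : R := 2 ^+ n * p * Num.sqrt (4 * pi) ^+ n * expR (4^-1).

Lemma frac_const_ge0 : 0 <= frac_const.
Proof. by rewrite !mulr_ge0 ?exprn_ge0 ?sqrtr_ge0 ?powR_ge0 ?expR_ge0. Qed.

(** On a dyadic shell the kernel is comparable to one Gaussian. *)
Lemma frac_kernel_shell v z : 0 < v -> v / 4 <= sqnorm z <= v ->
  frac_kernel z <= frac_const * (v `^ (- s) * gauss_kernel v z).
Proof.
move=> v0 /andP[vz zv]; have /andP[s0 s1] := s01.
have v40 : 0 < v / 4 by rewrite divr_gt0.
rewrite frac_kernelE /gauss_kernel.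
apply: (@le_trans _ _ ((v / 4) `^ (- (n%:R / 2 + s)))).
  have a0 : 0 <= n%:R / 2 + s by apply: addr_ge0; [exact: divr_ge0|exact: ltW].
  rewrite !powRN lef_pV2 ?posrE ?powR_gt0//; last exact: lt_le_trans vz.
  by apply: ge0_ler_powR; rewrite ?nnegrE// ?(ltW v40) ?sqnorm_ge0.
have -> : (v / 4) `^ (- (n%:R / 2 + s)) = 2 ^+ n * p * (v `^ (- s) * Num.sqrt v ^- n).
  have s4 : Num.sqrt 4 = 2 :> R by rewrite (_ : 4 = 2 ^+ 2) ?sqrtr_sqr ?ger0_norm//; ring.
  rewrite powRN powRM ?ltW// -[4^-1]powR_inv1// -powRrM mulN1r powRN.
  rewrite opprK !powR_half_natr// s4; field.
  by rewrite !gt_eqF// ?powR_gt0// exprn_gt0// sqrtr_gt0.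
have -> : Num.sqrt (4 * pi * v) = Num.sqrt (4 * pi) * Num.sqrt v.
  by rewrite sqrtrM// mulr_ge0// pi_ge0.
rewrite exprMn /frac_const.
set a := 2 ^+ n * p; set b := Num.sqrt (4 * pi) ^+ n; set c := Num.sqrt v ^+ n.
set w := v `^ (- s).
have b0 : b != 0 by rewrite gt_eqF// exprn_gt0// sqrtr_gt0 mulr_gt0// pi_gt0.
have c0 : c != 0 by rewrite gt_eqF// exprn_gt0// sqrtr_gt0.
have -> : a * b * expR 4^-1 * (w * ((b * c)^-1 * expR (- (sqnorm z / (4 * v))))) =
    a * (w * c^-1) * (expR 4^-1 * expR (- (sqnorm z / (4 * v)))) by field; rewrite b0 c0.
rewrite ler_peMr ?mulr_ge0 ?exprn_ge0 ?powR_ge0 ?invr_ge0 ?exprn_ge0 ?sqrtr_ge0//.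
rewrite -expRD -[leLHS]expR0 ler_expR subr_ge0 ler_pdivrMr ?mulr_gt0//.
by rewrite mulrA mulVf// mul1r.
Qed.

Lemma dyadic_shell (r : R) : 0 < r ->
  (exists k : nat, 4 ^- k / 4 <= r <= 4 ^- k) \/ (exists k : nat, 4 ^+ k.+1 / 4 <= r <= 4 ^+ k.+1).
Proof.
move=> r0; have e0 (k : nat) : 0 < 4 ^+ k :> R by rewrite exprn_gt0.
have cross (x : R) : 1 <= x -> exists k : nat, 4 ^+ k <= x <= 4 ^+ k.+1.
  move=> x1; have ex : exists k : nat, x < 4 ^+ k.
    exists (Num.truncn x).+1; apply: (lt_le_trans (truncnS_gt x)).
    by rewrite -natrX ler_nat ltnW// ltn_expl.
  have := ex_minnP ex; case=> -[|k]; first by rewrite expr0 ltNge x1.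
  move=> xk mink; exists k; rewrite (ltW xk) andbT leNgt; apply/negP => /mink.
  by rewrite ltnn.
have [r1|r1] := leP 1 r.
  right; have [k kr] := cross r r1; exists k.
  by rewrite [_ / 4](_ : _ = 4 ^+ k)// exprSr mulfK.
left; have [|k /andP[k1 k2]] := cross r^-1; first by rewrite invf_ge1// ltW.
exists k; rewrite -invfM -exprSr -[r]invrK !lef_pV2 ?posrE ?invr_gt0//.
by rewrite k1 k2.
Qed.

Definition gauss_series (k : nat) z : R :=
  p ^+ k * gauss_kernel (4 ^- k) z + p ^- k.+1 * gauss_kernel (4 ^+ k.+1) z.

Lemma gauss_series_ge0 (k : nat) z : 0 <= gauss_series k z.
Proof.
by rewrite addr_ge0// mulr_ge0 ?invr_ge0 ?exprn_ge0 ?powR_ge0 ?gauss_kernel_ge0 ?invr_gt0 ?exprn_gt0.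
Qed.

Lemma powR_exprn (k : nat) (r : R) : (4 ^+ k : R) `^ r = (4 `^ r) ^+ k.
Proof. by rewrite -powR_mulrn// -powRrM mulrC powRrM powR_mulrn ?powR_ge0. Qed.

Lemma frac_kernel_le_series z : exists k : nat, frac_kernel z <= frac_const * gauss_series k z.
Proof.
have e0 (k : nat) : 0 < 4 ^+ k :> R by rewrite exprn_gt0.
have : 0 <= sqnorm z := sqnorm_ge0 z; rewrite le_eqVlt => /predU1P[z0|z0].
  exists 0%N; suff -> : frac_kernel z = 0 by rewrite mulr_ge0 ?frac_const_ge0 ?gauss_series_ge0.
  rewrite frac_kernelE -z0 powR0//; have /andP[s0 _] := s01.
  by rewrite lt_eqF// oppr_lt0 ltr_wpDl// divr_ge0.
have [[k hk]|[k hk]] := dyadic_shell z0; exists k.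
  apply: le_trans (frac_kernel_shell _ hk) _; first by rewrite invr_gt0.
  rewrite ler_wpM2l ?frac_const_ge0//.
  have -> : (4 ^- k) `^ (- s) = p ^+ k.
    by rewrite -powR_inv1 ?ltW// -powRrM mulN1r opprK powR_exprn.
  by rewrite lerDl mulr_ge0 ?invr_ge0 ?exprn_ge0 ?powR_ge0 ?gauss_kernel_ge0.
apply: le_trans (frac_kernel_shell (e0 _) hk) _.
rewrite ler_wpM2l ?frac_const_ge0// powRN powR_exprn lerDr.
by rewrite mulr_ge0 ?exprn_ge0 ?powR_ge0 ?gauss_kernel_ge0 ?invr_gt0.
Qed.

(** The scales below [1] are controlled by the hypothesis; at the scale [4 ^+
    k.+1] the Gaussian energy is at most the measure of [F] and its
    coefficient is summable. *)
Lemma frac_perimeter_lty (F : set 'rV[R]_n) (B : R) :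
  measurable (F : set (borel_rV R n)) -> (mu F < +oo)%E ->
  (forall J, \sum_(j < J) p ^+ j * fine (gauss_energy (4 ^- j) F) <= B) ->
  (frac_perimeter s F < +oo)%E.
Proof.
move=> bF Foo hB.
have mF := measurable_borel_leb bF.
have p1 : 1 < p by apply: powR_base_gt1 => //; rewrite ltr1n.
have p0 : 0 < p := lt_trans ltr01 p1.
have u0 (k : nat) : 0 < (4 : R) ^- k by rewrite invr_gt0 exprn_gt0.
have v0 (k : nat) : 0 < (4 : R) ^+ k by rewrite exprn_gt0.
rewrite /frac_perimeter (double_integral_moved bF measurable_frac_kernel frac_kernel_ge0 frac_kernelN).
pose g (k : nat) h := ((gauss_series k h)%:E * moved F h)%E.
have g0 (k : nat) h : (0 <= g k h)%E by rewrite mule_ge0// lee_fin gauss_series_ge0.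
have gE (k : nat) h : g k h = ((p ^+ k)%:E * ((gauss_kernel (4 ^- k) h)%:E * moved F h) +
    (p ^- k.+1)%:E * ((gauss_kernel (4 ^+ k.+1) h)%:E * moved F h))%E.
  rewrite !muleA -!EFinM -ge0_muleDl ?lee_fin ?mulr_ge0 ?gauss_kernel_ge0 ?invr_ge0 ?exprn_ge0 ?(ltW p0)//.
have m1 (k : nat) := measurable_gauss_moved bF (u0 k).
have m2 (k : nat) := measurable_gauss_moved bF (v0 k.+1).
have s1 (k : nat) h : (0 <= (gauss_kernel (4 ^- k) h)%:E * moved F h)%E.
  by rewrite mule_ge0// lee_fin gauss_kernel_ge0.
have s2 (k : nat) h : (0 <= (gauss_kernel (4 ^+ k.+1) h)%:E * moved F h)%E.
  by rewrite mule_ge0// lee_fin gauss_kernel_ge0.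
have q1 (k : nat) : 0 <= p ^+ k by rewrite exprn_ge0 ?ltW.
have q2 (k : nat) : 0 <= p ^- k.+1 by rewrite invr_ge0 exprn_ge0 ?ltW.
have M1 (k : nat) := emeasurable_funM (measurable_cst (p ^+ k)%:E) (m1 k).
have M2 (k : nat) := emeasurable_funM (measurable_cst (p ^- k.+1)%:E) (m2 k).
have mg (k : nat) : measurable_fun [set: lebesgue_rV R n] (g k).
  have := emeasurable_funD (M1 k) (M2 k); congr measurable_fun.
  by apply/funext => h; rewrite gE.
have Ig (k : nat) : (\int[mu]_h g k h)%E = (p ^+ k * fine (gauss_energy (4 ^- k) F) +
    p ^- k.+1 * fine (gauss_energy (4 ^+ k.+1) F))%:E.
  under eq_integral do rewrite gE.
  rewrite (ge0_integral_add mu (M1 k) _ (M2 k)).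
  - rewrite (ge0_integral_scale mu (m1 k) (s1 k) (q1 k)) (ge0_integral_scale mu (m2 k) (s2 k) (q2 k)).
    rewrite -!gauss_energy_moved// [gauss_energy _ F in X in (X + _)%E](gauss_energy_fin mF Foo (u0 k)).
    by rewrite [gauss_energy (4 ^+ _) F](gauss_energy_fin mF Foo (v0 k.+1)) -!EFinM -EFinD.
  - by move=> h; apply: mule_ge0; [rewrite /= lee_fin; exact: q1|exact: s1].
  - by move=> h; apply: mule_ge0; [rewrite /= lee_fin; exact: q2|exact: s2].
have [mS IS] := ge0_integral_series mu mg g0.
have S0 h : (0 <= \sum_(0 <= k <oo) g k h)%E by apply: nneseries_ge0 => k _ _; exact: g0.
apply: (@le_lt_trans _ _ (\int[mu]_h (frac_const%:E * \sum_(0 <= k <oo) g k h))%E).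
  apply: ge0_integral_mono.
  - apply: (measurable_kernel_moved bF measurable_frac_kernel frac_kernel_ge0).
  - by move=> h; rewrite mule_ge0// lee_fin frac_kernel_ge0.
  - exact: emeasurable_funM (measurable_cst _) mS.
  - move=> h; have [k hk] := frac_kernel_le_series h.
    apply: (@le_trans _ _ (frac_const%:E * g k h)%E).
      by rewrite /g muleA -EFinM lee_wpmul2r// lee_fin.
    rewrite lee_wpmul2l ?lee_fin ?frac_const_ge0//.
    apply: (@le_trans _ _ (\sum_(0 <= i < k.+1) g i h)%E); last first.
      by apply: nneseries_lim_ge => i _ _; exact: g0.
    by rewrite big_nat_recr//= leeDr// sume_ge0.
rewrite (ge0_integral_scale mu mS S0 frac_const_ge0) IS.
have Sb : (\sum_(0 <= k <oo) \int[mu]_h g k h <= (B + fine (mu F) * (p - 1)^-1)%:E)%E.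
  apply: lime_le.
    by apply: is_cvg_nneseries => k _ _; apply: integral_ge0.
  apply: nearW => J /=; rewrite big_mkord; under eq_bigr do rewrite Ig.
  rewrite sumEFin lee_fin big_split/=; apply: lerD; first exact: hB.
  apply: (@le_trans _ _ (\sum_(j < J) p ^- j.+1 * fine (mu F))).
    apply: ler_sum => j _; rewrite ler_wpM2l//; apply: fine_le.
    - by rewrite gauss_energy_fin.
    - by rewrite ge0_fin_numE.
    - rewrite -(gauss_energyE (v0 j.+1) mF Foo) leeDl// lee_fin.
      apply: mulr_ge0; first by rewrite invr_ge0 exprn_ge0// mulr_ge0// pi_ge0.
      by apply: Rintegral_ge0 => xi _; rewrite mulr_ge0 ?expR_ge0 ?power_ge0.
  rewrite -mulr_suml mulrC ler_wpM2l ?fine_ge0//.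
  have -> : \sum_(j < J) p ^- j.+1 = (1 - p ^- J) / (p - 1).
    elim: J => [|J IH]; first by rewrite big_ord0 expr0 invr1 subrr mul0r.
    rewrite big_ord_recr IH /= exprS; field.
    by rewrite subr_eq0 !gt_eqF// exprn_gt0.
  rewrite ler_piMl ?invr_ge0 ?subr_ge0 ?ltW// gerBl invr_ge0 exprn_ge0// ltW.
apply: le_lt_trans (lee_wpmul2l _ Sb) _; first by rewrite lee_fin frac_const_ge0.
by rewrite -EFinM ltry.
Qed.

End frac_perimeter.
End gauss_moved.

(** * Extraction along an ultrafilter *)

Section ultrafilter.
Context (R : realType) (F : set_system nat).
Hypothesis UF : UltraFilter F.

(** Bounded real sequences converge along an ultrafilter. *)
Lemma ultra_oscillation1 (g : nat -> R) (e : R) : (forall i, 0 <= g i <= 1) -> 0 < e ->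
  exists2 P, F P & forall i j, P i -> P j -> `|g i - g j| <= e.
Proof.
move=> g01 e0.
have FF : ProperFilter F by case: UF.
have [l [_ lc]] : `[0 : R, 1]%classic `&` cluster (g @ F) !=set0.
  apply: (@segment_compact R 0 1 (g @ F)).
  by apply: (@filterS _ F _ setT) filterT => i _ /=; rewrite in_itv /= g01.
exists (g @^-1` ball l (e / 2)).
  have [//|Fc] := in_ultra_setVsetC (g @^-1` ball l (e / 2)) UF.
  have [y [ny by_]] := lc (~` ball l (e / 2)) _ Fc (nbhsx_ballx l (e / 2) (divr_gt0 e0 (ltr0n _ 2))).
  by [].
move=> i j; rewrite /ball /= => hi hj.
rewrite (_ : g i - g j = (l - g j) - (l - g i)); last by ring.
by apply: le_trans (ler_normB _ _) _; rewrite [leRHS]splitr addrC lerD// ltW.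
Qed.

Lemma ultra_oscillation (T : eqType) (s : seq T) (g : nat -> T -> R) (e : R) :
  (forall i x, 0 <= g i x <= 1) -> 0 < e ->
  exists2 P, F P & forall i j x, P i -> P j -> x \in s -> `|g i x - g j x| <= e.
Proof.
move=> g01 e0; have FF : ProperFilter F by case: UF.
elim: s => [|x s [P FP hP]]; first by exists setT; [exact: filterT|].
have [Q FQ hQ] := @ultra_oscillation1 (g^~ x) e (fun i => g01 i x) e0.
exists (P `&` Q); first exact: filterI.
by move=> i j y [Pi Qi] [Pj Qj]; rewrite inE => /predU1P[->|ys]; [exact: hQ|exact: hP].
Qed.

(** A family that is eventually as close as desired along the ultrafilter has
    a subsequence that is Cauchy at any prescribed rate. *)
Lemma ultra_subsequence (close : nat -> nat -> nat -> Prop) :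
  (forall N, F [set i | (N < i)%N]) ->
  (forall k, exists2 P, F P & forall i j, P i -> P j -> close k i j) ->
  exists2 phi : nat -> nat, {homo phi : i j / (i < j)%N} & forall k, close k (phi k) (phi k.+1).
Proof.
move=> Foo hP; have FF : ProperFilter F by case: UF.
have hP' k : exists P : set nat, F P /\ forall i j, P i -> P j -> close k i j.
  by have [P ? ?] := hP k; exists P.
have [P PF] := choice hP'.
pose Q k := [set i | forall l, (l <= k)%N -> P l i].
have FQ k : F (Q k).
  elim: k => [|k IH].
    apply: filterS (PF 0%N).1 => i Pi l; by rewrite leqn0 => /eqP ->.
  apply: filterS (filterI IH (PF k.+1).1) => i [Qi Pi] l.
  by rewrite leq_eqVlt => /predU1P[->|]//; exact: Qi.
have ex_next (kN : nat * nat) : exists i, (kN.2 < i)%N /\ Q kN.1 i.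
  have /(@filter_ex _ F FF) [i [Qi Ni]] : F (Q kN.1 `&` [set i | (kN.2 < i)%N]).
    exact: filterI.
  by exists i.
have [next nextP] := choice ex_next.
pose phi := fix phi k := match k with 0 => next (0%N, 0%N) | k'.+1 => next (k, phi k') end.
have phiQ k : Q k (phi k) by case: k => [|k]; exact: (nextP (_, _)).2.
have phiS k : (phi k < phi k.+1)%N by exact: (nextP (_, _)).1.
exists phi; first exact: homo_ltn ltn_trans phiS.
move=> k; apply: (PF k).2; first exact: phiQ.
by apply: phiQ; exact: leqnSn.
Qed.

End ultrafilter.

Definition symdiff T (A B : set T) := (A `\` B) `|` (B `\` A).

Definition limsup_sets T (A : nat -> set T) : set T :=
  \bigcap_n \bigcup_(k in [set k | (n <= k)%N]) A k.

Section measure_limits.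
Context d (T : measurableType d) (R : realType) (m : {measure set T -> \bar R}).
Implicit Types A B C : set T.

Lemma measurable_symdiff A B : measurable A -> measurable B -> measurable (symdiff A B).
Proof. by move=> mA mB; apply: measurableU; exact: measurableD. Qed.

Variable A : nat -> set T.
Hypotheses (mA : forall k, measurable (A k)).

(** A point at which no change of membership occurs from [n] on belongs to the
    upper limit exactly when it belongs to [A n]. *)
Lemma symdiff_limsup_sub n : symdiff (A n) (limsup_sets A) `<=` \bigcup_j symdiff (A (n + j)%N) (A (n + j).+1).
Proof.
move=> x hx; apply: contrapT => nx.
have same j : A (n + j)%N x <-> A n x.
  elim: j => [|j IH]; first by rewrite addn0.
  rewrite -IH addnS; apply: contrapT => h; apply: nx; exists j => //.
  rewrite /symdiff /=; apply: contrapT => h'; apply: h.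
  by split=> a; apply: contrapT => b; apply: h'; [right|left].
have [] : A n x <-> limsup_sets A x; last first.
  by case: hx => -[]; tauto.
split=> [Anx k _|].
  exists (maxn n k); first by rewrite /= leq_maxr.
  by rewrite -(subnKC (leq_maxl n k)); apply/same.
by move=> /(_ n I) [k /= nk]; rewrite -(subnKC nk) => /same.
Qed.

Lemma measurable_limsup_sets : measurable (limsup_sets A).
Proof.
apply: bigcap_measurable => // k _; exact: bigcup_measurable.
Qed.

Lemma measure_symdiff_limsup n : (forall k, (m (symdiff (A k) (A k.+1)) <= (2 ^- k)%:E)%E) ->
  (m (symdiff (A n) (limsup_sets A)) <= (2 * 2 ^- n)%:E)%E.
Proof.
move=> hA; pose D j := symdiff (A (n + j)%N) (A (n + j).+1).
have mD j : measurable (D j) by exact: measurable_symdiff.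
have := measure_sigma_subadditive m mD
  (measurable_symdiff (mA n) measurable_limsup_sets) (symdiff_limsup_sub (n := n)).
move=> /le_trans; apply; apply: lime_le; first exact: is_cvg_nneseries.
apply: nearW => J /=; rewrite big_mkord.
apply: (@le_trans _ _ (\sum_(j < J) (2 ^- (n + j))%:E)%E); first by apply: lee_sum => j _; exact: hA.
rewrite sumEFin lee_fin.
have -> : \sum_(j < J) 2 ^- (n + j) = 2 * 2 ^- n * (1 - 2 ^- J) :> R.
  elim: J => [|J IH]; first by rewrite big_ord0 expr0 invr1 subrr mulr0.
  rewrite big_ord_recr IH /= exprD exprS; field.
  by rewrite !gt_eqF// exprn_gt0.
by rewrite ler_piMr// ?gerBl ?mulr_ge0 ?invr_ge0 ?exprn_ge0.
Qed.

End measure_limits.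

(** * Borel envelopes *)

Section borel_envelope.
Variables (R : realType) (n : nat).
Local Notation mu := (@leb R n).

(** The intersection of [U] with Borel covers of almost optimal volume. *)
Lemma borel_envelope (U : set 'rV[R]_n) (E : set (lebesgue_rV R n)) :
  open U -> E `<=` U -> measurable E -> (mu E < +oo)%E ->
  exists B : set 'rV[R]_n, [/\ measurable (B : set (borel_rV R n)),
    E `<=` B, B `<=` U & mu (B `\` E) = 0%E].
Proof.
move=> oU EU mE Eoo.
have muf : mu E \is a fin_num by rewrite ge0_fin_numE.
have cov (k : nat) : exists C : set 'rV[R]_n, [/\ measurable (C : set (borel_rV R n)),
    E `<=` C & (mu C <= mu E + (k.+1%:R^-1)%:E)%E].
  have k0 : 0 < k.+1%:R^-1 :> R by rewrite invr_gt0.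
  have [_ [C [mC EC] <-] hC] := lb_ereal_inf_adherent k0 muf.
  exists (\bigcup_j C j); split => //; first exact: bigcup_measurable.
  have bC : measurable (\bigcup_j C j : set (borel_rV R n)) by exact: bigcup_measurable.
  apply: le_trans (ltW hC); rewrite (leb_borel bC).
  have := measure_sigma_subadditive (@vol R n) mC bC (fun=> id).
  exact.
have {cov}[C hC] := choice cov.
have bU := measurable_open oU.
have bB : measurable (U `&` \bigcap_k C k : set (borel_rV R n)).
  by apply: measurableI => //; apply: bigcap_measurable => // k _; have [] := hC k.
have EB : E `<=` U `&` \bigcap_k C k.
  by move=> x Ex; split; [exact: EU|move=> k _; have [_ + _] := hC k; apply].
exists (U `&` \bigcap_k C k); split; [exact: bB|exact: EB|by move=> x []|].
set B := U `&` _ in bB EB *.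
have mB := measurable_borel_leb bB.
have BE : (mu B <= mu E)%E.
  apply/lee_addgt0Pr => e e0.
  have [k ke] : exists k : nat, k.+1%:R^-1 <= e.
    exists (Num.truncn e^-1); rewrite invf_ple ?posrE//.
    by rewrite ltW// truncnS_gt.
  have [bC _ hCk] := hC k; apply: (@le_trans _ _ (mu (C k))).
    apply: le_measure; rewrite ?inE //; last by move=> x [_]; apply.
    exact: measurable_borel_leb.
  by apply: le_trans hCk _; rewrite leeD2l// lee_fin.
have Boo : (mu B < +oo)%E by exact: le_lt_trans BE Eoo.
apply/eqP; rewrite eq_le measure_ge0 andbT.
have := measureDI mu mB mE; rewrite (setIidr EB) => h.
rewrite h in BE.
by rewrite -(leeD2rE _ _ muf) add0e.
Qed.

End borel_envelope.

(** * Compactness from small Gaussian energies *)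

Section smoothing.
Context d (T : measurableType d) (R : realType).
Variables (m : {sigma_finite_measure set T -> \bar R}) (k : T * T -> R).
Hypotheses (mk : measurable_fun setT k) (k0 : forall p, 0 <= k p).

Lemma measurable_section1 x D : measurable_fun D (fun y => k (x, y)).
Proof. by apply: measurable_funTS; exact: (measurableT_comp mk (measurable_pair1 x)). Qed.

Let mkx x D : measurable_fun D (fun y => (k (x, y))%:E).
Proof.
apply: measurable_funTS; apply/measurable_EFinP.
exact: (measurableT_comp mk (measurable_pair1 x)).
Qed.

Lemma ge0_double_integral_swap A B : measurable A -> measurable B ->
  (\int[m]_(x in A) \int[m]_(y in B) (k (x, y))%:E =
   \int[m]_(y in B) \int[m]_(x in A) (k (x, y))%:E)%E.
Proof.
move=> mA mB.
pose f (p : T * T) : \bar R := (\1_A p.1 * (\1_B p.2 * k p))%:E.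
have mf : measurable_fun setT f.
  have iA : measurable_fun setT (@indic T R A) by exact: measurable_indic.
  have iB : measurable_fun setT (@indic T R B) by exact: measurable_indic.
  apply/measurable_EFinP; apply: measurable_funM.
    exact: (measurableT_comp iA measurable_fst).
  by apply: measurable_funM => //; exact: (measurableT_comp iB measurable_snd).
have f0 p : (0 <= f p)%E by rewrite lee_fin !mulr_ge0.
transitivity (\int[m]_x \int[m]_y f (x, y))%E.
  rewrite [LHS]integral_mkcond; apply: eq_integral => x _; rewrite patchE /f /= [\1_A x]indicE.
  case: ifPn => xA; last by rewrite integral0_eq// => y _; rewrite mul0r.
  rewrite integral_mkcond; apply: eq_integral => y _; rewrite patchE indicE mul1r.
  by case: ifPn => yB; rewrite ?mul1r ?mul0r.
rewrite (ge0_integral_swap m mf f0) [RHS]integral_mkcond; apply: eq_integral => y _.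
rewrite patchE /f /= [\1_B y]indicE.
case: ifPn => yB; last by rewrite integral0_eq// => x _; rewrite mul0r mulr0.
rewrite [RHS]integral_mkcond; apply: eq_integral => x _; rewrite patchE indicE mul1r.
by case: ifPn => xA; rewrite ?mul1r ?mul0r.
Qed.

Lemma integral_le_add (D : set T) (f g : T -> R) c V : measurable D -> (m D <= V%:E)%E ->
  measurable_fun D f -> measurable_fun D g ->
  (forall y, 0 <= f y) -> (forall y, 0 <= g y) -> 0 <= c ->
  (forall y, D y -> f y <= g y + c) ->
  (\int[m]_(y in D) (f y)%:E <= \int[m]_(y in D) (g y)%:E + (c * V)%:E)%E.
Proof.
move=> mD DV mf mg f0 g0 c0 fg.
apply: (@le_trans _ _ (\int[m]_(y in D) ((g y)%:E + c%:E))%E).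
  apply: ge0_le_integral => //.
  - by move=> y _; rewrite lee_fin.
  - exact/measurable_EFinP.
  - by apply: emeasurable_funD => //; exact/measurable_EFinP.
rewrite ge0_integralD//; [|by move=> y _; rewrite lee_fin|exact/measurable_EFinP].
by rewrite leeD2l// integral_cst// EFinM lee_wpmul2l ?lee_fin.
Qed.

Lemma mean_lipschitz A x x' c V : measurable A -> (m A <= V%:E)%E -> 0 <= c ->
  (forall y, A y -> k (x, y) <= k (x', y) + c) ->
  (\int[m]_(y in A) (k (x, y))%:E <= \int[m]_(y in A) (k (x', y))%:E + (c * V)%:E)%E.
Proof.
move=> mA AV c0 h; apply: integral_le_add => //; exact: measurable_section1.
Qed.

Hypotheses (ksym : forall x y, k (x, y) = k (y, x)) (k1 : forall x, (\int[m]_y (k (x, y))%:E = 1)%E).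

Lemma mean_split A x : measurable A ->
  (\int[m]_(y in A) (k (x, y))%:E + \int[m]_(y in ~` A) (k (x, y))%:E = 1)%E.
Proof.
move=> mA; rewrite -(k1 x) -[in RHS](setUv A) ge0_integral_setU//.
- exact: measurableC.
- by move=> y _; rewrite lee_fin.
- by apply/disj_setPCl.
Qed.

(** On [A `\` B], the average of [A] falls short of [1] by the interaction
    with the complement of [A], and the average of [B] is itself an
    interaction of [B] with its complement. *)
Lemma measure_diff_le (A B U : set T) c V : measurable A -> measurable B -> A `<=` U -> 0 <= c ->
  measurable U -> (m U <= V%:E)%E ->
  (forall x, U x -> \int[m]_(y in A) (k (x, y))%:E <= \int[m]_(y in B) (k (x, y))%:E + c%:E)%E ->
  (m (A `\` B) <= \int[m]_(x in A) \int[m]_(y in ~` A) (k (x, y))%:E +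
    \int[m]_(x in B) \int[m]_(y in ~` B) (k (x, y))%:E + (c * V)%:E)%E.
Proof.
move=> mA mB AU c0 mU UV AB.
have mD : measurable (A `\` B) by exact: measurableD.
have mAc := measurableC mA; have mBc := measurableC mB.
have i0 D x : (0 <= \int[m]_(y in D) (k (x, y))%:E)%E.
  by apply: integral_ge0 => y _; rewrite lee_fin.
have ms D E : measurable D -> measurable_fun E (fun x => \int[m]_(y in D) (k (x, y))%:E)%E.
  by move=> mD'; apply: measurable_funTS; exact: measurable_slice.
rewrite -[leLHS]mul1e -(integral_cst m mD).
apply: (@le_trans _ _ (\int[m]_(x in A `\` B) (\int[m]_(y in ~` A) (k (x, y))%:E +
   (\int[m]_(y in B) (k (x, y))%:E + c%:E)))%E).
  apply: ge0_le_integral => //.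
  - by apply: emeasurable_funD; [exact: ms|apply: emeasurable_funD; [exact: ms|exact: measurable_cst]].
  - move=> x [Ax _]; rewrite /= -(mean_split x mA) addeC leeD2l//.
    by apply: AB; exact: AU.
rewrite ge0_integralD//; [|exact: ms|by move=> x _; rewrite adde_ge0|
  by apply: emeasurable_funD; [exact: ms|exact: measurable_cst]].
rewrite -addeA; apply: leeD.
  by apply: ge0_subset_integral => //; exact: ms.
rewrite ge0_integralD//; last exact: ms.
apply: leeD.
  rewrite [leRHS](_ : _ = \int[m]_(x in ~` B) \int[m]_(y in B) (k (x, y))%:E)%E.
    by apply: ge0_subset_integral => //; exact: ms.
  rewrite ge0_double_integral_swap//; apply: eq_integral => x _; apply: eq_integral => y _.
  by rewrite ksym.
rewrite integral_cst// EFinM lee_wpmul2l ?lee_fin//; apply: le_trans UV.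
apply: le_measure; rewrite ?inE//; exact: subset_trans (@subDsetl _ _ _) AU.
Qed.

End smoothing.

Section compactness.
Variables (R : realType) (n : nat).
Local Notation mu := (@leb R n).

Lemma expR_lipschitz (a b : R) : 0 <= a -> 0 <= b -> expR (- a) <= expR (- b) + `|a - b|.
Proof.
move=> a0 b0; have [ab|/ltW ba] := leP b a.
  by apply: ler_wpDr => //; rewrite ler_expR lerN2.
rewrite -lerBlDl ler0_norm ?subr_le0// opprB.
have -> : expR (- a) - expR (- b) = expR (- a) * (1 - expR (- (b - a))).
  by rewrite mulrBr mulr1 -expRD; congr (_ - expR _); ring.
have h : 1 - expR (- (b - a)) <= b - a by have := expR_ge1Dx (- (b - a)); lra.
apply: le_trans h; rewrite ler_piMl// ?expR_le1 ?oppr_le0//.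
by rewrite subr_ge0 expR_le1 oppr_le0 subr_ge0.
Qed.

Lemma normr_entry_le (x : 'rV[R]_n) i : `|x 0 i| <= `|x|.
Proof.
have /mapP[j Hj ->] : `|x 0 i| \in [seq `|x y.1 y.2| | y : 'I_1 * 'I_n].
  by apply/mapP; exists (0, i) => //=; rewrite mem_enum.
by rewrite [leRHS]/Num.Def.normr /= mx_normrE; apply/bigmax_geP; right => /=; exists j.
Qed.

Lemma sqnorm_lipschitz (x x' y : 'rV[R]_n) N : `|x| <= N -> `|x'| <= N -> `|y| <= N ->
  `|sqnorm (x - y) - sqnorm (x' - y)| <= n%:R * (4 * N) * `|x - x'|.
Proof.
move=> xN x'N yN; rewrite /sqnorm /dotrV -sumrB.
apply: le_trans (ler_norm_sum _ _ _) _.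
apply: (@le_trans _ _ (\sum_(i < n) (4 * N) * `|x - x'|)); last first.
  by rewrite sumr_const card_ord -[leRHS]mulrA [leRHS]mulr_natl.
apply: ler_sum => i _; rewrite !mxE.
have -> : (x 0 i - y 0 i) * (x 0 i - y 0 i) - (x' 0 i - y 0 i) * (x' 0 i - y 0 i) =
    (x 0 i + x' 0 i - y 0 i - y 0 i) * (x 0 i - x' 0 i) by ring.
have hx := le_trans (normr_entry_le x i) xN.
have hx' := le_trans (normr_entry_le x' i) x'N.
have hy := le_trans (normr_entry_le y i) yN.
rewrite normrM ler_pM//; last by have := normr_entry_le (x - x') i; rewrite !mxE.
apply: le_trans (ler_normB _ _) _.
have := ler_normB (x 0 i + x' 0 i) (y 0 i); have := ler_normD (x 0 i) (x' 0 i).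
lra.
Qed.

(** The exponential is Lipschitz on negative arguments, and the square of the
    norm is Lipschitz on bounded sets. *)
Lemma gauss_kernel_lipschitz u N : 0 < u -> exists2 L, 0 <= L & forall x x' y : 'rV[R]_n,
  `|x| <= N -> `|x'| <= N -> `|y| <= N ->
  gauss_kernel u (x - y) <= gauss_kernel u (x' - y) + L * `|x - x'|.
Proof.
move=> u0; set c := Num.sqrt (4 * pi * u) ^- n.
have c0 : 0 <= c by rewrite invr_ge0 exprn_ge0 ?sqrtr_ge0.
have u40 : 0 < 4 * u by rewrite mulr_gt0.
exists (c * (n%:R * (4 * `|N|) / (4 * u))).
  by rewrite mulr_ge0// divr_ge0 ?(ltW u40)// mulr_ge0// mulr_ge0.
move=> x x' y xN x'N yN; rewrite /gauss_kernel -/c.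
rewrite -[c * _ * `|x - x'|]mulrA -mulrDr ler_wpM2l//.
have NN : N = `|N| by rewrite ger0_norm// (le_trans _ xN).
have q0 (z : 'rV[R]_n) : 0 <= sqnorm z / (4 * u) by rewrite divr_ge0 ?sqnorm_ge0// ltW.
apply: (le_trans (expR_lipschitz (q0 (x - y)) (q0 (x' - y)))); rewrite lerD2l -mulrBl normrM.
rewrite [`|(4 * u)^-1|]ger0_norm ?invr_ge0 ?(ltW u40)//.
rewrite mulrAC ler_wpM2r ?invr_ge0 ?(ltW u40)// -NN.
exact: sqnorm_lipschitz.
Qed.

Lemma finite_net N r : 0 < r -> exists s : seq 'rV[R]_n,
  forall x, `|x| <= N -> exists a, [/\ a \in s, `|a| <= N & `|x - a| < r].
Proof.
move=> r0; pose K := [set x : 'rV[R]_n | `|x| <= N].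
have cK : compact K.
  apply: bounded_closed_compact.
    by exists N; split; [exact: num_real|move=> M NM x /= xN; exact: le_trans xN (ltW NM)].
  rewrite (_ : K = (fun x => `|x|) @^-1` [set y | y <= N])//.
  by apply: (closed_comp _ (@closed_le R N)) => x _; exact: norm_continuous.
rewrite compact_cover in cK.
have [|x Kx|D' D'K cov] := cK _ K (fun a => ball a r).
- by move=> a _; exact: ball_open.
- by exists x => //; exact: ballxx.
exists (finmap.enum_fset D') => x xN; have [a /= aD xa] := cov x xN.
exists a; split.
- exact: aD.
- by have := D'K _ aD; rewrite inE.
- by move: xa; rewrite -ball_normE /ball_ /= distrC.
Qed.

Let three_steps (a b c d e : R) : a <= b + e -> b - c <= e -> c <= d + e -> a <= d + 3 * e.
Proof. lra. Qed.

Let half_of_tenths (x e : R) : x <= e / 10 -> e / 10 + e / 10 + 3 * x <= e / 2.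
Proof. lra. Qed.

(** Gaussian averages are equi-Lipschitz, so along the ultrafilter they agree
    up to a small error once they do so on a finite net. *)
Lemma energy_compactness (U : set 'rV[R]_n) (E : nat -> set 'rV[R]_n) (F : set_system nat) :
  UltraFilter F -> measurable (U : set (borel_rV R n)) -> bounded_set U ->
  (mu U < +oo)%E -> (forall i, measurable (E i : set (borel_rV R n))) -> (forall i, E i `<=` U) ->
  (forall e, 0 < e -> exists2 u, 0 < u & F [set i | (gauss_energy u (E i) <= e%:E)%E]) ->
  forall e : R, 0 < e -> exists2 P, F P &
    forall i j, P i -> P j -> (mu (symdiff (E i) (E j)) <= e%:E)%E.
Proof.
move=> UF bU Ubd Uoo bE EU hE e e0; have FF : ProperFilter F by case: UF.
have mU := measurable_borel_leb bU; have mE i := measurable_borel_leb (bE i).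
have [N UN] : exists N : R, forall x, U x -> `|x| <= N.
  by have [M [_ hM]] := Ubd; exists (M + 1); apply: hM; rewrite ltrDl.
set V := fine (mu U); have UV : (mu U <= V%:E)%E by rewrite fineK// ge0_fin_numE.
have V0 : 0 <= V by exact: fine_ge0.
(* Two energies and three oscillations, each at most [e / 10], add up to [e /
   2]. *)
pose e' := e / 10; have e'0 : 0 < e' by rewrite divr_gt0.
have [u u0 Fu] := hE e' e'0.
pose eta := e' / (V + 1); have V10 : 0 < V + 1 by rewrite ltr_wpDl.
have eta0 : 0 < eta by rewrite divr_gt0.
have [L L0 hL] := gauss_kernel_lipschitz N u0.
pose r := eta / (L * V + 1).
have LV0 : 0 <= L * V by rewrite mulr_ge0.
have LV10 : 0 < L * V + 1 by rewrite ltr_wpDl.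
have r0 : 0 < r by rewrite divr_gt0.
have [s net] := finite_net N r0.
pose k (p : lebesgue_rV R n * lebesgue_rV R n) := gauss_kernel u ((p.1 : 'rV[R]_n) - p.2).
have mk : measurable_fun setT k by exact: measurable_kernel_diff (measurable_gauss_kernel u).
have k0 p : 0 <= k p by exact: gauss_kernel_ge0.
have ksym (x y : 'rV[R]_n) : k (x, y) = k (y, x) by rewrite /k /= -gauss_kernelN opprB.
have k1 (x : 'rV[R]_n) : (\int[mu]_y (k (x, y))%:E = 1)%E.
  rewrite /k /= kernel_mass_shift ?gauss_kernel_mass//.
  - exact: measurable_gauss_kernel.
  - by move=> z; exact: gauss_kernel_ge0.
  - exact: gauss_kernelN.
pose A i (x : 'rV[R]_n) := (\int[mu]_(y in E i) (k (x, y))%:E)%E.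
pose g i x := fine (A i x).
have A0 i x : (0 <= A i x)%E by apply: integral_ge0 => y _; rewrite lee_fin.
have A1 i x : (A i x <= 1)%E.
  by rewrite -(mean_split mk k0 k1 x (mE i)) leeDl// integral_ge0// => y _; rewrite lee_fin.
have AE i x : A i x = (g i x)%:E.
  by rewrite fineK// ge0_fin_numE// (le_lt_trans (A1 i x))// ltry.
have g01 i x : 0 <= g i x <= 1 by rewrite -!lee_fin -AE A0 A1.
have glip i x x' : `|x| <= N -> `|x'| <= N -> `|x - x'| <= r -> g i x <= g i x' + eta.
  move=> xN x'N xx'.
  have EiV : (mu (E i) <= V%:E)%E by apply: le_trans UV; apply: le_measure; rewrite ?inE.
  have Lr0 : 0 <= L * r by rewrite mulr_ge0// ltW.
  have hk (y : 'rV[R]_n) : E i y -> k (x, y) <= k (x', y) + L * r.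
    move=> Ey; apply: le_trans (hL x x' y xN x'N (UN _ (EU i _ Ey))) _.
    by rewrite lerD2l ler_wpM2l.
  have := mean_lipschitz mk k0 (mE i) EiV Lr0 hk.
  rewrite -/(A i x) -/(A i x') (AE i x) (AE i x') -EFinD lee_fin => /le_trans; apply.
  rewrite lerD2l mulrAC /r mulrCA ler_piMr ?(ltW eta0)//.
  by rewrite ler_pdivrMr// mul1r lerDl.
have [P FP hP] := ultra_oscillation UF s g01 eta0.
exists (P `&` [set i | (gauss_energy u (E i) <= e'%:E)%E]); first exact: filterI.
have half i j : P i -> P j -> (gauss_energy u (E i) <= e'%:E)%E ->
    (gauss_energy u (E j) <= e'%:E)%E -> (mu (E i `\` E j) <= (e / 2)%:E)%E.
  move=> Pi Pj ei ej.
  have c0 : 0 <= 3 * eta by rewrite mulr_ge0// ltW.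
  apply: le_trans (measure_diff_le mk k0 ksym k1 (mE i) (mE j) (EU i) c0 mU UV _) _.
    move=> x Ux; rewrite -/(A i x) -/(A j x) !AE -EFinD lee_fin.
    have xN := UN _ Ux; have [a [as_ aN xa]] := net x xN.
    have h1 := glip i x a xN aN (ltW xa).
    have h2 := hP i j a Pi Pj as_; rewrite ler_norml in h2; case/andP: h2 => _ h2.
    have h3 : g j a <= g j x + eta by apply: glip => //; rewrite distrC ltW.
    exact: three_steps h1 h2 h3.
  apply: (@le_trans _ _ (e'%:E + e'%:E + (3 * eta * V)%:E)%E); first by rewrite leeD2r// leeD.
  rewrite -!EFinD lee_fin -mulrA; apply: half_of_tenths.
  by rewrite /eta mulrAC ler_pdivrMr// ler_wpM2l ?(ltW e'0)// lerDl.
move=> i j [Pi ei] [Pj ej].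
apply: le_trans (measureU2 _ (measurableD (mE i) (mE j)) (measurableD (mE j) (mE i))) _.
by rewrite (splitr e) EFinD leeD// half.
Qed.

End compactness.

(** * The perimeter through difference quotients *)

Section difference_quotient.
Variables (R : realType) (V : normedModType R).
Implicit Types (f : V -> R) (x v : V).

Lemma is_derive_line f x v (t : R) : (forall y, derivable f y v) ->
  is_derive t 1 (fun s : R => f (x + s *: v)) ('D_v f (x + t *: v)).
Proof.
move=> df; have eq_quot : (fun h : R => h^-1 *: (((fun s : R => f (x + s *: v)) \o shift t) (h *: 1) - f (x + t *: v))) =
    (fun h : R => h^-1 *: ((f \o shift (x + t *: v)) (h *: v) - f (x + t *: v))).
  apply/funext => h /=; congr (_ *: (f _ - _)).
  by rewrite [h *: 1]mulr1 scalerDl addrCA.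
apply: DeriveDef; last by rewrite /derive eq_quot.
by rewrite /derivable eq_quot; exact: df.
Qed.

(** The bound on difference quotients that makes the convergence to the
    derivative dominated. *)
Lemma MVT_line f x v (e : R) : (forall y, derivable f y v) -> 0 < e ->
  exists c, f (x + e *: v) - f x = 'D_v f (x + c *: v) * e.
Proof.
move=> df e0.
have D t := @is_derive_line f x v t df.
have [|c _] := @MVT R (fun s : R => f (x + s *: v)) (fun t => 'D_v f (x + t *: v)) 0 e e0 (fun t _ => D t).
  by apply: derivable_within_continuous => t _; have [] := D t.
by rewrite scale0r addr0 subr0 => h; exists c.
Qed.

Lemma difference_quotient_cvg f x v : derivable f x v ->
  k.+1%:R * (f (x + k.+1%:R^-1 *: v) - f x) @[k --> \oo] --> 'D_v f x.
Proof.
move=> df.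
have h0 : (k.+1%:R^-1 : R) @[k --> \oo] --> (0 : R)^'.
  move=> A nA; have [N _ hN] := @cvg_harmonic R _ nA.
  by exists N => // k Nk; apply: hN => //=; rewrite invr_neq0.
have := cvg_comp _ _ h0 df.
apply: cvg_trans; apply: near_eq_cvg; apply: nearW => k /=.
by rewrite invrK [_ *: v + x]addrC.
Qed.

End difference_quotient.

Section perimeter.
Variables (R : realType) (n : nat).
Local Notation mu := (@leb R n).
Implicit Types (f g : 'rV[R]_n -> R) (h v x : 'rV[R]_n) (F : set (lebesgue_rV R n)).

(** Shifting the integrand instead of the set, the integral over [F] becomes
    one over a translate of [F], whose part outside of [F] has measure [moved
    F h]. *)
Lemma integral_translate_le F g h : measurable F -> (mu F < +oo)%E ->
  measurable_fun [set: borel_rV R n] g -> (forall x, 0 <= g x <= 2) ->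
  (\int[mu]_(x in F) (g ((x : 'rV[R]_n) + h))%:E <=
   \int[mu]_(x in F) (g x)%:E + 2%:E * moved F h)%E.
Proof.
move=> mF Foo mg g02.
have mgl := measurable_fun_borel_leb mg.
have g0 x : (0 <= (g x)%:E)%E by rewrite lee_fin; have /andP[] := g02 x.
set T := translate (- h) F.
have mT : measurable T by exact: measurable_translate.
have mTF : measurable (T `\` F) by exact: measurableD.
have mG : measurable_fun [set: lebesgue_rV R n] (fun x => (g x * \1_T x)%:E).
  apply/measurable_EFinP; apply: measurable_funM mgl _; exact: measurable_indic.
have G0 x : (0 <= (g x * \1_T x)%:E)%E by rewrite lee_fin mulr_ge0//; have /andP[] := g02 x.
have mgE : measurable_fun [set: lebesgue_rV R n] (fun x => (g x)%:E) by exact/measurable_EFinP.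
have -> : (\int[mu]_(x in F) (g ((x : 'rV[R]_n) + h))%:E = \int[mu]_(x in T) (g x)%:E)%E.
  transitivity (\int[mu]_x (g x * \1_T x)%:E)%E.
    rewrite -(ge0_integral_leb_shift h mG G0) integral_mkcond; apply: eq_integral => x _.
    rewrite patchE indicE /T.
    have -> : ((x : 'rV[R]_n) + h \in translate (- h) F) = (x \in F).
      by apply/idP/idP; rewrite !inE /translate /= addrK.
    by case: ifP => _; rewrite ?mulr1 ?mulr0.
  rewrite [RHS]integral_mkcond; apply: eq_integral => x _; rewrite patchE indicE.
  by case: ifP => _; rewrite ?mulr1 ?mulr0.
have mv : mu (T `\` F) = moved F h.
  rewrite /moved -(leb_translate h (T `\` F)); congr (mu _).
  change (translate h T `\` translate h F = F `\` translate h F).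
  by rewrite /T translateD subrr translate0.
apply: (@le_trans _ _ (\int[mu]_(x in F `|` (T `\` F)) (g x)%:E)%E).
  apply: ge0_subset_integral.
  - exact: mT.
  - exact: measurableU.
  - exact: measurable_funTS.
  - by move=> x _.
  - by move=> x Tx; have [Fx|nF] := pselect (F x); [left|right].
rewrite ge0_integral_setU; last 5 first.
- exact: mF.
- exact: mTF.
- exact: measurable_funTS.
- by move=> x _.
- by apply/disj_setPS => x [? []].
rewrite leeD2l// -mv -(integral_cst mu mTF).
apply: ge0_le_integral.
- exact: mTF.
- by move=> x _.
- exact: measurable_funTS.
- exact: measurable_cst.
- by move=> x _; rewrite /= lee_fin; have /andP[] := g02 x.
Qed.

(** The derivative is a dominated limit of difference quotients; [f + 1] in
    place of [f] makes the integrands nonnegative and at most [2]. *)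
Lemma integral_derivative_le F f v (B C : R) : measurable F -> (mu F < +oo)%E ->
  continuous f -> (forall x, derivable f x v) -> (forall x, `|'D_v f x| <= B) ->
  (forall x, `|f x| <= 1) -> 0 <= C ->
  (forall e : R, 0 < e <= 1 -> (moved F (e *: v) <= (C * e)%:E)%E) ->
  mu.-integrable setT (EFin \o (fun x => 'D_v f x * \1_F x)) /\
  \int[mu]_x ('D_v f x * \1_F x) <= 2 * C.
Proof.
move=> mF Foo cf df DB f1 C0 mvF.
have mf := borel_continuous cf.
pose e k : R := k.+1%:R^-1.
have e0 k : 0 < e k by rewrite invr_gt0.
have e1 k : e k <= 1 by rewrite invf_le1// ler1n.
pose g x := f x + 1.
have mg : measurable_fun [set: borel_rV R n] g by exact: measurable_funD mf (measurable_cst _).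
have g02 x : 0 <= g x <= 2.
  by have := f1 x; rewrite ler_norml /g => /andP[a b]; apply/andP; split; lra.
have mgs k : measurable_fun [set: borel_rV R n] (fun x => g (x + e k *: v)).
  by have := measurableT_comp mg (borel_shift (e k *: v)).
have iF := integrable_ind mF Foo.
have mind := measurable_ind mF.
have iB b : mu.-integrable setT (EFin \o (fun x => b * \1_F x)) by exact: integrable_scale.
have ig (w : 'rV[R]_n -> R) : measurable_fun [set: borel_rV R n] w -> (forall x, 0 <= w x <= 2) ->
    mu.-integrable setT (EFin \o (fun x => w x * \1_F x)).
  move=> mw w02; apply: (integrable_ge0_dominated _ (iB 2)).
    exact: measurable_funM (measurable_fun_borel_leb mw) mind.
  move=> x; have /andP[a b] := w02 x.
  by rewrite normrM !ger0_norm// ler_wpM2r.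
pose q k x := k.+1%:R * (f (x + e k *: v) - f x) * \1_F x.
have qE k x : q k x = k.+1%:R * (1 * (g (x + e k *: v) * \1_F x) + -1 * (g x * \1_F x)).
  by rewrite /q /g; ring.
have i1 k := ig _ (mgs k) (fun x => g02 _).
have i2 := ig _ mg g02.
have mq k : measurable_fun [set: lebesgue_rV R n] (q k).
  apply: measurable_funM mind; apply: measurable_funM (measurable_cst _) _.
  apply: measurable_funB; last exact: measurable_fun_borel_leb.
  by apply: measurable_fun_borel_leb; have := measurableT_comp mf (borel_shift (e k *: v)).
have qB k x : `|q k x| <= B * \1_F x.
  rewrite /q normrM [`|\1_F x|]ger0_norm// ler_wpM2r//.
  have [c ->] := MVT_line x df (e0 k).
  by rewrite mulrCA /e mulfV// mulr1.
have qc x : q k x @[k --> \oo] --> 'D_v f x * \1_F x.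
  by apply: cvgMl; exact: difference_quotient_cvg.
have [_ iD cI] := dominated_convergence_real mq qc (iB B) qB.
split=> //.
have qle k : \int[mu]_x q k x <= 2 * C.
  rewrite (Rintegral_combination (i1 k) i2 (qE k)) mul1r mulN1r.
  rewrite -ler_pdivlMl// lerBlDl.
  have toF (w : 'rV[R]_n -> R) : (forall x, 0 <= w x <= 2) -> measurable_fun [set: borel_rV R n] w ->
      (\int[mu]_(x in F) (w x)%:E = (\int[mu]_x (w x * \1_F x))%:E)%E.
    move=> w02 mw; rewrite -(fineK_Rintegral measurableT (ig w mw w02)) [LHS]integral_mkcond.
    apply: eq_integral => x _; rewrite patchE indicE.
    by case: ifP => _; rewrite ?mulr1 ?mulr0.
  rewrite -lee_fin EFinD -(toF _ (fun x => g02 _) (mgs k)) -(toF _ g02 mg).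
  apply: le_trans (integral_translate_le (e k *: v) mF Foo mg g02) _.
  rewrite leeD2l//; apply: (@le_trans _ _ (2%:E * (C * e k)%:E)%E).
    by rewrite lee_wpmul2l// mvF// e0 e1.
  by rewrite -EFinM lee_fin /e; have := mulrC C (k.+1%:R^-1) => ->; rewrite mulrCA.
have c : \int[mu]_x q k x @[k --> \oo] --> \int[mu]_x ('D_v f x * \1_F x).
  by apply: fine_cvg; move: cI; rewrite (fineK_Rintegral measurableT iD).
rewrite -(cvg_lim _ c)//; apply: limr_le; last exact: nearW.
by apply/cvg_ex; eexists; exact: c.
Qed.

Lemma coord_le_enorm x j : `|x 0 j| <= enorm x.
Proof.
rewrite /enorm -sqrtr_sqr ler_wsqrtr// /dotrV (bigD1 j)//= expr2 lerDl.
by apply: sumr_ge0 => i _; rewrite -expr2 sqr_ge0.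
Qed.

Section test_field.
Variable phi : 'rV[R]_n -> 'rV[R]_n.
Hypothesis phiC : C1c phi.

Let f (j : 'I_n) : 'rV[R]_n -> R := fun x => phi x 0 j.
Let v (j : 'I_n) : 'rV[R]_n := delta_mx 0 j.

Let dphi x : differentiable phi x. Proof. by case: phiC. Qed.

Lemma coord_continuous_C1c j : continuous (f j).
Proof.
move=> x; exact: (continuous_comp (differentiable_continuous (dphi x))
  (@coord_continuous R 1 n 0 j (phi x))).
Qed.

Lemma coord_derivable_C1c j x : derivable (f j) x (v j).
Proof. by have /derivable_mxP := diff_derivable (dphi x) (v := v j); apply. Qed.

Lemma coord_deriveE j x : 'D_(v j) (f j) x = 'J phi x j j.
Proof.
have := derive_mx (diff_derivable (dphi x) (v := v j)).
rewrite (deriveEjacobian _ (dphi x)) => /matrixP /(_ 0 j).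
by rewrite /v -rowE => h; rewrite mxE [RHS]mxE in h; rewrite h.
Qed.

(** The derivative is continuous on the compact support of the field and
    vanishes outside of it. *)
Lemma coord_derive_bounded j : exists2 B, 0 <= B & forall x, `|'D_(v j) (f j) x| <= B.
Proof.
have [_ cJ cK] := phiC; set K := closure _ in cK.
have cD : continuous (fun x => 'J phi x j j).
  by move=> x; exact: (continuous_comp (cJ x) (@coord_continuous R n n j j ('J phi x))).
have [M [_ hM]] : bounded_set ((fun x => 'J phi x j j) @` K).
  by apply: compact_bounded; apply: continuous_compact => //; exact: continuous_subspaceT.
exists (`|M| + 1); first by rewrite addr_ge0.
move=> x; rewrite coord_deriveE; have [Kx|nK] := pselect (K x).
  apply: hM; last by exists x.
  by rewrite (le_lt_trans (ler_norm M))// ltrDl.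
rewrite -coord_deriveE (_ : 'D_(v j) (f j) x = 0) ?normr0 ?addr_ge0//.
have oKc : open (~` K) by rewrite openC; exact: closed_closure.
have near0 : \forall y \near x, f j y = cst 0 y.
  have : nbhs x (~` K) by exact: open_nbhs_nbhs.
  apply: filterS => y nKy; rewrite /f; have [->|py] := eqVneq (phi y) 0; first by rewrite mxE.
  by case: nKy; exact: subset_closure.
by rewrite (near_eq_derive _ near0) ?derive_cst//.
Qed.

End test_field.

(** Each of the [n] terms of the divergence contributes at most [2 * C]. *)
Lemma perimeter_lty F C : measurable F -> (mu F < +oo)%E -> 0 <= C ->
  (forall (j : 'I_n) (e : R), 0 < e <= 1 -> (moved F (e *: delta_mx 0 j)%R <= (C * e)%:E)%E) ->
  (perimeter F < +oo)%E.
Proof.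
move=> mF Foo C0 mvF; apply: (@le_lt_trans _ _ (n%:R * (2 * C))%:E); last exact: ltry.
apply: ge_ereal_sup => _ [phi [phiC phi1] <-].
have hj (j : 'I_n) := coord_derive_bounded phiC j.
have D (j : 'I_n) : mu.-integrable setT
      (EFin \o (fun x => 'D_(delta_mx 0 j) (fun y => phi y 0 j) x * \1_F x)) /\
    \int[mu]_x ('D_(delta_mx 0 j) (fun y => phi y 0 j) x * \1_F x) <= 2 * C.
  have [B B0 hB] := hj j.
  apply: (integral_derivative_le mF Foo _ _ hB _ C0 (mvF j)).
  - exact: coord_continuous_C1c.
  - by move=> x; exact: coord_derivable_C1c.
  - by move=> x; exact: le_trans (coord_le_enorm _ _) (phi1 x).
have -> : (\int[mu]_(x in F) (divergence phi x)%:E =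
    \int[mu]_x \sum_(j < n) ('D_(delta_mx 0 j) (fun y => phi y 0 j) x * \1_F x)%:E)%E.
  rewrite integral_mkcond; apply: eq_integral => x _.
  rewrite patchE sumEFin -mulr_suml indicE.
  by case: ifP => _; rewrite ?mulr1 ?mulr0.
rewrite integral_sum//; last by move=> j; case: (D j).
under eq_bigr => j _ do rewrite (fineK_Rintegral measurableT (D j).1).
rewrite sumEFin lee_fin; apply: (@le_trans _ _ (\sum_(j < n) 2 * C)).
  by apply: ler_sum => j _; case: (D j).
by rewrite sumr_const card_ord [leRHS]mulr_natl.
Qed.

End perimeter.

(** * Dyadic scales *)

Section scales.
Variable R : realType.
Implicit Types (a b c e q s t x M : R).

Lemma exists_natpow_gt x : exists J : nat, x < 2 ^+ J.
Proof.
exists (Num.truncn x).+1; apply: (lt_le_trans (truncnS_gt x)).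
by rewrite -natrX ler_nat ltnW// ltn_expl.
Qed.

Lemma geometric_small q e : 0 < e -> exists K : nat, forall k, (K <= k)%N -> q * 2 ^- k <= e.
Proof.
move=> e0; have [K qK] := exists_natpow_gt (q / e); exists K => k Kk.
rewrite ler_pdivrMr ?exprn_gt0// mulrC -ler_pdivrMr//.
by apply: le_trans (ltW qK) _; rewrite ler_eXn2l// ltr1n.
Qed.

Lemma le_of_geometric a b q (K : nat) :
  (forall k, (K <= k)%N -> a <= b + q * 2 ^- k) -> a <= b.
Proof.
move=> h; apply/ler_addgt0Pr => e e0; have [K' hK'] := geometric_small q e0.
apply: le_trans (h (maxn K K') (leq_maxl _ _)) _.
by rewrite lerD2l hK'// leq_maxr.
Qed.

Lemma exists_exprn_ge p x : 1 < p -> exists j : nat, x <= p ^+ j.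
Proof.
move=> p1; have d0 : 0 < p - 1 by rewrite subr_gt0.
have bern j : j%:R * (p - 1) <= p ^+ j.
  elim: j => [|j IH]; first by rewrite mul0r expr0.
  rewrite -natr1 mulrDl mul1r exprS; have : 1 <= p ^+ j by rewrite exprn_ege1// ltW.
  by rewrite -(ler_pM2l d0) mulr1 => h; rewrite (_ : p * p ^+ j = p ^+ j + (p - 1) * p ^+ j) ?lerD//; ring.
exists (Num.truncn (x / (p - 1))).+1; apply: le_trans (bern _).
by rewrite -ler_pdivrMr// ltW// truncnS_gt.
Qed.

(** The finest dyadic scale at which the heat energy at time [t] controls the
    Gaussian energies. *)
Lemma critical_scale p t : 2 <= p -> 0 < t < 1 -> exists J : nat, t * p ^+ J <= 1 < t * p ^+ J.+1.
Proof.
move=> p2 /andP[t0 t1].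
have ex : exists J : nat, 1 < t * p ^+ J.
  have [J hJ] := exists_natpow_gt t^-1; exists J.
  rewrite -ltr_pdivrMl// mulr1; apply: lt_le_trans hJ _.
  by apply: lerXn2r; rewrite ?nnegrE// (le_trans _ p2).
have := ex_minnP ex; case=> -[|J]; first by rewrite expr0 mulr1 ltNge (ltW t1).
move=> h mink; exists J; rewrite h andbT leNgt; apply/negP => /mink.
by rewrite ltnn.
Qed.

(** Each scale finer than [2 ^- k0] contributes at least [X]. At [s = 2^-1]
    there are about [`|ln t|] of them, all with the same weight; for larger
    [s] the finest scale alone suffices. *)
Lemma coarse_scale_bound s c M (k0 : nat) : 2^-1 <= s < 1 -> 0 < c -> 0 <= M ->
  exists2 tau, 0 < tau & forall t (e_ : nat -> R) X, 0 < t < 1 -> t <= tau ->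
    (forall j, 0 <= e_ j) -> 0 <= X ->
    (forall J, t * (4 `^ s) ^+ J <= 1 ->
      c * t * \sum_(j < J.+1) (4 `^ s) ^+ j * e_ j <= M * scaling s t) ->
    (forall j, (k0 <= j)%N -> X <= 2 ^+ j * e_ j) ->
  X <= 2 * 4 `^ s * M / c.
Proof.
move=> /andP[s12 s1] c0 M0; set p := 4 `^ s.
have s0 : 0 < s by apply: lt_le_trans s12; rewrite invr_gt0.
have s4 : 4 `^ 2^-1 = 2 :> R.
  by rewrite powR12_sqrt// (_ : 4 = 2 ^+ 2) ?sqrtr_sqr ?ger0_norm//; ring.
have p2 : 2 <= p by rewrite -s4 ler_powR// ler1n.
have p0 : 0 < p by apply: lt_le_trans p2.
exists (p ^- (2 * k0).+1); first by rewrite invr_gt0 exprn_gt0.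
move=> t e_ X t01 ttau e0 X0 hJ hX.
have /andP[t0 t1] := t01.
have [J /andP[tJ tJ1]] := critical_scale p2 t01.
have kJ : (2 * k0 <= J)%N.
  rewrite leqNgt; apply/negP => Jk; move: tJ1; apply/negP; rewrite -leNgt.
  rewrite -ler_pdivlMr ?exprn_gt0// mul1r; apply: le_trans ttau _.
  rewrite lef_pV2 ?posrE ?exprn_gt0// ler_weXn2l//; last by rewrite ltnW.
  by rewrite (le_trans _ p2)// ler1n.
have k0J : (k0 <= J)%N by apply: leq_trans kJ; rewrite leq_pmull.
have F0 j : 0 <= p ^+ j * e_ j by rewrite mulr_ge0// exprn_ge0// ltW.
have := hJ J tJ; rewrite /scaling ltNge s12 /=; case: eqP => [sE|sNE] hS.
  have pE : p = 2 by rewrite /p sE.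
  have sumX : ((J.+1 - k0)%:R * X <= \sum_(j < J.+1) p ^+ j * e_ j).
    rewrite -(big_mkord predT (fun j => p ^+ j * e_ j)) (@big_cat_nat _ _ _ k0)//=; last exact: leqW.
    apply: ler_wpDl; first by apply: sumr_ge0 => j _.
    rewrite mulr_natl -sumr_const_nat !big_nat; apply: ler_sum => j /andP[kj _].
    by rewrite pE hX.
  have lnt : `|ln t| <= J.+1%:R.
    rewrite ler0_norm ?ln_le0 ?(ltW t1)// -subr_ge0 opprK.
    have l2 : ln 2 <= 1 :> R.
      by rewrite -[leRHS]expRK ler_ln ?posrE ?expR_gt0//; have := expR_ge1Dx (1 : R); lra.
    have : 0 <= ln (t * p ^+ J.+1) by rewrite ln_ge0// ltW.
    rewrite lnM ?posrE ?exprn_gt0// pE lnXn// => h; apply: le_trans h _.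
    by rewrite addrC lerD2r -[leRHS]mulr1 mulr_natl lerMn2r l2.
  have half : J.+1%:R <= 2 * (J.+1 - k0)%:R :> R.
    rewrite -natrM ler_nat mulnBr leq_subRL; last by rewrite leq_mul2l leqW.
    by rewrite [(2 * J.+1)%N]mul2n -addnn leq_add2r leqW.
  have h1 : c * t * ((J.+1 - k0)%:R * X) <= M * (t * J.+1%:R).
    apply: le_trans (ler_wpM2l _ sumX) _; first by rewrite mulr_ge0// ltW.
    by apply: le_trans hS _; rewrite ler_wpM2l// ler_wpM2l// ltW.
  have Jp : 0 < J.+1%:R :> R by rewrite ltr0n.
  rewrite ler_pdivlMr// -(ler_pM2l (mulr_gt0 t0 Jp)).
  apply: (@le_trans _ _ (2 * (c * t * ((J.+1 - k0)%:R * X)))).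
    rewrite (_ : t * _ * (X * c) = t * c * X * J.+1%:R); last by ring.
    rewrite (_ : 2 * _ = t * c * X * (2 * (J.+1 - k0)%:R)); last by ring.
    by rewrite ler_wpM2l// !mulr_ge0// ltW.
  apply: (@le_trans _ _ (2 * (M * (t * J.+1%:R)))); first by rewrite ler_wpM2l.
  rewrite (_ : t * _ * (2 * p * M) = 2 * (M * (t * J.+1%:R)) * p); last by ring.
  by rewrite ler_peMr ?(le_trans _ p2) ?ler1n// !mulr_ge0// ltW.
set w := t `^ _ in hS.
have w1 : 2 ^+ J * w <= 1.
  have -> : 2 ^+ J = (p ^+ J) `^ (2 * s)^-1.
    have -> : (p ^+ J) `^ (2 * s)^-1 = 4 `^ (2^-1 * J%:R).
      rewrite (_ : 2^-1 * J%:R = s * J%:R * (2 * s)^-1); last by field; rewrite gt_eqF.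
      by rewrite [RHS]powRrM [4 `^ (s * _)]powRrM powR_mulrn ?powR_ge0.
    by rewrite powRrM s4 powR_mulrn.
  rewrite -powRM ?exprn_ge0 ?(ltW p0) ?(ltW t0)// mulrC.
  rewrite [leRHS](_ : 1 = 1 `^ (2 * s)^-1); last by rewrite powR1.
  apply: ge0_ler_powR => //.
  - by rewrite invr_ge0 mulr_ge0// ltW.
  - by rewrite nnegrE mulr_ge0 ?exprn_ge0// ltW.
  - by rewrite nnegrE.
have h1 : c * t * (p ^+ J * e_ J) <= M * w.
  apply: le_trans hS; rewrite ler_wpM2l ?mulr_ge0 ?(ltW c0) ?(ltW t0)//.
  by rewrite big_ord_recr /= lerDr sumr_ge0.
have h2 : c * e_ J <= p * (M * w).
  apply: le_trans (ler_wpM2l (ltW p0) h1).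
  rewrite (_ : p * _ = t * p ^+ J.+1 * (c * e_ J)); last by rewrite exprS; ring.
  by rewrite ler_peMl ?(ltW tJ1)// mulr_ge0// ltW.
rewrite ler_pdivlMr//; apply: (@le_trans _ _ (2 ^+ J * (c * e_ J))).
  by rewrite mulrCA [X * c]mulrC ler_wpM2l ?(ltW c0)// hX.
apply: (@le_trans _ _ (2 ^+ J * (p * (M * w)))); first by rewrite ler_wpM2l// exprn_ge0.
have pM : 0 <= p * M by rewrite mulr_ge0// ltW.
rewrite (_ : _ * (p * _) = p * M * (2 ^+ J * w)); last by ring.
by apply: (@le_trans _ _ (p * M)); [rewrite ler_piMr|rewrite -mulrA; lra].
Qed.

End scales.

(** * Bounds along the sequence and in the limit *)

Section uniform_bounds.
Variables (R : realType) (n : nat).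
Local Notation mu := (@leb R n).

Lemma sqnormZ (a : R) (x : 'rV[R]_n) : sqnorm (a *: x) = a ^+ 2 * sqnorm x.
Proof.
rewrite /sqnorm /dotrV mulr_sumr; apply: eq_bigr => i _; rewrite !mxE; ring.
Qed.

(** Walking from [0] to [h] in [2 ^+ (j - k0)] steps of the fine scale. *)
Lemma moved_le_fine_scale (E : set 'rV[R]_n) (h : 'rV[R]_n) (k0 j : nat) :
  measurable (E : set (borel_rV R n)) -> (mu E < +oo)%E -> (k0 <= j)%N -> sqnorm h <= 4 ^- k0 ->
  (moved E h <= (gauss_const R n * 2 ^- k0 * (2 ^+ j * fine (gauss_energy (4 ^- j) E)))%:E)%E.
Proof.
move=> bE Eoo kj hk; have mE := measurable_borel_leb bE.
set m := (j - k0)%N; set h' := 2 ^- m *: h.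
have u0 : 0 < 4 ^- j :> R by rewrite invr_gt0 exprn_gt0.
have q0 k : 0 < 2 ^+ k :> R by rewrite exprn_gt0.
have jE : (j = m + k0)%N by rewrite subnK.
have h'j : sqnorm h' <= 4 ^- j.
  rewrite sqnormZ jE exprD invfM (_ : (2 ^- m) ^+ 2 = 4 ^- m).
    by rewrite ler_wpM2l// invr_ge0 exprn_ge0.
  rewrite exprVn -exprM mulnC exprM; congr (_ ^+ _)^-1; ring.
have hE : h = h' *+ (2 ^ m).-1.+1.
  rewrite prednK ?expn_gt0// /h' -scaler_nat scalerA natrX mulfV ?scale1r//.
rewrite hE; apply: le_trans (moved_mulrn _ _ mE) _; rewrite prednK ?expn_gt0//.
apply: (@le_trans _ _ ((2 ^ m)%:R%:E * ((gauss_const R n)%:E * gauss_energy (4 ^- j) E))%E).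
  by rewrite lee_wpmul2l ?lee_fin//; exact: moved_le_gauss_energy.
rewrite (gauss_energy_fin mE Eoo u0) -!EFinM lee_fin natrX {2}jE exprD.
set G := gauss_const R n; set f := fine _; set a := 2 ^+ m; set b := 2 ^+ k0.
rewrite (_ : G * b^-1 * (a * b * f) = a * (G * f))//; field.
by rewrite gt_eqF// q0.
Qed.

Section family.
Variables (s : R) (t : nat -> R) (B : nat -> set 'rV[R]_n) (M V : R).
Hypotheses (s01 : 0 < s < 1) (t01 : forall i, 0 < t i < 1) (t_cvg0 : t @ \oo --> (0 : R)).
Hypotheses (bB : forall i, measurable (B i : set (borel_rV R n))).
Hypotheses (V0 : 0 <= V) (BV : forall i, (mu (B i) <= V%:E)%E) (M0 : 0 <= M).
Hypothesis energy_le : forall i, (frac_heat_energy s (t i) (B i) <= (M * scaling s (t i))%:E)%E.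

Local Notation p := ((4 : R) `^ s).

Let mB i : measurable (B i : set (lebesgue_rV R n)) := measurable_borel_leb (bB i).

Let Boo i : (mu (B i) < +oo)%E. Proof. by apply: le_lt_trans (BV i) _; rewrite ltry. Qed.

Let e i j := fine (gauss_energy (4 ^- j) (B i)).

Let u0 j : 0 < (4 : R) ^- j. Proof. by rewrite invr_gt0 exprn_gt0. Qed.

Let e0 i j : 0 <= e i j. Proof. by apply: fine_ge0; exact: gauss_energy_ge0. Qed.

Let p0 : 0 < p. Proof. by rewrite powR_gt0. Qed.

Let tsmall tau : 0 < tau -> exists I : nat, forall i, (I <= i)%N -> t i <= tau.
Proof.
move=> tau0; have /cvgrPdist_le /(_ _ tau0) [I _ hI] := t_cvg0; exists I => i Ii.
by have := hI i Ii; rewrite /= sub0r normrN => /ler_normlW.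
Qed.

Let constant : exists2 c, 0 < c & forall i J, t i * p ^+ J <= 1 ->
  c * t i * \sum_(j < J.+1) p ^+ j * e i j <= M * scaling s (t i).
Proof.
have [c c0 hc] := dyadic_gauss_energy_le s01 n; exists c => // i J tJ.
have /andP[ti0 _] := t01 i.
by rewrite -lee_fin; apply: le_trans (hc (B i) (t i) J (mB i) (Boo i) ti0 tJ) (energy_le i).
Qed.

Lemma dyadic_sums_bounded : s < 2^-1 -> exists C, forall J, exists I : nat,
  forall i, (I <= i)%N -> \sum_(j < J.+1) p ^+ j * fine (gauss_energy (4 ^- j) (B i)) <= C.
Proof.
move=> s12; have [c c0 hc] := constant; exists (M / c) => J.
have [I hI] := @tsmall (p ^- J) ltac:(by rewrite invr_gt0 exprn_gt0).
exists I => i Ii; have /andP[ti0 _] := t01 i.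
have tJ : t i * p ^+ J <= 1 by rewrite -ler_pdivlMr ?exprn_gt0// mul1r; exact: hI.
have := hc i J tJ; rewrite /scaling s12 => h.
rewrite ler_pdivlMr// -(ler_pM2l ti0).
by apply: le_trans _ (le_trans h _); [rewrite le_eqVlt; apply/orP; left; apply/eqP; rewrite /e; ring|rewrite mulrC].
Qed.

Lemma moved_bounded : 2^-1 <= s -> exists2 C, 0 <= C & forall k : nat, exists I : nat,
  forall i, (I <= i)%N -> forall h : 'rV[R]_n, sqnorm h <= 4 ^- k ->
  (moved (B i) h <= (C * 2 ^- k)%:E)%E.
Proof.
move=> s12; have /andP[s0 s1] := s01; have [c c0 hc] := constant.
have G0 := gauss_const_gt0 R n; set G := gauss_const R n in G0.
exists (G * (2 * p * M / c)).
  by rewrite mulr_ge0 ?(ltW G0)// divr_ge0 ?(ltW c0)// !mulr_ge0// ltW.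
move=> k; have [|tau tau0 htau] := @coarse_scale_bound R s c M k _ c0 M0; first by rewrite s12.
have [I hI] := tsmall tau0; exists I => i Ii h hk.
have mf : moved (B i) h = (fine (moved (B i) h))%:E.
  by rewrite fineK// ge0_fin_numE//; exact: le_lt_trans (moved_le (bB i) h) (Boo i).
have q0 : 0 < 2 ^- k :> R by rewrite invr_gt0 exprn_gt0.
have Gq : 0 < G * 2 ^- k by rewrite mulr_gt0.
have d0 : 0 <= fine (moved (B i) h) by exact: fine_ge0.
rewrite mf lee_fin mulrAC mulrC -ler_pdivrMr//.
apply: (htau (t i) (e i) _ (t01 i) (hI _ Ii) (e0 i) _ (hc i)).
  by rewrite divr_ge0// ltW.
move=> j kj; rewrite ler_pdivrMr// mulrC -lee_fin -mf.
exact: moved_le_fine_scale.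
Qed.

(** For [s < 2^-1] a single term of the dyadic sums decays like [p ^- j];
    otherwise small translation defects make the Gaussian energy small. *)
Lemma gauss_energy_eventually_small eps : 0 < eps -> exists2 u, 0 < u & exists I : nat,
  forall i, (I <= i)%N -> (gauss_energy u (B i) <= eps%:E)%E.
Proof.
move=> eps0; have [s12|s12] := leP (2^-1) s; last first.
  have [C hC] := dyadic_sums_bounded s12.
  have p1 : 1 < p by apply: powR_base_gt1 => //; rewrite ltr1n.
  have [j Cj] : exists j : nat, C <= eps * p ^+ j.
    have [j hj] := exists_exprn_ge (C / eps) p1; exists j.
    by rewrite mulrC -ler_pdivrMr.
  exists (4 ^- j) => //; have [I hI] := hC j; exists I => i Ii.
  rewrite (gauss_energy_fin (mB i) (Boo i) (u0 j)) lee_fin -/(e i j).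
  rewrite -(ler_pM2r (exprn_gt0 j p0)); apply: le_trans Cj; apply: le_trans (hI i Ii).
  rewrite big_ord_recr /= mulrC lerDr sumr_ge0// => l _.
  by rewrite mulr_ge0 ?exprn_ge0 ?(ltW p0)//; exact: e0.
have [C C0 hC] := moved_bounded s12.
have [k hk] := geometric_small C (divr_gt0 eps0 (ltr0n _ 2)).
have [I hI] := hC k; set r := 4 ^- k : R; have r0 : 0 < r := u0 k.
set W := V * Num.sqrt 2 ^+ n; have W0 : 0 <= W by rewrite mulr_ge0// exprn_ge0// sqrtr_ge0.
have W10 : 0 < W + 1 by rewrite ltr_wpDl.
(* Chosen so that [expR (- x) <= x^-1] bounds the tail by [eps / 2]. *)
pose u := eps * r / (16 * (W + 1)).
have uu : 0 < u by rewrite divr_gt0 ?mulr_gt0.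
exists u => //; exists I => i Ii.
apply: le_trans (gauss_energy_le_moved (bB i) uu _ V0 (BV i) (hI i Ii)) _.
  by rewrite mulr_ge0// invr_ge0 exprn_ge0.
rewrite lee_fin [leRHS]splitr lerD ?hk// -/W -/r.
have x0 : 0 < r / (8 * u) by apply: divr_gt0 => //; exact: mulr_gt0.
have hx : expR (- (r / (8 * u))) <= (r / (8 * u))^-1.
  rewrite expRN lef_pV2 ?posrE ?expR_gt0//; have := expR_ge1Dx (r / (8 * u)); lra.
apply: le_trans (ler_wpM2l W0 hx) _.
rewrite (_ : (r / (8 * u))^-1 = eps / 2 / (W + 1)); last first.
  by rewrite /u; field; rewrite !gt_eqF.
by rewrite mulrCA ler_piMr ?divr_ge0 ?(ltW eps0)// ler_pdivrMr// mul1r lerDl.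
Qed.

Section limit.
Variables (F : set 'rV[R]_n) (phi : nat -> nat).
Hypotheses (bF : measurable (F : set (borel_rV R n))) (Foo : (mu F < +oo)%E).
Hypotheses (phi_ge : forall k, (k <= phi k)%N).
Hypothesis phiF : forall k, (mu (symdiff (B (phi k)) F) <= (2 * 2 ^- k)%:E)%E.

Let mF : measurable (F : set (lebesgue_rV R n)) := measurable_borel_leb bF.

Let diffF k : (mu (F `\` B (phi k)) + mu (B (phi k) `\` F) <= (4 * 2 ^- k)%:E)%E.
Proof.
have mD := measurable_symdiff (mB (phi k)) mF.
have h (D : set (lebesgue_rV R n)) : measurable D -> D `<=` symdiff (B (phi k)) F ->
    (mu D <= (2 * 2 ^- k)%:E)%E.
  by move=> mD' sD; apply: le_trans (phiF k); apply: le_measure; rewrite ?inE.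
rewrite (_ : 4 * 2 ^- k = 2 * 2 ^- k + 2 * 2 ^- k); last by ring.
rewrite EFinD; apply: leeD; apply: h; try exact: measurableD.
- by move=> x; right.
- by move=> x; left.
Qed.

Lemma moved_limit (h : 'rV[R]_n) a (I : nat) :
  (forall i, (I <= i)%N -> (moved (B i) h <= a%:E)%E) -> (moved F h <= a%:E)%E.
Proof.
move=> hI.
have mf : moved F h = (fine (moved F h))%:E.
  by rewrite fineK// ge0_fin_numE//; exact: le_lt_trans (moved_le bF h) Foo.
rewrite mf lee_fin; apply: (@le_of_geometric R _ _ 4 I) => k Ik.
rewrite -lee_fin -mf EFinD; apply: le_trans (moved_stable h (mB (phi k)) mF) _.
by apply: leeD (diffF k); apply: hI; exact: leq_trans Ik (phi_ge k).
Qed.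

Lemma gauss_sum_limit a J (I : nat) :
  (forall i, (I <= i)%N -> \sum_(j < J) p ^+ j * fine (gauss_energy (4 ^- j) (B i)) <= a) ->
  \sum_(j < J) p ^+ j * fine (gauss_energy (4 ^- j) F) <= a.
Proof.
move=> hI; apply: (@le_of_geometric R _ _ (\sum_(j < J) p ^+ j * 4) I) => k Ik.
apply: le_trans (lerD (hI (phi k) (leq_trans Ik (phi_ge k))) (lexx _)).
rewrite mulr_suml -big_split; apply: ler_sum => j _ /=.
rewrite -mulrA -mulrDr ler_wpM2l ?exprn_ge0 ?(ltW p0)//.
rewrite -lee_fin EFinD -(gauss_energy_fin mF Foo (u0 j)) -(gauss_energy_fin (mB (phi k)) (Boo (phi k)) (u0 j)).
have dk := diffF k.
apply: le_trans (gauss_energy_stable (u0 j) (bB (phi k)) bF _) _.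
  by apply: le_lt_trans dk _; rewrite ltry.
by rewrite leeD2l.
Qed.

Lemma limit_frac_perimeter : s < 2^-1 -> (frac_perimeter s F < +oo)%E.
Proof.
move=> s12; have [C hC] := dyadic_sums_bounded s12.
apply: (frac_perimeter_lty s01 (B := C) bF Foo) => J.
have [I hI] := hC J; apply: (@gauss_sum_limit C J I) => i Ii.
apply: le_trans (hI i Ii); rewrite big_ord_recr /= lerDl.
by rewrite mulr_ge0 ?exprn_ge0 ?(ltW p0)//; exact: e0.
Qed.

Lemma limit_perimeter : 2^-1 <= s -> (perimeter F < +oo)%E.
Proof.
move=> s12; have [C C0 hC] := moved_bounded s12.
apply: (@perimeter_lty R n F (2 * C) mF Foo); first by rewrite mulr_ge0.
move=> j r /andP[r0 r1].
have ex : exists k : nat, 2 ^- k < r.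
  have [k hk] := exists_natpow_gt r^-1; exists k.
  by rewrite -[r]invrK ltf_pV2 ?posrE ?exprn_gt0 ?invr_gt0.
have := ex_minnP ex; case=> -[|k]; first by rewrite expr0 invr1 ltNge r1.
move=> kr mink.
have rk : r <= 2 ^- k by rewrite leNgt; apply/negP => /mink; rewrite ltnn.
have [I hI] := hC k.
have sh : sqnorm (r *: delta_mx 0 j : 'rV[R]_n) <= 4 ^- k.
  rewrite sqnormZ (_ : sqnorm _ = 1) ?mulr1.
    rewrite (_ : 4 ^- k = (2 ^- k) ^+ 2).
      by apply: lerXn2r; rewrite ?nnegrE ?(ltW r0)// invr_ge0 exprn_ge0.
    by rewrite exprVn -exprM mulnC exprM; congr (_ ^+ _)^-1; ring.
  rewrite /sqnorm /dotrV (bigD1 j)//= big1 ?addr0; last first.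
    by move=> i ij; rewrite !mxE (negbTE ij) andbF mul0r.
  by rewrite !mxE !eqxx mulr1.
apply: le_trans (moved_limit (fun i Ii => hI i Ii _ sh)) _.
rewrite lee_fin (_ : 2 * C * r = C * (2 * r)); last by ring.
rewrite ler_wpM2l// (_ : 2 ^- k = 2 * 2 ^- k.+1); first by rewrite ler_wpM2l// ltW.
by rewrite exprS; field; rewrite gt_eqF// exprn_gt0.
Qed.

End limit.

Lemma exists_limit (U : set 'rV[R]_n) : measurable (U : set (borel_rV R n)) ->
  bounded_set U -> (mu U < +oo)%E -> (forall i, B i `<=` U) ->
  exists (F : set 'rV[R]_n) (phi : nat -> nat),
    [/\ measurable (F : set (borel_rV R n)), F `<=` U, {homo phi : i j / (i < j)%N} &
      forall k, (mu (symdiff (B (phi k)) F) <= (2 * 2 ^- k)%:E)%E].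
Proof.
move=> bU Ubd Uoo BU.
have [G [UG ooG]] := @ultraFilterLemma nat \oo _.
have Gtail (I : nat) : G [set i | (I <= i)%N] by apply: ooG; exists I.
have small eps : 0 < eps -> exists2 u, 0 < u & G [set i | (gauss_energy u (B i) <= eps%:E)%E].
  move=> eps0; have [u uu [I hI]] := gauss_energy_eventually_small eps0.
  by exists u => //; apply: filterS (Gtail I) => i; exact: hI.
have close := energy_compactness UG bU Ubd Uoo bB BU small.
have [|k|phi phi_inc hphi] := @ultra_subsequence G UG
    (fun k i j => (mu (symdiff (B i) (B j)) <= (2 ^- k)%:E)%E).
- by move=> N; exact: (Gtail N.+1).
- by apply: close; rewrite invr_gt0 exprn_gt0.
exists (limsup_sets (fun k => B (phi k))), phi; split=> //.
- exact: (@measurable_limsup_sets _ (borel_rV R n) (fun k => B (phi k)) (fun k => bB (phi k))).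
- by move=> x /(_ 0%N I) [k _ /BU].
- by move=> k; exact: (@measure_symdiff_limsup _ _ R mu (fun k => B (phi k)) (fun k => mB (phi k)) k hphi).
Qed.

End family.
End uniform_bounds.

(** * From Lebesgue to Borel sets, and the theorem *)

Section reduction.
Variables (R : realType) (n : nat).
Local Notation mu := (@leb R n).

Lemma leb_bounded_lty (U : set 'rV[R]_n) : measurable (U : set (lebesgue_rV R n)) ->
  bounded_set U -> (mu U < +oo)%E.
Proof.
move=> mU [N [_ hN]].
have [k Nk] : exists k : nat, N < k%:R.
  by exists (Num.truncn N).+1; exact: truncnS_gt.
apply: le_lt_trans (leb_cube_lty R n k); apply: le_measure; rewrite ?inE //.
  by apply: measurable_borel_leb; exact: measurable_cube.
move=> x /hN xk i; exact: le_trans (normr_entry_le x i) (xk _ Nk).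
Qed.

(** With this, the energies of the given sets are those of their Borel
    envelopes. *)
Lemma frac_heat_energy_null s t (A B : set (lebesgue_rV R n)) : 0 < s < 1 -> 0 < t ->
  measurable A -> measurable B -> A `<=` B -> mu (B `\` A) = 0%E ->
  frac_heat_energy s t A = frac_heat_energy s t B.
Proof.
move=> s01 t0 mA mB AB BA0.
have mk := measurable_kernel_diff (@measurable_heat_kernel R n s t s01 t0).
have := double_integral_null mA mB mk (fun _ => heat_kernel_ge0 s01 t0 _) AB BA0.
have E (D : set (lebesgue_rV R n)) : frac_heat_energy s t D = (\int[mu]_(x in D) \int[mu]_(y in ~` D)
    (fourier_kernel (stretched_symbol s t) ((x : 'rV[R]_n) - y))%:E)%E.
  by apply: eq_integral => x _; apply: eq_integral => y _; rewrite frac_heat_kernelE.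
by rewrite !E.
Qed.

Lemma scaling_gt0 (s t : R) : 0 < t < 1 -> 0 < scaling s t.
Proof.
move=> /andP[t0 t1]; rewrite /scaling; case: ifP => _ //; case: ifP => _.
  by rewrite mulr_gt0// normr_gt0 lt_eqF// ln_lt0// t0.
by rewrite powR_gt0.
Qed.

Lemma Lnorm1_indic_diff (A B : set (lebesgue_rV R n)) : measurable A -> measurable B ->
  ('N[mu]_1[(fun x => (\1_A x - \1_B x)%:E)] = mu (symdiff A B))%E.
Proof.
move=> mA mB; rewrite Lnorm1.
rewrite -[RHS]/(mu (symdiff A B)) -[symdiff A B]setIT -integral_indic//; last exact: measurable_symdiff.
apply: eq_integral => x _; rewrite /= !indicE; congr EFin.
have -> : (x \in symdiff A B) = (x \in A) (+) (x \in B).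
  by rewrite /symdiff in_setU !in_setD; case: (x \in A); case: (x \in B).
by case: (x \in A); case: (x \in B); rewrite /= ?subrr ?subr0 ?sub0r ?normrN ?normr1 ?normr0.
Qed.

End reduction.

Theorem theorem2p1 (R : realType) (n : nat) (n_ge2 : (2 <= n)%N)
    (s : R) (s01 : 0 < s < 1)
    (U : set 'rV[R]_n) (U_open : open U) (U_bounded : bounded_set U)
    (t : nat -> R) (t01 : forall i, 0 < t i < 1) (t_cvg0 : t @ \oo --> (0 : R))
    (E : nat -> set (lebesgue_rV R n))
    (E_measurable : forall i, measurable (E i))
    (E_sub : forall i, E i `<=` U)
    (M : R)
    (energy_le : forall i,
      (frac_heat_energy s (t i) (E i) / (scaling s (t i))%:E <= M%:E)%E) :
  exists F : set (lebesgue_rV R n),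
    [/\ measurable F,
        F `<=` U,
        exists phi : nat -> nat, {homo phi : i j / (i < j)%N} /\
          ('N[leb]_1[(fun x => (\1_(E (phi k)) x - \1_F x)%:E)])%E @[k --> \oo] --> 0%E,
        s < 2^-1 -> (frac_perimeter s F < +oo)%E &
        2^-1 <= s -> (perimeter F < +oo)%E].
Proof.
have bU := measurable_open U_open; have mU := measurable_borel_leb bU.
have Uoo := leb_bounded_lty mU U_bounded.
have Eoo i : (leb (E i) < +oo)%E.
  by apply: le_lt_trans Uoo; apply: le_measure; rewrite ?inE.
have [B hB] := choice (fun i => borel_envelope U_open (@E_sub i) (E_measurable i) (Eoo i)).
have bB i : measurable (B i : set (borel_rV R n)) by case: (hB i).
have mB i := measurable_borel_leb (bB i).
have EB i : E i `<=` B i by case: (hB i).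
have BU i : B i `<=` U by case: (hB i).
have BE0 i : leb (B i `\` E i) = 0%E by case: (hB i).
have heat_le i : (frac_heat_energy s (t i) (B i) <= (`|M| * scaling s (t i))%:E)%E.
  have /andP[ti0 _] := t01 i; have g0 := scaling_gt0 s (t01 i).
  rewrite -(frac_heat_energy_null s01 ti0 (E_measurable i) (mB i) (@EB i) (BE0 i)).
  have := energy_le i; rewrite inver (gt_eqF g0) lee_pdivrMr// => /le_trans; apply.
  by rewrite -EFinM lee_fin ler_wpM2r ?(ltW g0)// ler_norm.
have UV : leb U = (fine (leb U))%:E by rewrite fineK// ge0_fin_numE.
have V0 : 0 <= fine (leb U) by exact: fine_ge0.
have BV i : (leb (B i) <= (fine (leb U))%:E)%E.
  by rewrite -UV; apply: le_measure; rewrite ?inE.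
have [F [phi [bF FU phi_inc hphi]]] :=
  exists_limit s01 t01 t_cvg0 bB V0 BV (normr_ge0 M) heat_le bU U_bounded Uoo BU.
have mF := measurable_borel_leb bF.
have Foo : (leb F < +oo)%E by apply: le_lt_trans Uoo; apply: le_measure; rewrite ?inE.
have phi_ge k : (k <= phi k)%N.
  by elim: k => // k IH; exact: leq_ltn_trans IH (phi_inc _ _ (ltnSn k)).
exists F; split.
- exact: mF.
- exact: FU.
- exists phi; split=> //.
  have dist_le k : (leb (symdiff (E (phi k)) F) <= (2 * 2 ^- k)%:E)%E.
    have m1 := measurable_symdiff (mB (phi k)) mF.
    have m2 := measurableD (mB (phi k)) (E_measurable (phi k)).
    apply: (@le_trans _ _ (leb (symdiff (B (phi k)) F `|` (B (phi k) `\` E (phi k))))).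
      apply: le_measure; rewrite ?inE.
      - exact: measurable_symdiff.
      - exact: measurableU.
      - move=> x [[Ex nF]|[Fx nE]]; first by left; left; split => //; exact: EB.
        by have [Bx|nB] := pselect (B (phi k) x); [right|left; right].
    apply: (@le_trans _ _ (leb (symdiff (B (phi k)) F) + leb (B (phi k) `\` E (phi k)))%E).
      exact: measureU2.
    by rewrite BE0 adde0.
  under eq_fun do rewrite Lnorm1_indic_diff//.
  apply: (@squeeze_cvge _ _ _ _ (cst 0%E) _ (fun k => (2 * 2 ^- k)%:E)).
  + by apply: nearW => k; rewrite measure_ge0 dist_le.
  + exact: cvg_cst.
  + apply: cvg_EFin; first exact: nearW.
    apply/cvgrPdist_le => eps eps0; have [K hK] := geometric_small 2 eps0.
    exists K => // k Kk; rewrite sub0r normrN ger0_norm ?hK//.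
    by rewrite mulr_ge0// invr_ge0 exprn_ge0.
- exact: (limit_frac_perimeter s01 t01 t_cvg0 bB BV heat_le bF Foo phi_ge hphi).
- exact: (limit_perimeter s01 t01 t_cvg0 bB BV (normr_ge0 M) heat_le bF Foo phi_ge hphi).
Qed.
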